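(* Let $q\ge 1$ be an integer and let $P, Q, R \in \mathbf{C}^{N\times N}$ be pairwise commuting matrices such that $Q$, $R$ and $R-Q$ are positive stable. Then for every $z\in\mathbf{C}$ with $|z|<1$, $${}_{q+1}F_q\left(P,\tfrac{Q}{q},\tfrac{Q+I}{q},\dots,\tfrac{Q+(q-1)I}{q};\tfrac{R}{q},\tfrac{R+I}{q},\dots,\tfrac{R+(q-1)I}{q};z\right) = \Gamma(R)\,\Gamma(Q)^{-1}\,\Gamma(R-Q)^{-1} \int_0^1 u^{Q-I} (1-u)^{R-Q-I} (1-zu^q)^{-P}\, du.$$
   Context: $\mathbf{C}^{N\times N}$ is the space of complex $N\times N$ matrices, $I$ is the identity matrix. A matrix $A\in\mathbf{C}^{N\times N}$ is positive stable if $\Re(\lambda)>0$ for every eigenvalue $\lambda$ of $A$. For a positive stable matrix $A$, $\Gamma(A)=\int_0^\infty e^{-t}t^{A-I}\,dt$. For a scalar $c$, $c^{A}=\exp(A\log c)$, with the real logarithm for $c>0$ and the principal logarithm for other complex $c$. The matrix Pochhammer symbol is $(A)_0=I$, $(A)_m=A(A+I)\cdots(A+(m-1)I)$ for $m\ge 1$. The generalized hypergeometric matrix function is defined by $${}_rF_s(P_1,\dots,P_r;Q_1,\dots,Q_s;z)=\sum_{m=0}^\infty \frac{(P_1)_m\cdots(P_r)_m(Q_1)_m^{-1}\cdots(Q_s)_m^{-1}}{m!}z^m,$$ where $P_i,Q_j\in\mathbf{C}^{N\times N}$ and each $Q_j+mI$ is invertible for all integers $m\ge 0$. *)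

(* Defs.v *)
From HB Require Import structures.
From mathcomp Require Import all_boot all_order all_algebra.
From mathcomp Require Import complex.
From mathcomp Require Import all_classical all_reals all_analysis.
Set Implicit Arguments.
Unset Strict Implicit.
Unset Printing Implicit Defensive.
Import Order.TTheory GRing.Theory Num.Theory.
Import numFieldNormedType.Exports.
Local Open Scope complex_scope.
Local Open Scope classical_set_scope.
Local Open Scope ring_scope.

Local Notation Re := (@complex.Re _).
Local Notation Im := (@complex.Im _).

(* The library attaches topologies to abstract numeric fields only; this makes
   the modulus topology canonical on K[i], hence also on 'M[K[i]]_N. *)
HB.instance Definition _ (K : realType) := NormedModule.copy K[i] (K[i]^o).

Section ComplexLog.
Variable K : realType.
Implicit Type z : K[i].

Definition cmod z : K := Re `|z|.

(* The principal argument, with values in ]-pi, pi] for z != 0. *)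
Definition carg z : K :=
  let t := acos (Re z / cmod z) in if 0 <= Im z then t else - t.

Definition clog z : K[i] := ln (cmod z) +i* carg z.

Lemma clog_real (x : K) : 0 < x -> clog x%:C = (ln x)%:C.
Proof.
move=> x0; have cx : cmod x%:C = x by rewrite /cmod ger0_norm ?lecR ?ltW.
by rewrite /clog /carg cx /= lexx divff ?gt_eqF// acos1.
Qed.

End ComplexLog.

Section MatrixFunctions.
Variables (K : realType) (N : nat).
Implicit Types (A : 'M[K[i]]_N) (D : set K) (F : K -> 'M[K[i]]_N).

Definition positive_stable A :=
  forall a : K[i], eigenvalue A a -> 0 < Re a.

Definition mxexp A : 'M[K[i]]_N :=
  limn (series (fun k => (k`!%:R)^-1 *: A ^+ k)).

Definition cpowmx (c : K[i]) A : 'M[K[i]]_N := mxexp (clog c *: A).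

Definition mxintegrable D F :=
  forall i j,
    (@lebesgue_measure K).-integrable D (fun x => (Re (F x i j))%:E) /\
    (@lebesgue_measure K).-integrable D (fun x => (Im (F x i j))%:E).

Definition mxintegral D F : 'M[K[i]]_N :=
  \matrix_(i, j)
    ((\int[@lebesgue_measure K]_(x in D) Re (F x i j))
     +i* (\int[@lebesgue_measure K]_(x in D) Im (F x i j))).

Definition mxGamma A : 'M[K[i]]_N :=
  mxintegral `]0, +oo[
    (fun t => (expR (- t))%:C *: cpowmx t%:C (A - 1%:M)).

Definition mxpoch A (m : nat) : 'M[K[i]]_N := \prod_(k < m) (A + k%:R%:M).

Definition hyp_term (Ps Qs : seq 'M[K[i]]_N) (z : K[i]) (m : nat) :
    'M[K[i]]_N :=
  (z ^+ m / m`!%:R) *: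
    ((\prod_(A <- Ps) mxpoch A m) *m (\prod_(B <- Qs) invmx (mxpoch B m))).

Definition hyp (Ps Qs : seq 'M[K[i]]_N) (z : K[i]) : 'M[K[i]]_N :=
  limn (series (hyp_term Ps Qs z)).

(* A/q, (A+I)/q, ..., (A+(q-1)I)/q *)
Definition mxsplit (q : nat) A : seq 'M[K[i]]_N :=
  [seq q%:R^-1 *: (A + k%:R%:M) | k <- iota 0 q].

End MatrixFunctions.

(* Main.v *)
Require Import Defs.
From HB Require Import structures.
From mathcomp Require Import all_boot all_order all_algebra.
From mathcomp Require Import complex.
From mathcomp Require Import all_classical all_reals all_analysis.
From mathcomp Require Import measurable_realfun.
From mathcomp Require Import ring lra.
Set Implicit Arguments.
Unset Strict Implicit.
Unset Printing Implicit Defensive.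
Import Order.TTheory GRing.Theory Num.Theory.
Import numFieldNormedType.Exports.
Local Open Scope complex_scope.
Local Open Scope classical_set_scope.
Local Open Scope ring_scope.

(** Write S = R - Q. By the binomial series, (1 - z u^q)^(-P) is the sum over k
    of (P)_k (z u^q)^k / k!, so by dominated convergence the integral is the
    sum of the (P)_k z^k / k! B(Q + q k, S), B(Q, S) being the Beta integral.
    Integrating by parts, (Q)_n B(Q, S) = (Q + S)_n B(Q + n, S); for n = q k
    the symbols (Q)_n and (R)_n split into those of the (Q + j I)/q and the
    (R + j I)/q, and the integral is B(Q, S) times the hypergeometric series.
    Finally Gamma(R) B(Q, S) = Gamma(Q) Gamma(S) follows from the same
    recursion and Gauss' limit Gamma(S) = lim n^S B(Q + n, S), which is the
    rescaling u = 1 - t/n in the Beta integral.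

    The binomial series and the addition law of the exponential come from
    linear differential equations in a real parameter. Integrability rests on
    the decay of exp(-s A) for a positive stable A, which is obtained from
    Cayley-Hamilton by removing one linear factor at a time. *)

(** The matrices need not be diagonalisable, so nothing reduces to scalar Gamma and Beta functions:
    every identity is proved for matrices, with commutation tracked explicitly. The [ring_*] lemmas
    isolate these rearrangements in arbitrary noncommutative rings or algebras. All analysis runs
    over one real variable, with estimates in a submultiplicative real-valued norm. The quotient of
    Gamma matrices hides the main obstacle. [invmx] returns a singular matrix unchanged, so Gamma(Q)
    and Gamma(S) must be shown invertible, about which their integrals say nothing directly. For
    this the Gauss limit is read a second time, with Q = I, as a product formula for Gamma whose
    inverse factors stay bounded. B(Q, S) itself is never inverted: it remains a left factor until
    the Gamma quotient removes it. Every dominating function is a constant multiple of one with an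
    explicit bounded antiderivative, so integrability presupposes no Gamma or Beta value. Sizes are
    m + 1 until the very end, because matrices form a nontrivial ring only in nonzero size. *)

Local Notation Re := (@complex.Re _).
Local Notation Im := (@complex.Im _).

(** * Real-valued modulus on the complex numbers *)

Section Modulus.
Variable K : realType.
Implicit Types x y : K[i].

Lemma cmodC x : (cmod x)%:C = `|x|.
Proof. by rewrite /cmod normc_def. Qed.

Lemma cmod_ge0 x : 0 <= cmod x.
Proof. by rewrite -ler0c cmodC. Qed.

Lemma cmodM x y : cmod (x * y) = cmod x * cmod y.
Proof. by apply: complexI; rewrite rmorphM /= !cmodC normrM. Qed.

Lemma cmodD x y : cmod (x + y) <= cmod x + cmod y.
Proof. by rewrite -lecR rmorphD /= !cmodC ler_normD. Qed.

Lemma cmodN x : cmod (- x) = cmod x.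
Proof. by apply: complexI; rewrite !cmodC normrN. Qed.

Lemma cmod_real (a : K) : cmod a%:C = `|a|.
Proof. by rewrite /cmod normc_def /= expr0n addr0 sqrtr_sqr. Qed.

Lemma cmod0 : cmod (0 : K[i]) = 0.
Proof. by rewrite cmod_real normr0. Qed.

Lemma cmod1 : cmod (1 : K[i]) = 1.
Proof. by rewrite cmod_real normr1. Qed.

Lemma cmodE x : cmod x = Num.sqrt (Re x ^+ 2 + Im x ^+ 2).
Proof. by rewrite /cmod normc_def. Qed.

Lemma cmod_eq0 x : cmod x = 0 -> x = 0.
Proof. by move=> x0; apply/normr0_eq0; rewrite -cmodC x0. Qed.

Lemma normRe_cmod x : `|Re x| <= cmod x.
Proof. by rewrite -lecR cmodC normc_ge_Re. Qed.

Lemma normIm_cmod x : `|Im x| <= cmod x.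
Proof.
rewrite cmodE -sqrtr_sqr ler_wsqrtr// lerDr sqr_ge0 //.
Qed.

Lemma cmod_ReIm x : cmod x <= `|Re x| + `|Im x|.
Proof.
rewrite cmodE -[leRHS]ger0_norm ?addr_ge0// -sqrtr_sqr ler_wsqrtr//.
by rewrite sqrrD !real_normK ?num_real// lerD2r lerDl mulrn_wge0// mulr_ge0.
Qed.

Lemma cmodX x n : cmod (x ^+ n) = cmod x ^+ n.
Proof. by elim: n => [|n IH]; rewrite ?expr0 ?cmod1// !exprS cmodM IH. Qed.

Lemma cmodV x : cmod x^-1 = (cmod x)^-1.
Proof. by apply: complexI; rewrite fmorphV /= !cmodC normfV. Qed.

Lemma cmod_sum (I : Type) (r : seq I) (P : pred I) (f : I -> K[i]) :
  cmod (\sum_(i <- r | P i) f i) <= \sum_(i <- r | P i) cmod (f i).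
Proof.
elim/big_rec2: _ => [|i a b _ h]; first by rewrite cmod0.
by rewrite (le_trans (cmodD _ _))// lerD2l.
Qed.

Lemma Re_sum (I : Type) (r : seq I) (P : pred I) (f : I -> K[i]) :
  Re (\sum_(i <- r | P i) f i) = \sum_(i <- r | P i) Re (f i).
Proof. exact: (big_morph (fun z : K[i] => Re z) (fun x y => raddfD _ x y) erefl). Qed.

Lemma Im_sum (I : Type) (r : seq I) (P : pred I) (f : I -> K[i]) :
  Im (\sum_(i <- r | P i) f i) = \sum_(i <- r | P i) Im (f i).
Proof. exact: (big_morph (fun z : K[i] => Im z) (fun x y => raddfD _ x y) erefl). Qed.

Lemma ReM x y : Re (x * y) = Re x * Re y - Im x * Im y.
Proof. by case: x y => [a b] [c d]. Qed.

Lemma ImM x y : Im (x * y) = Re x * Im y + Im x * Re y.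
Proof. by case: x y => [a b] [c d]; rewrite /= mulrC. Qed.

Lemma complex_cvg (u : nat -> K[i]) (l : K[i]) :
  (fun n => cmod (u n - l)) @ \oo --> (0 : K) -> u @ \oo --> l.
Proof.
move=> h; apply/cvgrPdist_lt => e e0.
(* In the order of [K[i]], [0 < e] forces the imaginary part to vanish, so every radius of the
   complex topology is real. *)
have er : e = (Re e)%:C.
  by case: e e0 => a b; rewrite ltcE /= => /andP[/eqP-> _].
have re0 : 0 < Re e by rewrite -ltcR -er.
move/cvgrPdist_lt : h => /(_ _ re0); apply: filterS => n.
by rewrite sub0r normrN ger0_norm ?cmod_ge0// -ltcR -er cmodC distrC.
Qed.

End Modulus.

Lemma cvg_sumr (K : realType) (T : Type) (F : set_system T) {FF : Filter F}
    (I : Type) (r : seq I) (f : I -> T -> K) (l : I -> K) :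
  (forall i, f i @ F --> l i) ->
  (fun k => \sum_(i <- r) f i k) @ F --> \sum_(i <- r) l i.
Proof.
move=> fl; elim: r => [|i r IH].
  by under eq_fun do rewrite big_nil; rewrite big_nil; exact: cvg_cst.
by under eq_fun do rewrite big_cons; rewrite big_cons; exact: cvgD.
Qed.

(** * A submultiplicative matrix norm and its convergence *)

Section MatrixNorm.
Variables (K : realType) (m : nat).
Local Notation M := 'M[K[i]]_m.+1.
Implicit Types (A B : M) (u v : nat -> M).

(* The library's norm on matrices is a maximum, which is not submultiplicative. *)
Definition nrm A : K := \sum_i \sum_j cmod (A i j).

Lemma nrm_ge0 A : 0 <= nrm A.
Proof. by apply: sumr_ge0 => i _; apply: sumr_ge0 => j _; exact: cmod_ge0. Qed.

Lemma nrm_entry A i j : cmod (A i j) <= nrm A.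
Proof.
rewrite /nrm (bigD1 i)//= (bigD1 j)//= -addrA lerDl addr_ge0 ?sumr_ge0//.
  by move=> *; exact: cmod_ge0.
by move=> *; apply: sumr_ge0 => *; exact: cmod_ge0.
Qed.

Lemma nrm0 : nrm 0 = 0.
Proof. by rewrite /nrm big1 // => i _; rewrite big1// => j _; rewrite mxE cmod0. Qed.

Lemma nrm_eq0 A : nrm A = 0 -> A = 0.
Proof.
move=> A0; apply/matrixP => i j; rewrite mxE; apply: cmod_eq0.
by apply/eqP; rewrite eq_le cmod_ge0 andbT -A0 nrm_entry.
Qed.

Lemma nrmD A B : nrm (A + B) <= nrm A + nrm B.
Proof.
rewrite /nrm -big_split ler_sum// => i _; rewrite -big_split ler_sum// => j _.
by rewrite mxE cmodD.
Qed.

Lemma nrmN A : nrm (- A) = nrm A.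
Proof.
by apply: eq_bigr => i _; apply: eq_bigr => j _; rewrite mxE cmodN.
Qed.

Lemma nrmB A B : nrm (A - B) = nrm (B - A).
Proof. by rewrite -nrmN opprB. Qed.

Lemma nrm_sum (I : Type) (r : seq I) (P : pred I) (F : I -> M) :
  nrm (\sum_(i <- r | P i) F i) <= \sum_(i <- r | P i) nrm (F i).
Proof.
elim/big_rec2: _ => [|i a b _ h]; first by rewrite nrm0.
by rewrite (le_trans (nrmD _ _))// lerD2l.
Qed.

Lemma nrmZ (c : K[i]) A : nrm (c *: A) = cmod c * nrm A.
Proof.
rewrite /nrm mulr_sumr; apply: eq_bigr => i _; rewrite mulr_sumr.
by apply: eq_bigr => j _; rewrite mxE cmodM.
Qed.

Lemma nrmM A B : nrm (A * B) <= nrm A * nrm B.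
Proof.
rewrite /nrm mulr_suml ler_sum// => i _.
apply: (@le_trans _ _ (\sum_j \sum_k cmod (A i k) * cmod (B k j))).
  apply: ler_sum => j _; rewrite mxE (le_trans (cmod_sum _ _ _))//.
  by apply: ler_sum => k _; rewrite cmodM.
rewrite exchange_big mulr_suml ler_sum// => k _.
rewrite -mulr_sumr ler_wpM2l ?cmod_ge0//.
rewrite [leRHS](bigD1 k)//= lerDl sumr_ge0// => i' _.
by apply: sumr_ge0 => j _; exact: cmod_ge0.
Qed.

Lemma nrm_le_sum A : nrm A <= \sum_i \sum_j (`|Re (A i j)| + `|Im (A i j)|).
Proof. by apply: ler_sum => i _; apply: ler_sum => j _; exact: cmod_ReIm. Qed.

Lemma nrm_Re A i j : `|Re (A i j)| <= nrm A.
Proof. exact: le_trans (normRe_cmod _) (nrm_entry _ _ _). Qed.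

Lemma nrm_Im A i j : `|Im (A i j)| <= nrm A.
Proof. exact: le_trans (normIm_cmod _) (nrm_entry _ _ _). Qed.

(** Phrased with a real-valued norm, so that squeezing and real limits apply; [mxcvg_cvg] passes to
    the matrix topology, which only [limn] and [cvgn] call for. *)
Definition mxcvg (u : nat -> M) (L : M) :=
  (fun k => nrm (u k - L)) @ \oo --> (0 : K).

Lemma mxcvg_squeeze (e : nat -> K) (u : nat -> M) (L : M) :
  (\forall k \near \oo, nrm (u k - L) <= e k) -> e @ \oo --> (0 : K) -> mxcvg u L.
Proof.
move=> ue e0; apply: (@squeeze_cvgr _ _ _ _ (fun=> 0) e) => //; last exact: cvg_cst.
by apply: filterS ue => k ->; rewrite nrm_ge0.
Qed.

Lemma mxcvg_cst A : mxcvg (fun=> A) A.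
Proof. by rewrite /mxcvg subrr nrm0; exact: cvg_cst. Qed.

Lemma mxcvg_uniq u A B : mxcvg u A -> mxcvg u B -> A = B.
Proof.
move=> uA uB; apply/eqP; rewrite -subr_eq0; apply/eqP/nrm_eq0/eqP.
rewrite eq_le nrm_ge0 andbT.
have h : (fun k => nrm (u k - A) + nrm (u k - B)) @ \oo --> (0 + 0 : K).
  exact: cvgD.
rewrite -[X in _ <= X]addr0 -(cvg_lim _ h)//.
apply: limr_ge; first by apply/cvg_ex; eexists; exact: h.
apply: nearW => k; rewrite (nrmB (u k) A).
by rewrite -[A - B](subrKA (u k)) nrmD.
Qed.

Lemma mxcvgD u v A B : mxcvg u A -> mxcvg v B -> mxcvg (fun k => u k + v k) (A + B).
Proof.
move=> uA vB; apply: (@mxcvg_squeeze (fun k => nrm (u k - A) + nrm (v k - B))).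
  by apply: nearW => k; rewrite opprD addrACA nrmD.
by rewrite -[0]addr0; exact: cvgD.
Qed.

Lemma mxcvg_bounded u A : mxcvg u A -> \forall k \near \oo, nrm (u k) <= nrm A + 1.
Proof.
move=> /cvgrPdist_lt/(_ 1 ltr01); apply: filterS => k.
rewrite sub0r normrN ger0_norm ?nrm_ge0// => h.
by rewrite -[u k](subrK A) (le_trans (nrmD _ _))// addrC lerD2l ltW.
Qed.

Lemma mxcvgM u v A B : mxcvg u A -> mxcvg v B -> mxcvg (fun k => u k * v k) (A * B).
Proof.
move=> uA vB.
apply: (@mxcvg_squeeze (fun k => nrm (u k - A) * (nrm B + 1) + nrm A * nrm (v k - B))).
  apply: filterS (mxcvg_bounded vB) => k bk.
  have -> : u k * v k - A * B = (u k - A) * v k + A * (v k - B).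
    by rewrite mulrBl mulrBr addrA subrK.
  rewrite (le_trans (nrmD _ _))// lerD// (le_trans (nrmM _ _))//.
  by rewrite ler_wpM2l ?nrm_ge0.
have -> : (0 : K) = 0 * (nrm B + 1) + nrm A * 0 by rewrite mul0r mulr0 addr0.
apply: cvgD; first by apply: cvgM => //; exact: cvg_cst.
by apply: cvgM => //; exact: cvg_cst.
Qed.

Lemma mxcvg_entries u A :
  (forall i j, (fun k => Re (u k i j)) @ \oo --> Re (A i j)) ->
  (forall i j, (fun k => Im (u k i j)) @ \oo --> Im (A i j)) -> mxcvg u A.
Proof.
move=> hRe hIm.
pose e k := \sum_i \sum_j (`|Re (u k i j) - Re (A i j)| + `|Im (u k i j) - Im (A i j)|).
apply: (@mxcvg_squeeze e).
  apply: nearW => k; rewrite (le_trans (nrm_le_sum _))// /e.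
  apply: ler_sum => i _; apply: ler_sum => j _; rewrite !mxE.
  by case: (u k i j) (A i j) => [a b] [c d].
have -> : (0 : K) = \sum_(i < m.+1) \sum_(j < m.+1) (`|0 : K| + `|0 : K|).
  by rewrite big1// => i _; rewrite big1// => j _; rewrite normr0 addr0.
rewrite /e; apply: cvg_sumr => i; apply: cvg_sumr => j.
by apply: cvgD; apply: cvg_norm; apply/subr_cvg0.
Qed.

Lemma mxcvg_Re u A i j : mxcvg u A -> (fun k => Re (u k i j)) @ \oo --> Re (A i j).
Proof.
move=> h; apply/cvgrPdist_lt => e e0.
move/cvgrPdist_lt : h => /(_ _ e0); apply: filterS => k.
rewrite sub0r normrN ger0_norm ?nrm_ge0// => /(le_lt_trans _); apply.
by rewrite distrC -raddfB (le_trans _ (nrm_Re _ i j))// !mxE.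
Qed.

Lemma mxcvg_Im u A i j : mxcvg u A -> (fun k => Im (u k i j)) @ \oo --> Im (A i j).
Proof.
move=> h; apply/cvgrPdist_lt => e e0.
move/cvgrPdist_lt : h => /(_ _ e0); apply: filterS => k.
rewrite sub0r normrN ger0_norm ?nrm_ge0// => /(le_lt_trans _); apply.
by rewrite distrC -raddfB (le_trans _ (nrm_Im _ i j))// !mxE.
Qed.

(** A neighbourhood of a matrix contains a box of neighbourhoods of its entries, and there are
    finitely many entries. *)
Lemma mxcvg_cvg u A : mxcvg u A -> u @ \oo --> A.
Proof.
move=> h V [P nP PV]; rewrite /= nbhs_simpl /=.
have : \forall k \near \oo, forall ij : 'I_m.+1 * 'I_m.+1, P ij.1 ij.2 (u k ij.1 ij.2).
  apply: filter_forall => -[i j] /=.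
  have : (fun k => u k i j) @ \oo --> A i j.
    apply: complex_cvg; apply: (@squeeze_cvgr _ _ _ _ (fun=> 0)); [|exact: cvg_cst|exact: h].
    by apply: nearW => k; rewrite cmod_ge0 (le_trans _ (nrm_entry _ i j))// !mxE.
  by apply; exact: nP.
by apply: filterS => k hk; apply: PV => i j; exact: (hk (i, j)).
Qed.

Lemma mxcvg_limn u A : mxcvg u A -> limn u = A.
Proof.
by move=> /mxcvg_cvg uA; exact: cvg_lim.
Qed.

End MatrixNorm.

(** * Entrywise derivatives along a real parameter *)

Section Derivatives.
Variables (K : realType) (m : nat).
Local Notation M := 'M[K[i]]_m.+1.
Implicit Types (A B D E : M) (F G : K -> M) (f g : K -> K) (x a b : K).

(** Both [g + f] and [g - f] have a nonnegative derivative, hence are nondecreasing. *)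
Lemma mean_value_le (f g f' g' : K -> K) a b : a <= b ->
  (forall x, a <= x <= b -> is_derive x 1 f (f' x)) ->
  (forall x, a <= x <= b -> is_derive x 1 g (g' x)) ->
  (forall x, a <= x <= b -> `|f' x| <= g' x) ->
  `|f b - f a| <= g b - g a.
Proof.
move=> ab df dg fg.
have mono (h h' : K -> K) : (forall x, a <= x <= b -> is_derive x 1 h (h' x)) ->
    (forall x, a <= x <= b -> 0 <= h' x) -> h a <= h b.
  move=> dh h0.
  apply: (@ger0_derive1_le_cc _ h a b); rewrite ?in_itv/= ?lexx ?ab//.
  - move=> x; rewrite in_itv/= => /andP[/ltW ax /ltW xb].
    by have /dh [] : a <= x <= b by rewrite ax.
  - move=> x; rewrite in_itv/= => /andP[/ltW ax /ltW xb].
    have xab : a <= x <= b by rewrite ax.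
    by rewrite derive1E; have [_ ->] := dh _ xab; exact: h0.
  - apply: derivable_within_continuous => x; rewrite in_itv/= => xab.
    by have [] := dh _ xab.
have := mono (g + f) (fun x => g' x + f' x).
have := mono (g - f) (fun x => g' x - f' x).
rewrite !fctE => h1 h2; suff : g a - f a <= g b - f b /\ g a + f a <= g b + f b.
  by case=> ? ?; rewrite ler_norml; apply/andP; split; lra.
split; [apply: h1|apply: h2] => x xab.
- by have := df x xab; have := dg x xab; exact: is_deriveB.
- by have := fg _ xab; rewrite ler_norml => /andP[? ?]; lra.
- by have := df x xab; have := dg x xab; exact: is_deriveD.
- by have := fg _ xab; rewrite ler_norml => /andP[? ?]; lra.
Qed.

(** Only real functions of a real variable are differentiated, which makes the real mean value
    theorem and real power series applicable; no complex derivative is ever formed. *)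
Definition mxder F x D := forall i j,
  is_derive x 1 (fun t => Re (F t i j)) (Re (D i j)) /\
  is_derive x 1 (fun t => Im (F t i j)) (Im (D i j)).

Lemma mxder_eq F x D E : D = E -> mxder F x D -> mxder F x E.
Proof. by move=> ->. Qed.

Lemma eq_mxder F G x D : F =1 G -> mxder F x D -> mxder G x D.
Proof. by move=> /funext ->. Qed.

Lemma mxder_cst A x : mxder (fun=> A) x 0.
Proof. by move=> i j; rewrite mxE; split; exact: is_derive_cst. Qed.

Lemma mxder_real f x a : is_derive x 1 f a ->
  mxder (fun t => (f t)%:C%:M) x (a%:C%:M).
Proof.
move=> fa i j; rewrite !mxE; split.
  rewrite [X in is_derive _ _ X _](_ : _ = fun t => (i == j)%:R * f t).
    rewrite [X in is_derive _ _ _ X](_ : _ = (i == j)%:R *: a).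
      exact: is_deriveZ.
    by case: (i == j); rewrite ?scale1r ?scale0r.
  by apply/funext => t; rewrite mxE; case: (i == j); rewrite ?mul1r ?mul0r.
rewrite [X in is_derive _ _ X _](_ : _ = fun t => 0).
  by rewrite [Im _](_ : _ = 0); [exact: is_derive_cst|case: (i == j)].
by apply/funext => t; rewrite mxE; case: (i == j).
Qed.

Lemma is_derive_sumr (I : Type) (r : seq I) (h : I -> K -> K) (h' : I -> K) x :
  (forall i, is_derive x 1 (h i) (h' i)) ->
  is_derive x 1 (fun t => \sum_(i <- r) h i t) (\sum_(i <- r) h' i).
Proof.
move=> hh; elim: r => [|i r IH].
  by under eq_fun do rewrite big_nil; rewrite big_nil; exact: is_derive_cst.
under eq_fun do rewrite big_cons; rewrite big_cons.
exact: is_deriveD.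
Qed.

Lemma mxderD F G x D E : mxder F x D -> mxder G x E ->
  mxder (fun t => F t + G t) x (D + E).
Proof.
move=> dF dG i j; have [? ?] := dF i j; have [? ?] := dG i j.
split; under eq_fun do rewrite mxE raddfD; rewrite mxE raddfD; exact: is_deriveD.
Qed.

Lemma mxderM F G x D E : mxder F x D -> mxder G x E ->
  mxder (fun t => F t * G t) x (D * G x + F x * E).
Proof.
move=> dF dG i j; split.
  under eq_fun do rewrite mxE Re_sum; rewrite !mxE raddfD /= !Re_sum -big_split.
  apply: is_derive_sumr => k; have [dr di] := dF i k; have [er ei] := dG k j.
  under eq_fun do rewrite ReM; rewrite !ReM.
  have := is_deriveB (is_deriveM dr er) (is_deriveM di ei).
  rewrite /GRing.scale /=.
  by move/is_derive_eq; apply; ring.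
under eq_fun do rewrite mxE Im_sum; rewrite !mxE raddfD /= !Im_sum -big_split.
apply: is_derive_sumr => k; have [dr di] := dF i k; have [er ei] := dG k j.
under eq_fun do rewrite ImM; rewrite !ImM.
have := is_deriveD (is_deriveM dr ei) (is_deriveM di er).
rewrite /GRing.scale /=.
by move/is_derive_eq; apply; ring.
Qed.

Lemma mxderMl A F x D : mxder F x D -> mxder (fun t => A * F t) x (A * D).
Proof.
move=> dF; have := mxderM (mxder_cst A x) dF.
by apply: mxder_eq; rewrite mul0r add0r.
Qed.

Lemma mxderMr A F x D : mxder F x D -> mxder (fun t => F t * A) x (D * A).
Proof.
move=> dF; have := mxderM dF (mxder_cst A x).
by apply: mxder_eq; rewrite mulr0 addr0.
Qed.

Lemma mxder_comp F f x D a : mxder F (f x) D -> is_derive x 1 f a ->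
  mxder (fun t => F (f t)) x (a%:C%:M * D).
Proof.
move=> dF fa i j; have [dr di] := dF i j.
rewrite -[_ * D]/(_ *m D) mul_scalar_mx mxE; split.
  have -> : Re (a%:C * D i j) = Re (D i j) * a by rewrite ReM /= mul0r subr0 mulrC.
  exact: is_derive1_comp dr fa.
have -> : Im (a%:C * D i j) = Im (D i j) * a by rewrite ImM /= mul0r addr0 mulrC.
exact: is_derive1_comp di fa.
Qed.

Lemma mxder_near F G x D : (\forall t \near x, F t = G t) -> mxder F x D -> mxder G x D.
Proof.
move=> FG dF i j; have [dr di] := dF i j; split.
  apply: (near_eq_is_derive _ dr); apply: filterS FG => t /= ->; by [].
apply: (near_eq_is_derive _ di); apply: filterS FG => t /= ->; by [].
Qed.

(** The mean value inequality holds for each real function separately; the factor counts the real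
    and imaginary parts of the (m + 1)^2 entries. *)
Lemma mxder_bound F F' (g g' : K -> K) a b : a <= b ->
  (forall x, a <= x <= b -> mxder F x (F' x)) ->
  (forall x, a <= x <= b -> is_derive x 1 g (g' x)) ->
  (forall x, a <= x <= b -> nrm (F' x) <= g' x) ->
  nrm (F b - F a) <= (2 * m.+1 ^ 2)%:R * (g b - g a).
Proof.
move=> ab dF dg Fg.
apply: (@le_trans _ _ (\sum_(i < m.+1) \sum_(j < m.+1) ((g b - g a) *+ 2))).
  rewrite (le_trans (nrm_le_sum _))//.
  apply: ler_sum => i _; apply: ler_sum => j _; rewrite !mxE mulr2n lerD//.
    rewrite raddfB.
    apply: (@mean_value_le (fun t => Re (F t i j)) g (fun t => Re (F' t i j)) g' a b ab _ dg).
    - by move=> x xab; have [h _] := dF x xab i j; exact: h.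
    - by move=> x xab /=; exact: le_trans (nrm_Re _ _ _) (Fg _ xab).
  rewrite raddfB.
  apply: (@mean_value_le (fun t => Im (F t i j)) g (fun t => Im (F' t i j)) g' a b ab _ dg).
  - by move=> x xab; have [_ h] := dF x xab i j; exact: h.
  - by move=> x xab /=; exact: le_trans (nrm_Im _ _ _) (Fg _ xab).
by rewrite !sumr_const !card_ord -!mulrnA mulr_natl mulnn.
Qed.

(** Uniqueness for linear differential equations is reduced to this case: the unknown function is
    multiplied by a candidate inverse, and the product has derivative 0. *)
Lemma mxder_constant F a b : a <= b ->
  (forall x, a <= x <= b -> mxder F x 0) -> F b = F a.
Proof.
move=> ab dF; apply/eqP; rewrite -subr_eq0; apply/eqP/nrm_eq0/eqP.
rewrite eq_le nrm_ge0 andbT.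
have := @mxder_bound F (fun=> 0) (fun=> 0) (fun=> 0) a b ab dF.
rewrite subrr mulr0 => h; apply: h => x _; last by rewrite nrm0.
Qed.

End Derivatives.

(** * Power series with matrix coefficients *)

Section PowerSeries.
Variables (K : realType) (m : nat).
Local Notation M := 'M[K[i]]_m.+1.
Implicit Types (c : nat -> M) (y t : K).

(** A quantitative form of: the radius of convergence is at least 1/y. *)
Definition geo y c := exists C, forall k, nrm (c k) <= C * y ^+ k.

(** Ratio test. The constant sums the quotients nrm (c i) / y^i for i up to [k0], so that it covers
    all early terms at once, and the ratio propagates the bound afterwards. *)
Lemma geo_ratio y c k0 : 0 < y ->
  (forall k, (k0 <= k)%N -> nrm (c k.+1) <= y * nrm (c k)) -> geo y c.
Proof.
move=> y0 h; exists (\sum_(i < k0.+1) nrm (c i) / y ^+ i) => k.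
elim: k => [|k IH].
  rewrite expr0 mulr1 big_ord_recl /= expr0 divr1 lerDl sumr_ge0// => i _.
  by rewrite divr_ge0 ?nrm_ge0// exprn_ge0// ltW.
have [k0k|kk0] := leqP k0 k.
  by rewrite (le_trans (h _ k0k))// exprS mulrCA ler_wpM2l// ltW.
have kk : (k.+1 < k0.+1)%N by [].
rewrite (bigD1 (Ordinal kk))//= mulrDl divfK ?lerDl; last by rewrite expf_neq0// gt_eqF.
apply: mulr_ge0; last by rewrite exprn_ge0// ltW.
apply: sumr_ge0 => i _; by rewrite divr_ge0 ?nrm_ge0// exprn_ge0// ltW.
Qed.

Lemma geo_ge0 y c C : (forall k, nrm (c k) <= C * y ^+ k) -> 0 <= C.
Proof. by move=> /(_ 0%N); rewrite expr0 mulr1; apply: le_trans; exact: nrm_ge0. Qed.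

Lemma bernoulli_le (e : K) k : 0 <= e -> 1 + k%:R * e <= (1 + e) ^+ k.
Proof.
move=> e0; elim: k => [|k IH]; first by rewrite mul0r addr0 expr0.
rewrite exprS -natr1; apply: le_trans (ler_wpM2l _ IH); last by lra.
have : 0 <= k%:R * e * e by rewrite !mulr_ge0.
by lra.
Qed.

Definition psdiff c k : M := (k.+1)%:R *: c k.+1.

Lemma cmod_natr k : cmod (k%:R : K[i]) = k%:R.
Proof. by rewrite -(rmorph_nat (real_complex K)) cmod_real normr_nat. Qed.

(** Any strictly larger ratio absorbs the factor k + 1 that differentiation introduces. *)
Lemma geo_psdiff y y' c : 0 < y -> y < y' -> geo y c -> geo y' (psdiff c).
Proof.
move=> y0 yy' [C hC]; pose e := y' / y - 1.
have e0 : 0 < e by rewrite subr_gt0 ltr_pdivlMr ?mul1r.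
have C0 := geo_ge0 hC.
(* By Bernoulli's inequality, (1 + 1/e) (1 + e)^k >= (1 + 1/e) (1 + k e) >= k + 1, and y (1 + e) =
   y'. *)
exists (C * y * (1 + e^-1)) => k.
rewrite nrmZ cmod_natr.
apply: (@le_trans _ _ (k.+1%:R * (C * y ^+ k.+1))); first by rewrite ler_wpM2l.
have -> : y' ^+ k = (1 + e) ^+ k * y ^+ k.
  by rewrite -exprMn /e addrC subrK divfK// gt_eqF.
rewrite exprS.
have -> : k.+1%:R * (C * (y * y ^+ k)) = C * y * y ^+ k * k.+1%:R by ring.
have -> : C * y * (1 + e^-1) * ((1 + e) ^+ k * y ^+ k) =
  C * y * y ^+ k * ((1 + e^-1) * (1 + e) ^+ k) by ring.
rewrite ler_wpM2l//.
  by rewrite !mulr_ge0// ?exprn_ge0// ltW.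
have := bernoulli_le k (ltW e0).
have ie0 : 0 < e^-1 by rewrite invr_gt0.
move=> hb; apply: le_trans (ler_wpM2l _ hb); last by lra.
rewrite -natr1 mulrDr mulr1 mulrDl mul1r.
rewrite (mulrC e^-1) mulfK ?gt_eqF//.
have : 0 <= k%:R * e by rewrite mulr_ge0// ltW.
by lra.
Qed.

(** Split into real power series so that real termwise differentiation applies to each entry. *)
Definition psum c t : M :=
  \matrix_(i, j) (limn (pseries (fun k => Re (c k i j)) t) +i*
                  limn (pseries (fun k => Im (c k i j)) t)).

Lemma pseries_geo_cvg (u : nat -> K) C y t : 0 < y -> `|t| * y < 1 ->
  (forall k, `|u k| <= C * y ^+ k) -> cvgn (pseries u t).
Proof.
move=> y0 ty hu; apply: normed_cvg.
have C0 : 0 <= C by have := hu 0%N; rewrite expr0 mulr1; exact: le_trans.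
apply: (@series_le_cvg _ _ (fun k => C * (`|t| * y) ^+ k)) => //.
- by move=> k; exact: normr_ge0.
- by move=> k; rewrite mulr_ge0// exprn_ge0// mulr_ge0// ltW.
- move=> k /=; rewrite normrM normrX exprMn mulrCA [leLHS]mulrC.
  by rewrite ler_wpM2l// exprn_ge0.
by apply: is_cvg_geometric_series; rewrite ger0_norm// mulr_ge0// ltW.
Qed.

Lemma psum_cvg y c t : 0 < y -> `|t| * y < 1 -> geo y c ->
  mxcvg (series (fun k => t%:C ^+ k *: c k)) (psum c t).
Proof.
move=> y0 ty [C hC].
apply: mxcvg_entries => i j; rewrite mxE /=.
  have -> : (fun k => Re (series (fun k => t%:C ^+ k *: c k) k i j)) =
      pseries (fun k => Re (c k i j)) t.
    apply/funext => k; rewrite /pseries /series /= summxE Re_sum.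
    apply: eq_bigr => l _; rewrite mxE -rmorphXn ReM /= mul0r subr0 mulrC //.
  apply: pseries_geo_cvg y0 ty _ => k.
  exact: le_trans (nrm_Re _ _ _) (hC k).
have -> : (fun k => Im (series (fun k => t%:C ^+ k *: c k) k i j)) =
    pseries (fun k => Im (c k i j)) t.
  apply/funext => k; rewrite /pseries /series /= summxE Im_sum.
  apply: eq_bigr => l _; rewrite mxE -rmorphXn ImM /= mul0r addr0 mulrC //.
apply: pseries_geo_cvg y0 ty _ => k.
exact: le_trans (nrm_Im _ _ _) (hC k).
Qed.

Lemma psdiff_Re c i j :
  pseries_diffs (fun k => Re (c k i j)) = fun k => Re (psdiff c k i j).
Proof.
apply/funext => k; rewrite /pseries_diffs mxE -(rmorph_nat (real_complex K)).
by rewrite ReM /= mul0r subr0.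
Qed.

Lemma psdiff_Im c i j :
  pseries_diffs (fun k => Im (c k i j)) = fun k => Im (psdiff c k i j).
Proof.
apply/funext => k; rewrite /pseries_diffs mxE -(rmorph_nat (real_complex K)).
by rewrite ImM /= mul0r addr0.
Qed.

Lemma radius_gap (y t : K) : `|t| * y < 1 -> exists y2, y < y2 /\ `|t| * y2 < 1.
Proof.
move=> ty; have t0 := normr_ge0 t; have t1 : 0 < `|t| + 1 by rewrite ltr_wpDl.
exists (y + (1 - `|t| * y) / (`|t| + 1)).
have d0 : 0 < 1 - `|t| * y by rewrite subr_gt0.
split; first by rewrite ltrDl divr_gt0.
rewrite mulrDr -ltrBrDl mulrA ltr_pdivrMr// mulrC ltr_pM2l//.
by rewrite ltrDl.
Qed.

(** Termwise differentiation asks for convergence of the series and of its first two derived series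
    at some X beyond t. Each derived series costs a slightly larger ratio, whence y < y1 < y2 with
    |t| y2 < 1. *)
Lemma psum_der y c t : 0 < y -> `|t| * y < 1 -> geo y c ->
  mxder (psum c) t (psum (psdiff c) t).
Proof.
move=> y0 ty gc.
have [y2 [yy2 ty2]] := radius_gap ty.
have y20 : 0 < y2 by exact: lt_trans yy2.
pose y1 := (y + y2) / 2.
have [yy1 y12] : y < y1 /\ y1 < y2 by rewrite /y1; split; lra.
have y10 : 0 < y1 by exact: lt_trans yy1.
have g1 := geo_psdiff y0 yy1 gc.
have g2 := geo_psdiff y10 y12 g1.
(* The midpoint between |t| and 1/y2 lies beyond t and inside all three discs of convergence. *)
pose X := (`|t| + y2^-1) / 2.
have ty2' : `|t| < y2^-1 by rewrite -[_^-1]mul1r ltr_pdivlMr.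
have X0 : 0 < X.
  have : 0 < y2^-1 by rewrite invr_gt0.
  by have := normr_ge0 t; rewrite /X; lra.
have tX : `|t| < `|X| by rewrite (gtr0_norm X0) /X; lra.
have Xy2 : `|X| * y2 < 1.
  by rewrite (gtr0_norm X0) -ltr_pdivlMr// mul1r /X; lra.
have Xy1 : `|X| * y1 < 1 by apply: le_lt_trans Xy2; rewrite ler_wpM2l// ltW.
have Xy0 : `|X| * y < 1 by apply: le_lt_trans Xy1; rewrite ler_wpM2l// ltW.
have [C0 h0] := gc; have [C1 h1] := g1; have [C2 h2] := g2.
move=> i j; split.
  rewrite mxE /=.
  under [X in is_derive _ _ X _]eq_fun do rewrite mxE /=.
  have := @pseries_snd_diffs _ (fun k => Re (c k i j)) X t; rewrite !psdiff_Re; apply => //.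
  - by apply: (pseries_geo_cvg y0 Xy0) => k; exact: le_trans (nrm_Re _ _ _) (h0 k).
  - by apply: (pseries_geo_cvg y10 Xy1) => k; exact: le_trans (nrm_Re _ _ _) (h1 k).
  - by apply: (pseries_geo_cvg y20 Xy2) => k; exact: le_trans (nrm_Re _ _ _) (h2 k).
rewrite mxE /=.
under [X in is_derive _ _ X _]eq_fun do rewrite mxE /=.
have := @pseries_snd_diffs _ (fun k => Im (c k i j)) X t; rewrite !psdiff_Im; apply => //.
- by apply: (pseries_geo_cvg y0 Xy0) => k; exact: le_trans (nrm_Im _ _ _) (h0 k).
- by apply: (pseries_geo_cvg y10 Xy1) => k; exact: le_trans (nrm_Im _ _ _) (h1 k).
- by apply: (pseries_geo_cvg y20 Xy2) => k; exact: le_trans (nrm_Im _ _ _) (h2 k).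
Qed.

End PowerSeries.

(** The product rule for e f g, where e, f, g solve the equations with coefficients a + b, -a,
    -b. *)
Lemma leibniz3_eq0 (R : pzRingType) (a b e f g : R) :
  a * e = e * a -> b * e = e * b -> b * f = f * b ->
  ((a + b) * e * f + e * (- a * f)) * g + e * f * (- b * g) = 0.
Proof.
move=> ae be bf.
have -> : (a + b) * e * f + e * (- a * f) = e * f * b.
  rewrite mulNr mulrN (mulrA e) -ae -(mulrA a) mulrDl mulrDl -!mulrA addrAC subrr add0r.
  by rewrite mulrA be -mulrA bf.
by rewrite mulNr mulrN !mulrA subrr.
Qed.

(** * The matrix exponential and its addition law *)

Section Exponential.
Variables (K : realType) (m : nat).
Local Notation M := 'M[K[i]]_m.+1.
Implicit Types (A B X : M) (s t : K).

Lemma mxcvg_bound (u : nat -> M) A C :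
  (forall k, nrm (u k) <= C) -> mxcvg u A -> nrm A <= C.
Proof.
move=> uC uA; apply/ler_addgt0Pr => e e0.
move/cvgrPdist_lt : uA => /(_ _ e0) [k _ /(_ k (leqnn k))] /=.
rewrite sub0r normrN ger0_norm ?nrm_ge0// => h.
rewrite -[A](subrK (u k)) addrC (le_trans (nrmD _ _))// lerD//.
by rewrite nrmB ltW.
Qed.

Lemma mxcvg_comm (u : nat -> M) A X :
  (forall k, GRing.comm X (u k)) -> mxcvg u A -> GRing.comm X A.
Proof.
move=> uX uA; apply: (@mxcvg_uniq _ _ (fun k => X * u k)).
  exact: mxcvgM (mxcvg_cst _) uA.
have -> : (fun k => X * u k) = fun k => u k * X by apply/funext => k; exact: uX.
exact: mxcvgM uA (mxcvg_cst _).
Qed.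

Definition expc A k : M := (k`!%:R)^-1 *: A ^+ k.

Lemma expcS A k : expc A k.+1 = (k.+1%:R)^-1 *: (A * expc A k).
Proof. by rewrite /expc exprS factS natrM invfM -scalerA -scalerAr. Qed.

(** The ratio of consecutive terms is at most nrm A / (k + 1), which falls below y once k reaches
    the integer part of nrm A / y. *)
Lemma geo_expc A y : 0 < y -> geo y (expc A).
Proof.
move=> y0; apply: (@geo_ratio _ _ y _ (Num.trunc (nrm A / y))) => // k hk.
rewrite expcS nrmZ cmodV cmod_natr.
rewrite ler_pdivrMl ?ltr0n// (le_trans (nrmM _ _))// mulrA ler_wpM2r ?nrm_ge0//.
rewrite -ler_pdivrMr//; apply/ltW.
apply: lt_le_trans (truncnS_gt (nrm A / y)) _.
by rewrite ler_nat ltnS.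
Qed.

Lemma psdiff_expc A : psdiff (expc A) = fun k => A * expc A k.
Proof.
by apply/funext => k; rewrite /psdiff expcS scalerA divff ?scale1r// pnatr_eq0.
Qed.

Lemma mxexp_series A t :
  series (fun k => (k`!%:R)^-1 *: (t%:C *: A) ^+ k) =
  series (fun k => t%:C ^+ k *: expc A k).
Proof.
by congr series; apply/funext => k; rewrite exprZn /expc !scalerA mulrC.
Qed.

Lemma mxexp_cvg A t :
  mxcvg (series (fun k => (k`!%:R)^-1 *: (t%:C *: A) ^+ k)) (mxexp (t%:C *: A)).
Proof.
have y0 : 0 < (`|t| + 1)^-1 by rewrite invr_gt0 ltr_wpDl.
have h : mxcvg (series (fun k => (k`!%:R)^-1 *: (t%:C *: A) ^+ k)) (psum (expc A) t).
  rewrite mxexp_series; apply: psum_cvg (geo_expc A y0) => //.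
  by rewrite ltr_pdivrMr ?mul1r ?ltrDl// ltr_wpDl.
by rewrite /mxexp (mxcvg_limn h).
Qed.

Lemma mxexp_cvg1 A : mxcvg (series (expc A)) (mxexp A).
Proof. by have := mxexp_cvg A 1; rewrite scale1r. Qed.

Lemma psum_mull A c y t : 0 < y -> `|t| * y < 1 -> geo y c ->
  psum (fun k => A * c k) t = A * psum c t.
Proof.
move=> y0 ty gc; apply: (@mxcvg_uniq _ _ (series (fun k => t%:C ^+ k *: (A * c k)))).
  apply: psum_cvg y0 ty _; have [C hC] := gc; exists (nrm A * C) => k.
  by rewrite -mulrA (le_trans (nrmM _ _))// ler_wpM2l// nrm_ge0.
have -> : series (fun k => t%:C ^+ k *: (A * c k)) =
    fun k => A * series (fun k => t%:C ^+ k *: c k) k.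
  apply/funext => k; rewrite /series /= mulr_sumr; apply: eq_bigr => l _.
  by rewrite scalerAr.
exact: mxcvgM (mxcvg_cst _) (psum_cvg y0 ty gc).
Qed.

Lemma mxexp_psum A t : mxexp (t%:C *: A) = psum (expc A) t.
Proof.
have y0 : 0 < (`|t| + 1)^-1 by rewrite invr_gt0 ltr_wpDl.
apply: mxcvg_uniq (mxexp_cvg A t) _.
rewrite mxexp_series; apply: psum_cvg (geo_expc A y0) => //.
by rewrite ltr_pdivrMr ?mul1r ?ltrDl// ltr_wpDl.
Qed.

Lemma mxder_mxexp A t : mxder (fun s => mxexp (s%:C *: A)) t (A * mxexp (t%:C *: A)).
Proof.
have y0 : 0 < (`|t| + 1)^-1 by rewrite invr_gt0 ltr_wpDl.
have ty : `|t| * (`|t| + 1)^-1 < 1.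
  by rewrite ltr_pdivrMr ?mul1r ?ltrDl// ltr_wpDl.
have -> : (fun s => mxexp (s%:C *: A)) = psum (expc A).
  by apply/funext => s; exact: mxexp_psum.
have := psum_der y0 ty (geo_expc A y0).
by rewrite psdiff_expc (psum_mull _ y0 ty (geo_expc A y0)) mxexp_psum.
Qed.

Lemma mxexp_comm A X : GRing.comm X A -> GRing.comm X (mxexp A).
Proof.
move=> XA; apply: mxcvg_comm (mxexp_cvg1 A) => k.
apply: commr_sum => i _; rewrite /GRing.comm -scalerAl -scalerAr.
by congr (_ *: _); exact: commrX.
Qed.

Lemma mxexp0 : mxexp (0 : M) = 1.
Proof.
apply: mxcvg_uniq (mxexp_cvg1 0) _.
apply: (@mxcvg_squeeze _ _ (fun=> 0)); last exact: cvg_cst.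
exists 1%N => // -[//|k] _; rewrite seriesEnat /= big_nat_recl//= big1.
  by rewrite /expc fact0 expr0 invr1 scale1r addr0 subrr nrm0.
by move=> i _; rewrite /expc expr0n scaler0.
Qed.

(* exp(s(A + B)) exp(-s A) exp(-s B) has derivative 0 in s. *)
Lemma mxexpD_subproof A B : GRing.comm A B -> mxexp (A + B) * mxexp (- A) * mxexp (- B) = 1.
Proof.
move=> AB.
pose e X s := mxexp (s%:C *: X).
have cXe X Y s : GRing.comm X Y -> GRing.comm X (e Y s).
  by move=> XY; apply: mxexp_comm; rewrite /GRing.comm -scalerAl -scalerAr XY.
have e0 X : e X 0 = 1 by rewrite /e scale0r mxexp0.
have e1 X : e X 1 = mxexp X by rewrite /e scale1r.
pose G s := e (A + B) s * e (- A) s * e (- B) s.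
suff : G 1 = G 0 by rewrite /G !e0 !e1 !mulr1.
apply: mxder_constant => // s _.
have := mxderM (mxderM (mxder_mxexp (A + B) s) (mxder_mxexp (- A) s)) (mxder_mxexp (- B) s).
apply: mxder_eq; rewrite -!/(e _ _).
have cA : GRing.comm A (e (A + B) s) by apply: cXe; apply: commrD.
have cB : GRing.comm B (e (A + B) s) by apply: cXe; apply: commrD.
have cBA : GRing.comm B (e (- A) s) by apply: cXe; apply: commrN; exact: commr_sym.
exact: (leibniz3_eq0 _ cA cB cBA).
Qed.

Lemma mxexpNr A : mxexp A * mxexp (- A) = 1.
Proof.
have := mxexpD_subproof (commr0 A).
by rewrite addr0 oppr0 mxexp0 mulr1.
Qed.

Lemma mxexpNl A : mxexp (- A) * mxexp A = 1.
Proof. by have := mxexpNr (- A); rewrite opprK. Qed.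

Lemma mxexpD A B : GRing.comm A B -> mxexp (A + B) = mxexp A * mxexp B.
Proof.
move=> AB; have h := mxexpD_subproof AB.
have cancel (R : pzRingType) (x a a' b b' : R) :
  x * a' * b' = 1 -> a' * a = 1 -> b' * b = 1 -> x = b * a.
  move=> xab aa bb; rewrite -[RHS]mul1r -xab mulrA -(mulrA _ b') bb mulr1.
  by rewrite -mulrA aa mulr1.
rewrite (cancel _ _ _ _ _ _ h (mxexpNl A) (mxexpNl B)).
by apply: mxexp_comm; apply: commr_sym; apply: mxexp_comm; exact: AB.
Qed.

(** The identity has norm m + 1 rather than 1, so the term of index 0 is set apart and only the
    others are compared with the scalar exponential. *)
Lemma nrm_mxexp A : nrm (mxexp A) <= nrm (1 : M) + expR (nrm A).
Proof.
apply: mxcvg_bound (mxexp_cvg1 A) => k.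
apply: (@le_trans _ _ (nrm (1 : M) + series (exp_coeff (nrm A)) k)); last first.
  rewrite lerD2l; apply: nondecreasing_cvgn_le (is_cvg_series_exp_coeff _) _.
  by apply: nondecreasing_series => i _; rewrite /exp_coeff/= divr_ge0// exprn_ge0// nrm_ge0.
have h0 i : 0 <= exp_coeff (nrm A) i.
  by rewrite /exp_coeff/= divr_ge0// exprn_ge0// nrm_ge0.
rewrite !seriesEnat /=; apply: le_trans (nrm_sum _ _ _) _.
case: k => [|k]; first by rewrite !big_nil addr0 nrm_ge0.
have ex0 : expc A 0%N = 1 by rewrite /expc fact0 expr0 invr1 scale1r.
rewrite [X in X <= _]big_nat_recl//= [X in _ <= _ + X]big_nat_recl//= ex0.
rewrite lerD2l.
apply: (@le_trans _ _ (\sum_(0 <= i < k) exp_coeff (nrm A) i.+1)).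
  apply: ler_sum => i _; rewrite nrmZ cmodV cmod_natr /exp_coeff /= mulrC.
  rewrite ler_wpM2r ?invr_ge0//.
  elim: i => [|i IH]; first by rewrite !expr1.
  by rewrite exprS [leRHS]exprS (le_trans (nrmM _ _))// ler_wpM2l// nrm_ge0.
by rewrite lerDr h0.
Qed.

End Exponential.

(** * Scalar exponentials and exponential decay for stable matrices *)

Section ScalarExponential.
Variables (K : realType) (m : nat).
Local Notation M := 'M[K[i]]_m.+1.
Implicit Types (A B X : M) (s t u : K) (c : K[i]).

(** Written with real functions so that its modulus is explicit; [mxexp_scalar] identifies it with
    the exponential series. *)
Definition cexp c : K[i] := (expR (Re c))%:C * (cos (Im c) +i* sin (Im c)).

Lemma cmod_cexp c : cmod (cexp c) = expR (Re c).
Proof.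
rewrite cmodM cmod_real ger0_norm ?expR_ge0// cmodE /= cos2Dsin2.
by rewrite sqrtr1 mulr1.
Qed.

Lemma mxder_complex (f g : K -> K) (x a b : K) : is_derive x 1 f a -> is_derive x 1 g b ->
  mxder (fun t => (f t +i* g t)%:M : M) x ((a +i* b)%:M).
Proof.
move=> fa gb i j; rewrite !mxE; case: eqP => [ij|ij]; rewrite ?mulr1n ?mulr0n; split.
- by under eq_fun do rewrite mxE (introT eqP ij) mulr1n.
- by under eq_fun do rewrite mxE (introT eqP ij) mulr1n.
- by under eq_fun do rewrite mxE (introF eqP ij) mulr0n; exact: is_derive_cst.
- by under eq_fun do rewrite mxE (introF eqP ij) mulr0n; exact: is_derive_cst.
Qed.

Lemma scalar_mxM c d : (c * d)%:M = c%:M * d%:M :> M.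
Proof. by rewrite -[RHS]/(c%:M *m d%:M) scalar_mxM. Qed.

Lemma comm_scalar c X : GRing.comm X c%:M.
Proof. exact: comm_mx_scalar. Qed.

Lemma mxder_cexp c t :
  mxder (fun s => (cexp (s%:C * c))%:M : M) t ((c * cexp (t%:C * c))%:M).
Proof.
have -> : (fun s => (cexp (s%:C * c))%:M : M) = fun s =>
    (expR (s * Re c) * cos (s * Im c) +i* (expR (s * Re c) * sin (s * Im c)))%:M.
  apply/funext => s; congr (_%:M); rewrite /cexp.
  rewrite ReM ImM /= !mul0r subr0 addr0; apply/eqP.
  by rewrite eq_complex /= !mul0r subr0 addr0 !eqxx.
have dl (a : K) : is_derive t 1 (fun s => s * a) a.
  have := @is_deriveZ _ _ _ id a t 1 1 _.
  have -> : a \*: id = fun s : K => s * a by apply/funext => s; rewrite /= mulrC.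
  by move=> /(_ _)/is_derive_eq; apply; rewrite /GRing.scale /= mulr1.
have de (a : K) : is_derive t 1 (fun s => expR (s * a)) (expR (t * a) * a).
  exact: is_derive1_comp (is_derive_expR _) (dl a).
have dc (a : K) : is_derive t 1 (fun s => cos (s * a)) (- sin (t * a) * a).
  exact: is_derive1_comp (is_derive_cos _) (dl a).
have ds (a : K) : is_derive t 1 (fun s => sin (s * a)) (cos (t * a) * a).
  exact: is_derive1_comp (is_derive_sin _) (dl a).
have := mxder_complex (is_deriveM (de (Re c)) (dc (Im c))) (is_deriveM (de (Re c)) (ds (Im c))).
apply: mxder_eq; congr (_%:M); apply/eqP; rewrite /cexp eq_complex.
rewrite !(ReM, ImM) /= !mul0r !subr0 !addr0 /GRing.scale /=.
by apply/andP; split; apply/eqP; ring.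
Qed.

Lemma cexp0 : cexp 0 = 1.
Proof.
rewrite /cexp /= expR0 cos0 sin0 mul1r //.
Qed.

Lemma cexpN c : cexp c * cexp (- c) = 1.
Proof.
rewrite /cexp !raddfN /= cosN sinN mulrACA -rmorphM /= -expRD subrr expR0 mul1r.
apply/eqP; rewrite eq_complex ReM ImM /=; apply/andP; split; apply/eqP; last ring.
by rewrite mulrN opprK -!expr2 cos2Dsin2.
Qed.

Lemma mxexp_scalar c : mxexp (c%:M : M) = (cexp c)%:M.
Proof.
pose G s := mxexp (s%:C *: c%:M : M) * (cexp (s%:C * - c))%:M.
have G1 : G 1 = G 0.
  apply: mxder_constant => // s _.
  have := mxderM (mxder_mxexp (c%:M) s) (mxder_cexp (- c) s).
  apply: mxder_eq; rewrite scalar_mxM [X in _ + X]mulrA (comm_scalar (- c)).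
  by rewrite -!mulrA -mulrDl -raddfD addrN raddf0 mul0r.
have : mxexp (c%:M : M) * (cexp (- c))%:M = 1.
  by move: G1; rewrite /G scale1r scale0r mxexp0 mul1r mul0r cexp0 mul1r.
move=> /(congr1 (fun X => X * (cexp c)%:M)).
by rewrite /= -mulrA -scalar_mxM mulrC cexpN mulr1 mul1r.
Qed.

Lemma nrm_scalar c X : nrm (c%:M * X) = cmod c * nrm X.
Proof. by rewrite -nrmZ -[_ * _]/(_ *m _) mul_scalar_mx. Qed.

Lemma horner_mx_linear A c : horner_mx A ('X - c%:P) = A - c%:M.
Proof. by rewrite rmorphB /= horner_mx_X horner_mx_C. Qed.

Lemma is_derive_expRM (d x : K) :
  is_derive x 1 (fun s => expR (d * s)) (d * expR (d * x)).
Proof.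
have dl : is_derive x 1 (fun s => d * s) d.
  have := is_deriveZ d (is_derive_id x (1 : K)).
  by move/is_derive_eq; apply; rewrite /GRing.scale /= mulr1.
by have := is_derive1_comp (is_derive_expR _) dl; rewrite mulrC.
Qed.

(* Induction on the roots: the derivative of exp(s(c - A)) X is, up to a scalar
   factor, exp(-s A) applied to (A - c) X, which has one root less. *)
Lemma decay_roots A (alpha : K) (rs : seq K[i]) X :
  (forall c, c \in rs -> alpha < Re c) ->
  horner_mx A (\prod_(c <- rs) ('X - c%:P)) * X = 0 ->
  exists C, 0 <= C /\ forall s, 0 <= s ->
    nrm (mxexp ((- s)%:C *: A) * X) <= C * expR (- (alpha * s)).
Proof.
elim: rs X => [|c rs IH] X hre.
  rewrite big_nil rmorph1 mul1r => ->; exists 0; split => // s _.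
  by rewrite mulr0 nrm0 mul0r.
rewrite big_cons mulrC rmorphM /= horner_mx_linear -mulrA => hX.
have [c' hc'|C [C0 hC]] := IH _ _ hX.
  by apply: hre; rewrite in_cons hc' orbT.
(* The strict gap d is what prevents polynomial factors from appearing at repeated roots:
   integrating C e^(d s) gives (C/d) e^(d s), of the same exponential order. *)
have dc : 0 < Re c - alpha by rewrite subr_gt0 hre// mem_head.
set d := Re c - alpha in dc.
pose B : M := c%:M - A.
have eB s : mxexp (s%:C *: B) = (cexp (s%:C * c))%:M * mxexp ((- s)%:C *: A).
  rewrite /B scalerBr scale_scalar_mx -scaleNr -rmorphN mxexpD ?mxexp_scalar//.
  by apply: commr_sym; exact: comm_scalar.
pose G s := mxexp (s%:C *: B) * X.
pose k : K := (2 * m.+1 ^ 2)%:R.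
have k0 : 0 <= k by rewrite ler0n.
have hG s : 0 <= s -> nrm (G s - G 0) <= k * (C / d * expR (d * s) - C / d * expR (d * 0)).
  move=> s0; apply: (@mxder_bound _ _ G (fun s => B * mxexp (s%:C *: B) * X)
    (fun s => C / d * expR (d * s)) (fun s => C * expR (d * s)) 0 s s0).
  - by move=> x _; apply: mxderMr; exact: mxder_mxexp.
  - move=> x _; have := is_deriveZ (C / d) (is_derive_expRM d x).
    by move/is_derive_eq; apply; rewrite /GRing.scale /= mulrA divfK// gt_eqF.
  - move=> x /andP[x0 _].
    have -> : B * mxexp (x%:C *: B) * X =
        - ((cexp (x%:C * c))%:M * (mxexp ((- x)%:C *: A) * ((A - c%:M) * X))).
      have -> : B * mxexp (x%:C *: B) = mxexp (x%:C *: B) * B.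
        by apply: mxexp_comm; rewrite /GRing.comm -scalerAl -scalerAr.
      by rewrite mulrA -eB -mulrA -mulrN -mulNr opprB.
    rewrite nrmN nrm_scalar cmod_cexp.
    apply: (le_trans (ler_wpM2l (expR_ge0 _) (hC _ x0))).
    rewrite mulrCA -expRD ReM /= mul0r subr0 le_eqVlt; apply/orP; left.
    by apply/eqP; congr (_ * expR _); rewrite /d; ring.
(* The first summand comes from the integrated derivative, the second from the initial value
   [G 0 = X]. *)
exists (k * (C / d) + nrm X); split.
  by rewrite addr_ge0 ?nrm_ge0// mulr_ge0// divr_ge0// ltW.
move=> s s0.
have -> : mxexp ((- s)%:C *: A) * X = (cexp (- (s%:C * c)))%:M * G s.
  by rewrite /G eB mulrA mulrA -scalar_mxM mulrC cexpN mul1r.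
rewrite nrm_scalar cmod_cexp.
have -> : expR (- (alpha * s)) = expR (Re (- (s%:C * c))) * expR (d * s).
  by rewrite -expRD /d; congr expR; case: (c) => a b /=; rewrite mul0r; ring.
rewrite mulrCA ler_wpM2l ?expR_ge0//.
have G0 : G 0 = X by rewrite /G scale0r mxexp0 mul1r.
rewrite -[G s](subrK (G 0)) (le_trans (nrmD _ _))// mulrDl lerD//.
  rewrite (le_trans (hG _ s0))// -[leRHS]mulrA ler_wpM2l// gerBl//.
  by rewrite mulr_ge0 ?expR_ge0// divr_ge0// ltW.
by rewrite G0 ler_peMr ?nrm_ge0// -expR0 ler_expR mulr_ge0// ltW.
Qed.

(** Cayley-Hamilton makes [decay_roots] applicable to the identity, with the roots of the
    characteristic polynomial. *)
Lemma positive_stable_decay A : positive_stable A ->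
  exists alpha C, [/\ 0 < alpha, 0 <= C & forall s, 0 <= s ->
    nrm (mxexp ((- s)%:C *: A)) <= C * expR (- (alpha * s))].
Proof.
move=> Astable.
have [rs hrs] := closed_field_poly_normal (char_poly A).
have mon := char_poly_monic A.
rewrite (monicP mon) scale1r in hrs.
have [alpha [a0 ha]] : exists alpha : K, 0 < alpha /\ forall c, c \in rs -> alpha < Re c.
  have : forall c, c \in rs -> 0 < Re c.
    move=> c crs; apply: Astable; rewrite eigenvalue_root_char hrs.
    by rewrite root_prod_XsubC.
  elim: (rs) => [|c r IH] h; first by exists 1.
  have [|a [a0 ha]] := IH; first by move=> c' hc'; apply: h; rewrite in_cons hc' orbT.
  have c0 : 0 < Re c by apply: h; exact: mem_head.
  (* Halving keeps the rate strictly below the real part of the root. *)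
  exists (Num.min a (Re c / 2)); split; first by rewrite lt_min a0 divr_gt0.
  move=> c'; rewrite in_cons => /orP[/eqP->|/ha]; rewrite gt_min.
    by apply/orP; right; lra.
  by move=> ->.
have [C [C0 hC]] : exists C, 0 <= C /\ forall s, 0 <= s ->
    nrm (mxexp ((- s)%:C *: A) * 1) <= C * expR (- (alpha * s)).
  by apply: (decay_roots ha); rewrite -hrs Cayley_Hamilton mul0r.
by exists alpha, C; split => // s /hC; rewrite mulr1.
Qed.

End ScalarExponential.

(** * Matrix powers of positive reals *)

Section RealPowers.
Variables (K : realType) (m : nat).
Local Notation M := 'M[K[i]]_m.+1.
Implicit Types (A B X : M) (s t u : K) (c : K[i]).

Lemma cpowmxE A u : 0 < u -> cpowmx u%:C A = mxexp ((ln u)%:C *: A).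
Proof. by move=> u0; rewrite /cpowmx clog_real. Qed.

Lemma commrZ (c : K[i]) A B : GRing.comm A B -> GRing.comm A (c *: B).
Proof. by move=> AB; rewrite /GRing.comm -scalerAl -scalerAr AB. Qed.

Lemma cpowmxD c A B : GRing.comm A B -> cpowmx c (A + B) = cpowmx c A * cpowmx c B.
Proof.
move=> AB; rewrite /cpowmx scalerDr mxexpD//.
by apply: commrZ; apply: commr_sym; apply: commrZ; exact: commr_sym.
Qed.

Lemma cpowmx_comm c A X : GRing.comm X A -> GRing.comm X (cpowmx c A).
Proof. by move=> XA; apply: mxexp_comm; exact: commrZ. Qed.

Lemma cpowmxN c A : cpowmx c (- A) * cpowmx c A = 1.
Proof. by rewrite /cpowmx scalerN mxexpNl. Qed.

Lemma cpowmxNr c A : cpowmx c A * cpowmx c (- A) = 1.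
Proof. by rewrite /cpowmx scalerN mxexpNr. Qed.

Lemma cpowmx_real A u (a : K) : 0 < u ->
  cpowmx u%:C (A + a%:C%:M) = (u `^ a)%:C *: cpowmx u%:C A.
Proof.
move=> u0; rewrite cpowmxD; last exact: comm_scalar.
rewrite cpowmxE// [X in _ * X](cpowmxE _ u0) scale_scalar_mx mxexp_scalar.
rewrite /cexp ReM ImM /= !(mul0r, mulr0, subr0, addr0) cos0 sin0.
rewrite [1 +i* 0](_ : _ = 1)// mulr1 comm_scalar.
by rewrite -[LHS]/(_ *m _) mul_scalar_mx /powR gt_eqF// mulrC.
Qed.

Lemma cpowmx_natD A u k : 0 < u ->
  cpowmx u%:C (A + k%:R%:M) = (u ^+ k)%:C *: cpowmx u%:C A.
Proof.
move=> u0; have := cpowmx_real A k%:R u0.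
have -> : u `^ k%:R = u ^+ k by rewrite powR_mulrn// ltW.
have -> : (k%:R : K)%:C = k%:R by exact: (rmorph_nat (real_complex K)).
exact.
Qed.

Lemma cpowmx_sub1 A u : 0 < u -> cpowmx u%:C A = u%:C *: cpowmx u%:C (A - 1%:M).
Proof.
by move=> u0; rewrite -{1}(subrK (1%:M) A) (cpowmx_natD _ 1 u0) expr1.
Qed.

Lemma cpowmx_base1 A : cpowmx 1 A = 1.
Proof. by rewrite (cpowmxE A ltr01) ln1 scale0r mxexp0. Qed.

Lemma mxder_cpowmx A u : 0 < u ->
  mxder (fun t => cpowmx t%:C A) u (A * cpowmx u%:C (A - 1%:M)).
Proof.
move=> u0.
apply: (@mxder_near _ _ (fun t => mxexp ((ln t)%:C *: A))).
  have : \forall t \near u, 0 < t by apply: lt_nbhsr.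
  by apply: filterS => t t0; rewrite cpowmxE.
have := mxder_comp (mxder_mxexp A (ln u)) (is_derive1_ln u0).
apply: mxder_eq; rewrite -cpowmxE// (cpowmx_sub1 _ u0) -scalerAr.
rewrite -[LHS]/(_ *m _) mul_scalar_mx scalerA -rmorphM /= mulVf ?scale1r//.
by rewrite gt_eqF.
Qed.

(** The substitution u = e^(-s) turns exponential decay into a power of u. The exponent is capped at
    1 so that later u^(a - 1) is nonincreasing. *)
Lemma cpowmx_stable_bound A : positive_stable A ->
  exists a C, [/\ 0 < a <= 1, 0 <= C & forall u, 0 < u <= 1 ->
    nrm (cpowmx u%:C A) <= C * u `^ a].
Proof.
move=> /positive_stable_decay[a [C [a0 C0 hC]]].
exists (Num.min a 1), C; split => //.
  by rewrite lt_min a0 ltr01 ge_min lexx orbT.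
move=> u /andP[u0 u1]; rewrite cpowmxE// -[ln u]opprK.
apply: le_trans (hC _ _) _; first by rewrite oppr_ge0 ln_le0.
rewrite ler_wpM2l// mulrN opprK.
apply: (@le_trans _ _ (u `^ a)); first by rewrite /powR gt_eqF.
by apply: ger_powR; rewrite ?u0 // ge_min lexx.
Qed.

(** Powers grow more slowly than any exponential; the rate 1/4 leaves room under the factor e^(-t/2)
    available in [gauss_kernel_bound]. *)
Lemma cpowmx_large_bound A : exists C, 0 <= C /\ forall t, 1 <= t ->
  nrm (cpowmx t%:C A) <= C * expR (t / 4).
Proof.
pose a := nrm A; have a0 : 0 <= a by exact: nrm_ge0.
(* With a e <= 1/4, the inequality ln (t e) <= t e gives a ln t <= t/4 - a ln e, the source of the
   constant below. *)
pose e : K := (4 * (a + 1))^-1.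
have e0 : 0 < e by rewrite invr_gt0; lra.
have ae : a * e <= 4^-1.
  rewrite ler_pdivrMr; last by lra.
  by lra.
exists (nrm (1 : M) + expR (- (a * ln e))); split.
  by rewrite addr_ge0 ?nrm_ge0 ?expR_ge0.
move=> t t1; have t0 : 0 < t by exact: lt_le_trans t1.
rewrite cpowmxE//; apply: le_trans (nrm_mxexp _) _.
rewrite mulrDl lerD//.
  rewrite ler_peMr ?nrm_ge0// -[leLHS]expR0 ler_expR.
  by rewrite divr_ge0// ltW.
rewrite -expRD ler_expR nrmZ cmod_real ger0_norm ?ln_ge0// -/a.
have : ln (t * e) <= t * e.
  have := @le_ln1Dx K (t * e - 1); rewrite [1 + _]addrC subrK => h.
  apply: le_trans (h _) _; last by lra.
  by rewrite ltrBDr addrC subrr mulr_gt0.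
rewrite lnM ?posrE// => h.
have : a * (ln t + ln e) <= a * (t * e) by rewrite ler_wpM2l.
have : t * (a * e) <= t / 4 by rewrite ler_wpM2l// ltW.
by lra.
Qed.

End RealPowers.

(** * Fundamental theorem of calculus on sets exhausted by segments *)

Section RealIntegrals.
Variable K : realType.
Local Notation mu := (@lebesgue_measure K).
Implicit Types (f F g : K -> K) (a b : K).

Lemma derive_cont f (x d : K) : is_derive x 1 f d -> {for x, continuous f}.
Proof.
by move=> h; apply/differentiable_continuous/derivable1_diffP; have [] := h.
Qed.

Lemma integral_FTC_segment f F a b : a < b ->
  (forall x, a <= x <= b -> {for x, continuous f}) ->
  (forall x, a <= x <= b -> is_derive x 1 F (f x)) ->
  (\int[mu]_(x in `[a, b]) (f x)%:E = (F b - F a)%:E)%E.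
Proof.
move=> ab cf dF; rewrite EFinB; apply: (continuous_FTC2 ab).
- apply: continuous_in_subspaceT => x /set_mem /=; rewrite in_itv /=; exact: cf.
- split.
  + move=> x; rewrite in_itv /= => /andP[/ltW ax /ltW xb].
    by have /dF[] : a <= x <= b by rewrite ax xb.
  + apply: cvg_at_right_filter; apply: derive_cont (f a) _.
    by apply: dF; rewrite lexx ltW.
  + apply: cvg_at_left_filter; apply: derive_cont (f b) _.
    by apply: dF; rewrite lexx ltW.
- move=> x; rewrite in_itv /= => /andP[/ltW ax /ltW xb].
  have xab : a <= x <= b by rewrite ax.
  by rewrite derive1E; have [_] := dF _ xab.
Qed.

Section Exhaustion.
Variables (D : set K) (a_ b_ : nat -> K).
Hypothesis ab_D : forall n x, a_ n <= x <= b_ n -> D x.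
Hypothesis D_ab : forall x, D x -> \forall n \near \oo, a_ n <= x <= b_ n.
Hypothesis ab_lt : forall n, a_ n < b_ n.
Hypothesis ab_nd : forall n k, (n <= k)%N -> a_ k <= a_ n /\ b_ n <= b_ k.

Lemma exhaustion_bigcup : D = \bigcup_n [set` `[a_ n, b_ n]].
Proof.
apply/seteqP; split => [x /D_ab [n _ /(_ n (leqnn n))]/= h|x [n _]].
  by exists n => //=; rewrite in_itv.
by rewrite /= in_itv /=; exact: ab_D.
Qed.

Lemma exhaustion_measurable : measurable D.
Proof.
by rewrite exhaustion_bigcup; apply: bigcup_measurable => n _; exact: measurable_itv.
Qed.

Lemma exhaustion_measurable_fun f :
  (forall x, D x -> {for x, continuous f}) -> measurable_fun D f.
Proof.
move=> cf; rewrite exhaustion_bigcup; apply/measurable_fun_bigcup.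
  by move=> n; exact: measurable_itv.
move=> n; apply: subspace_continuous_measurable_fun; first exact: measurable_itv.
apply: continuous_in_subspaceT => x /set_mem /=; rewrite in_itv /= => h.
exact: cf (ab_D h).
Qed.

(** A bounded antiderivative bounds the integrals over all segments by 2 M; monotone convergence
    carries the bound to D. *)
Lemma ge0_integrable_FTC f F M :
  (forall x, D x -> {for x, continuous f}) ->
  (forall x, D x -> 0 <= f x) ->
  (forall x, D x -> is_derive x 1 F (f x)) ->
  (forall x, D x -> `|F x| <= M) -> mu.-integrable D (EFin \o f).
Proof.
move=> cf f0 dF FM; apply/integrableP; split.
  by apply/measurable_EFinP; exact: exhaustion_measurable_fun.
have -> : (\int[mu]_(x in D) `|(EFin \o f) x| = \int[mu]_(x in D) (f x)%:E)%E.
  by apply: eq_integral => x /set_mem Dx /=; rewrite ger0_norm ?f0.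
have := @ge0_nondecreasing_set_cvg_integral _ (measurableTypeR K) K
  (fun n => [set` `[a_ n, b_ n]]) (EFin \o f) mu.
rewrite -exhaustion_bigcup => h.
have {}h : (\int[mu]_(x in `[a_ n, b_ n]) (f x)%:E)%E @[n --> \oo] -->
    (\int[mu]_(x in D) (f x)%:E)%E.
  apply: h.
  - move=> n k nk; apply/subsetPset => x /=; rewrite !in_itv/=.
    have [h1 h2] := ab_nd nk.
    by move=> /andP[h3 h4]; rewrite (le_trans h1)//= (le_trans h4).
  - by move=> n; exact: measurable_itv.
  - move=> n; apply/measurable_EFinP; apply: measurable_funS (exhaustion_measurable_fun cf).
      exact: exhaustion_measurable.
    by move=> x /=; rewrite in_itv/=; exact: ab_D.
  - by move=> n x /=; rewrite in_itv/= => /ab_D Dx; rewrite lee_fin f0.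
apply: (@le_lt_trans _ _ (M + M)%:E); last by rewrite ltry.
rewrite -(cvg_lim _ h)//; apply: lime_le; first by apply/cvg_ex; eexists; exact: h.
apply: nearW => n.
have -> : (\int[mu]_(x in `[a_ n, b_ n]) (f x)%:E = (F (b_ n) - F (a_ n))%:E)%E.
  by apply: integral_FTC_segment => // x /ab_D; [exact: cf|exact: dF].
have h1 : D (a_ n) by apply: (@ab_D n); rewrite lexx ltW.
have h2 : D (b_ n) by apply: (@ab_D n); rewrite lexx ltW.
by rewrite lee_fin (le_trans (ler_norm _))// (le_trans (ler_normB _ _))// lerD//; exact: FM.
Qed.

(** Dominated convergence for the restrictions of f to the segments, with |f| as the dominating
    function. *)
Lemma integral_FTC_lim f F (l : K) :
  (forall x, D x -> {for x, continuous f}) ->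
  mu.-integrable D (EFin \o f) ->
  (forall x, D x -> is_derive x 1 F (f x)) ->
  (fun n => F (b_ n) - F (a_ n)) @ \oo --> l ->
  (\int[mu]_(x in D) f x)%R = l.
Proof.
move=> cf fi dF Fl.
have mD := exhaustion_measurable.
have mf : measurable_fun D (EFin \o f).
  by apply/measurable_EFinP; exact: exhaustion_measurable_fun.
have [||||| _ _ h] := @dominated_convergence _ (measurableTypeR K) K mu D mD
  (fun n => (EFin \o f) \_ [set` `[a_ n, b_ n]]) (EFin \o f) (abse \o (EFin \o f)) => //.
- move=> n; apply/(measurable_restrict _ (measurable_itv _) mD).
  by apply: measurable_funS mf => // x [].
- apply: aeW => x Dx /=; apply: cvg_near_cst.
  apply: filterS (D_ab Dx) => n /= h; rewrite patchE mem_set//=; by rewrite in_itv.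
- exact: integrable_abse.
- apply: aeW => x n Dx /=; rewrite patchE; case: ifP => // _.
  by rewrite abse0 lee_fin normr_ge0.
have e n : (\int[mu]_(x in D) ((EFin \o f) \_ [set` `[a_ n, b_ n]]) x = (F (b_ n) - F (a_ n))%:E)%E.
  rewrite -integral_mkcondr (_ : D `&` _ = [set` `[a_ n, b_ n]]).
    by apply: integral_FTC_segment => // x /ab_D; [exact: cf|exact: dF].
  by apply/setIidPr => x /=; rewrite in_itv/=; exact: ab_D.
have {}h : (F (b_ n) - F (a_ n))%:E @[n --> \oo] --> (\int[mu]_(x in D) (f x)%:E)%E.
  by apply: cvg_trans h; apply: near_eq_cvg; apply: nearW => n; exact: e.
rewrite /Rintegral -(cvg_lim _ h)//.
by rewrite (_ : limn _ = l%:E)//; apply/cvg_lim => //; apply: cvg_EFin => //; exact: nearW.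
Qed.

End Exhaustion.

End RealIntegrals.

(** * Explicit majorants on the unit interval and on the half-line *)

Section ConcreteIntervals.
Variable K : realType.
Local Notation mu := (@lebesgue_measure K).
Local Notation I01 := (`]0, 1[%classic : set K).
Local Notation I0y := (`]0, +oo[%classic : set K).
Implicit Types (f F g : K -> K) (a b x : K).

(** The shift by 3 gives l_n < 1/2, so that [l_n, 1 - l_n] is nondegenerate from n = 0 on. *)
Let l_ n : K := n.+3%:R^-1.
Let l_gt0 n : 0 < l_ n. Proof. by rewrite invr_gt0. Qed.
Let l_lt2 n : l_ n < 2^-1.
Proof. by rewrite ltf_pV2 ?posrE// ltr_nat. Qed.
Let l_nd n k : (n <= k)%N -> l_ k <= l_ n.
Proof. by move=> nk; rewrite lef_pV2 ?posrE// ler_nat. Qed.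

Lemma cvg_inv_natS3 : (fun n => n.+3%:R^-1 : K) @ \oo --> (0 : K).
Proof. by have := @cvg_harmonic K; rewrite -2!cvg_shiftS. Qed.

Let l_near x : 0 < x -> \forall n \near \oo, l_ n <= x.
Proof.
move=> x0; move/cvgrPdist_lt : cvg_inv_natS3 => /(_ _ x0).
by apply: filterS => n; rewrite sub0r normrN gtr0_norm// => /ltW.
Qed.

Let D01 n x : l_ n <= x <= 1 - l_ n -> I01 x.
Proof.
move=> /andP[h1 h2]; rewrite /= in_itv/=; have := l_gt0 n.
by move=> h; apply/andP; split; lra.
Qed.

Let D01' x : I01 x -> \forall n \near \oo, l_ n <= x <= 1 - l_ n.
Proof.
rewrite /= in_itv/= => /andP[x0 x1].
have x1' : 0 < 1 - x by lra.
near=> n; apply/andP; split; first by near: n; exact: l_near.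
have : l_ n <= 1 - x by near: n; exact: l_near.
lra.
Unshelve. all: by end_near. Qed.

Let lt01 n : l_ n < 1 - l_ n.
Proof. by have := l_lt2 n; lra. Qed.

Let nd01 n k : (n <= k)%N -> l_ k <= l_ n /\ 1 - l_ n <= 1 - l_ k.
Proof. by move=> /l_nd h; split; lra. Qed.

Lemma ge0_integrable_FTC01 f F (M : K) :
  (forall x, I01 x -> {for x, continuous f}) ->
  (forall x, I01 x -> 0 <= f x) ->
  (forall x, I01 x -> is_derive x 1 F (f x)) ->
  (forall x, I01 x -> `|F x| <= M) -> mu.-integrable I01 (EFin \o f).
Proof. exact: (ge0_integrable_FTC D01 D01' lt01 nd01). Qed.

Lemma integral_FTC01 f F (l0 l1 : K) :
  (forall x, I01 x -> {for x, continuous f}) ->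
  mu.-integrable I01 (EFin \o f) ->
  (forall x, I01 x -> is_derive x 1 F (f x)) ->
  F x @[x --> 0^'+] --> l0 -> F x @[x --> 1^'-] --> l1 ->
  (\int[mu]_(x in I01) f x)%R = l1 - l0.
Proof.
move=> cf fi dF F0 F1.
apply: (integral_FTC_lim D01 D01' lt01 cf fi dF).
have l0' : l_ n @[n --> \oo] --> 0^'+.
  have h := cvg_inv_natS3.
  move=> A [e /= e0 eA].
  move/cvgrPdist_lt : h => /(_ _ e0); apply: filterS => n hn.
  exact: eA.
apply: cvgB.
  apply: (cvg_comp (fun n => 1 - l_ n) F _ F1).
  move=> A [e /= e0 eA].
  move/cvgrPdist_lt : cvg_inv_natS3 => /(_ _ e0); apply: filterS => n hn.
  apply: eA => /=; last by have := l_gt0 n; lra.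
  rewrite opprB addrC subrK.
  by move: hn; rewrite sub0r normrN.
exact: (cvg_comp l_ F l0' F0).
Qed.

Let D0y n x : l_ n <= x <= n.+1%:R -> I0y x.
Proof. by move=> /andP[h1 h2]; rewrite /= in_itv/= andbT; apply: lt_le_trans h1. Qed.

Let D0y' x : I0y x -> \forall n \near \oo, l_ n <= x <= n.+1%:R.
Proof.
rewrite /= in_itv/= andbT => x0.
near=> n; apply/andP; split; first by near: n; exact: l_near.
have : x <= n%:R by near: n; exact: nbhs_infty_ger.
by move=> /le_trans; apply; rewrite ler_nat.
Unshelve. all: by end_near. Qed.

Let lt0y n : l_ n < n.+1%:R.
Proof.
apply: lt_le_trans (l_lt2 n) _; rewrite (@le_trans _ _ 1)//; first by lra.
by rewrite ler1n.
Qed.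

Let nd0y n k : (n <= k)%N -> l_ k <= l_ n /\ n.+1%:R <= k.+1%:R :> K.
Proof. by move=> nk; split; [exact: l_nd|rewrite ler_nat]. Qed.

Lemma ge0_integrable_FTC0y f F (M : K) :
  (forall x, I0y x -> {for x, continuous f}) ->
  (forall x, I0y x -> 0 <= f x) ->
  (forall x, I0y x -> is_derive x 1 F (f x)) ->
  (forall x, I0y x -> `|F x| <= M) -> mu.-integrable I0y (EFin \o f).
Proof. exact: (ge0_integrable_FTC D0y D0y' lt0y nd0y). Qed.

Lemma is_derive_powR a x : 0 < x ->
  is_derive x 1 (fun t => t `^ a) (a * x `^ (a - 1)).
Proof.
move=> x0; have xin : x \in `]0, +oo[ by rewrite in_itv/= x0.
apply: DeriveDef; first exact: derivable_powR.
by rewrite -derive1E powR_derive1.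
Qed.

Lemma continuous_powR a x : 0 < x -> {for x, continuous (fun t : K => t `^ a)}.
Proof. by move=> /(is_derive_powR a)/derive_cont. Qed.

Lemma is_derive_powR_comp a f x (d : K) : is_derive x 1 f d -> 0 < f x ->
  is_derive x 1 (fun t => f t `^ a) (a * f x `^ (a - 1) * d).
Proof.
move=> df fx0.
exact: (@is_derive1_comp _ (fun t => t `^ a) f x _ _ (is_derive_powR a fx0) df).
Qed.

Lemma is_derive_onem x : is_derive x 1 (fun t : K => 1 - t) (-1).
Proof.
have := is_deriveB (is_derive_cst (1 : K) x 1) (is_derive_id x (1 : K)).
by move/is_derive_eq; apply; rewrite sub0r.
Qed.

Lemma is_derive_powR_onem a x : x < 1 ->
  is_derive x 1 (fun t => (1 - t) `^ a) (- (a * (1 - x) `^ (a - 1))).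
Proof.
move=> x1; have x1' : 0 < 1 - x by rewrite subr_gt0.
have := is_derive_powR_comp a (is_derive_onem x) x1'.
by move/is_derive_eq; apply; rewrite mulrN1.
Qed.

(** A sum of the two endpoint singularities, unlike their product, has the elementary bounded
    antiderivative u^a / a - (1 - u)^b / b. *)
Lemma integrable_beta_bound a b : 0 < a -> 0 < b ->
  mu.-integrable I01 (EFin \o (fun u => u `^ (a - 1) + (1 - u) `^ (b - 1))).
Proof.
move=> a0 b0.
apply: (@ge0_integrable_FTC01 _ (fun u => u `^ a / a - (1 - u) `^ b / b) (a^-1 + b^-1)).
- move=> x; rewrite /= in_itv/= => /andP[x0 x1].
  apply: continuousD; first exact: continuous_powR.
  exact: derive_cont (is_derive_powR_onem _ x1).
- by move=> x _; rewrite addr_ge0 ?powR_ge0.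
- move=> x; rewrite /= in_itv/= => /andP[x0 x1].
  have d1 := is_deriveZ a^-1 (is_derive_powR a x0).
  have d2 := is_deriveZ b^-1 (is_derive_powR_onem b x1).
  have := is_deriveB d1 d2.
  have -> : a^-1 \*: (fun t : K => t `^ a) - b^-1 \*: (fun t : K => (1 - t) `^ b) =
      fun u => u `^ a / a - (1 - u) `^ b / b.
    by apply/funext => u; rewrite !fctE /GRing.scale /= mulrC [X in _ - X]mulrC.
  move/is_derive_eq; apply; rewrite /GRing.scale /=.
  by field; rewrite !gt_eqF.
- move=> x; rewrite /= in_itv/= => /andP[x0 x1].
  have pow1 (c y : K) : 0 < c -> 0 < y < 1 -> `|y `^ c / c| <= c^-1.
    move=> c0 /andP[y0 y1]; rewrite ger0_norm ?divr_ge0 ?powR_ge0 ?(ltW c0)//.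
    rewrite ler_piMl ?invr_ge0 ?(ltW c0)// -[leRHS](powRr0 y).
    by apply: ger_powR; rewrite ?y0 ?ltW.
  rewrite (le_trans (ler_normB _ _))// lerD// pow1// ?x0// subr_gt0 x1 gtrBl x0 //.
Qed.

(* The integrand is the derivative of (t / (1 + t))^a / a, which is bounded. *)
Lemma integrable_gamma_bound a : 0 < a <= 1 ->
  mu.-integrable I0y (EFin \o (fun t => (t / (1 + t)) `^ (a - 1) * ((1 + t) ^+ 2)^-1)).
Proof.
move=> /andP[a0 a1].
have dv x : 0 < x -> is_derive x 1 (fun t : K => (1 + t)^-1) (- ((1 + x) ^+ 2)^-1).
  move=> x0.
  have d1 : is_derive x 1 (fun t : K => 1 + t) 1.
    have := is_deriveD (is_derive_cst (1 : K) x 1) (is_derive_id x (1 : K)).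
    by move/is_derive_eq; apply; rewrite add0r.
  have nz : 1 + x != 0 by rewrite gt_eqF// addr_gt0.
  have := @realfun.is_deriveV _ (fun t : K => 1 + t) x 1 1 nz d1.
  by move/is_derive_eq; apply; rewrite /GRing.scale /= mulr1.
have dw x : 0 < x -> is_derive x 1 (fun t : K => t / (1 + t)) (((1 + x) ^+ 2)^-1).
  move=> x0.
  have nz : 1 + x != 0 by rewrite gt_eqF// addr_gt0.
  have := is_deriveM (is_derive_id x (1 : K)) (dv _ x0).
  by move/is_derive_eq; apply; rewrite /GRing.scale /=; field.
have w0 x : 0 < x -> 0 < x / (1 + x) by move=> x0; rewrite divr_gt0// addr_gt0.
apply: (@ge0_integrable_FTC0y _ (fun t => (t / (1 + t)) `^ a / a) a^-1).
- move=> x; rewrite /= in_itv/= andbT => x0.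
  apply: continuousM.
    exact: derive_cont (is_derive_powR_comp (a - 1) (dw _ x0) (w0 _ x0)).
  have -> : (fun t : K => ((1 + t) ^+ 2)^-1) = (fun t => (1 + t)^-1 * (1 + t)^-1).
    by apply/funext => t; rewrite expr2 invfM.
  by apply: continuousM; exact: derive_cont (dv _ x0).
- by move=> x _; rewrite mulr_ge0 ?powR_ge0// invr_ge0 sqr_ge0.
- move=> x; rewrite /= in_itv/= andbT => x0.
  have := is_deriveZ a^-1 (is_derive_powR_comp a (dw _ x0) (w0 _ x0)).
  have -> : a^-1 \*: (fun t : K => (t / (1 + t)) `^ a) =
      fun t : K => (t / (1 + t)) `^ a / a.
    by apply/funext => u; exact: mulrC.
  move/is_derive_eq; apply; rewrite /GRing.scale /= !mulrA mulVf ?mul1r//.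
  by rewrite gt_eqF.
- move=> x; rewrite /= in_itv/= andbT => x0.
  rewrite ger0_norm ?divr_ge0 ?powR_ge0 ?(ltW a0)//.
  rewrite ler_piMl ?invr_ge0 ?(ltW a0)// -[leRHS](powRr0 (x / (1 + x))).
  apply: ger_powR; last exact: ltW.
  by rewrite w0//= ler_pdivrMr ?addr_gt0// mul1r; lra.
Qed.

(** Merges the behaviour near 0 and the exponential tail into the single majorant of
    [integrable_gamma_bound], which is comparable to t^(a - 1) near 0 and to t^(-2) at infinity. *)
Lemma gamma_bound_ge a C h (t : K) : 0 < a <= 1 -> 0 < t -> 0 <= C ->
  (t <= 1 -> h <= C * t `^ (a - 1)) -> (1 <= t -> h <= C * expR (- (t / 4))) ->
  h <= 128 * C * ((t / (1 + t)) `^ (a - 1) * ((1 + t) ^+ 2)^-1).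
Proof.
move=> /andP[a0 a1] t0 C0 h0 h1.
have w0 : 0 < t / (1 + t) by rewrite divr_gt0// addr_gt0.
have t1p : 0 < 1 + t by rewrite addr_gt0.
have [t1|/ltW t1] := leP t 1.
  apply: (le_trans (h0 t1)).
  (* The exponent is nonpositive and t / (1 + t) <= t. *)
  have h2 : t `^ (a - 1) <= (t / (1 + t)) `^ (a - 1).
    rewrite -[a - 1]opprB !powRN lef_pV2 ?posrE ?powR_gt0//.
    apply: ge0_ler_powR; rewrite ?nnegrE ?subr_ge0// ?ltW//.
    by rewrite ltr_pdivrMr// mulrDr mulr1 ltrDl mulr_gt0.
  have h3 : 1 <= 4 * ((1 + t) ^+ 2)^-1.
    rewrite ler_pdivlMr ?exprn_gt0// mul1r.
    by nra.
  have h4 : t `^ (a - 1) <= (t / (1 + t)) `^ (a - 1) * (4 * ((1 + t) ^+ 2)^-1).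
    by apply: (le_trans h2); rewrite ler_peMr// powR_ge0.
  have := ler_wpM2l C0 h4.
  have : 0 <= C * ((t / (1 + t)) `^ (a - 1) * (4 * ((1 + t) ^+ 2)^-1)).
    by rewrite mulr_ge0// mulr_ge0 ?powR_ge0// mulr_ge0// invr_ge0 sqr_ge0.
  set X := (t / _) `^ _; set Y := (_ ^+ 2)^-1.
  rewrite (_ : C * (X * (4 * Y)) = 4 * (C * X * Y)); last by ring.
  rewrite (_ : 128 * C * (X * Y) = 128 * (C * X * Y)); last by ring.
  by lra.
apply: (le_trans (h1 t1)).
rewrite [128 * C]mulrC -mulrA ler_wpM2l//.
have h2 : 1 <= (t / (1 + t)) `^ (a - 1).
  rewrite -[leLHS](powRr0 (t / (1 + t))); apply: ger_powR; last by lra.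
  by rewrite w0 ler_pdivrMr// mul1r; lra.
(* The quadratic term of e^(t/4) is t^2 / 32, and (1 + t)^2 <= 4 t^2 for t >= 1; 128 = 32 * 4. *)
have h3 : expR (- (t / 4)) <= 128 * ((1 + t) ^+ 2)^-1.
  rewrite expRN -[128]invrK -invfM lef_pV2 ?posrE ?expR_gt0 ?mulr_gt0 ?exprn_gt0//.
  have t4 : 0 <= t / 4 by rewrite divr_ge0// ltW.
  have := @expR_ge1Dxn K (t / 4) 1 t4.
  apply: le_trans.
  rewrite (_ : 2`!%:R = 2)// expr2.
  by nra.
apply: (le_trans h3); rewrite ler_wpM2l// ler_peMl// invr_ge0 sqr_ge0 //.
Qed.

End ConcreteIntervals.

(** * The substitution u = 1 - t/c *)

Section Substitution.
Variable K : realType.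
Local Notation mu := (@lebesgue_measure K).
Local Notation I01 := (`]0, 1[%classic : set K).
Variable c : K.
Hypothesis c0 : 0 < c.
Local Notation I0c := (`]0%R, c%R[%classic : set K).

Let phi (t : measurableTypeR K) : measurableTypeR K := 1 - t / c.

Let mphi : measurable_fun setT phi.
Proof.
have cphi : continuous (fun t : K => 1 - t / c).
  move=> x; apply: cvgB; first exact: cvg_cst.
  by apply: cvgM; [exact: cvg_id|exact: cvg_cst].
exact: measurable_realfun.continuous_measurable_fun cphi.
Qed.

Let phi_oc (a b : K) : phi @^-1` [set` `]a, b]] = [set` `[c * (1 - b), c * (1 - a)[].
Proof.
apply/seteqP; split => t; rewrite /= !in_itv/= /phi => /andP[h1 h2].
  have h : t / c * c = t by rewrite divfK// gt_eqF.
  by rewrite -h [c * _]mulrC [c * (1 - a)]mulrC ler_pM2r// ltr_pM2r//; apply/andP; split; lra.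
have h : t / c * c = t by rewrite divfK// gt_eqF.
rewrite -h [c * _]mulrC in h1; rewrite -h [c * _]mulrC in h2.
move: h1 h2; rewrite ler_pM2r// ltr_pM2r// => h1 h2.
by apply/andP; split; lra.
Qed.

(** By uniqueness of Lebesgue measure it suffices to compare half-open intervals. The map reverses
    orientation, so the closed end of the preimage changes side without affecting its length. *)
Let pushforward_phi A : measurable A ->
  pushforward mu phi A = mscale (NngNum (ltW c0)) mu A.
Proof.
move=> mA.
pose ci := NngNum (ltW (etrans (invr_gt0 c) c0)).
have h := @lebesgue_measure_unique K (mscale ci (pushforward mu phi)).
have hA : (mu A = (ci%:num)%:E * mu (phi @^-1` A))%E.
  apply: (h mphi _ A mA) => X /ocitvP [->|[[a b] /= ab ->]].
    by rewrite !measure0.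
  change (mu [set` `]a, b]%R] = (ci%:num)%:E * mu (phi @^-1` [set` `]a, b]%R]))%E.
  rewrite phi_oc !lebesgue_measure_itv /=.
  rewrite !lte_fin ab ltr_pM2l// ltrD2l ltrN2 ab -!EFinB -EFinM.
  by congr (_%:E); field; rewrite gt_eqF.
change (mu (phi @^-1` A) = c%:E * mu A)%E.
by rewrite hA muleA -EFinM /= mulfV ?mul1e// gt_eqF.
Qed.

Let ge0_integral_phi (f : K -> \bar K) : measurable_fun setT f ->
  (forall x, 0 <= f x)%E ->
  (\int[mu]_(t in phi @^-1` I01) f (phi t) = c%:E * \int[mu]_(u in I01) f u)%E.
Proof.
move=> mf f0.
have mI : measurable I01 by exact: measurable_itv.
have := @ge0_integral_pushforward _ _ _ _ K phi mphi mu I01 f mI (measurable_funTS mf).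
move=> /(_ (fun x _ => f0 x)) <-.
rewrite (eq_measure_integral (mscale (NngNum (ltW c0)) mu)); last first.
  by move=> A mA _; exact: pushforward_phi.
by rewrite ge0_integral_mscale//; exact: measurable_funTS.
Qed.

Let phi_I01 : phi @^-1` I01 = I0c.
Proof.
apply/seteqP; split => t; rewrite /= !in_itv/= /phi => /andP[h1 h2].
  have h : t / c * c = t by rewrite divfK// gt_eqF.
  have tc0 : 0 < t / c by lra.
  have tc1 : t / c < 1 by lra.
  by rewrite -h pmulr_lgt0// tc0 -[ltRHS]mul1r ltr_pM2r.
have tc0 : 0 < t / c by rewrite divr_gt0.
have tc1 : t / c < 1 by rewrite ltr_pdivrMr// mul1r.
by apply/andP; split; lra.
Qed.

(** The nonnegative case is applied to the positive and negative parts; integrability of the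
    composite makes both finite, so that real subtraction is legitimate. *)
Lemma Rintegral_rescale (f : K -> K) : measurable_fun I01 f ->
  mu.-integrable I0c (EFin \o (fun t => f (1 - t / c))) ->
  \int[mu]_(t in I0c) f (1 - t / c) = c * \int[mu]_(u in I01) f u.
Proof.
move=> mf fi.
have mI : measurable I01 by exact: measurable_itv.
have mI2 : measurable (I0c : set (measurableTypeR K)) by exact: measurable_itv.
(* Extension by 0 provides a function measurable on the whole line. *)
pose g : K -> \bar K := (EFin \o f) \_ I01.
have mg : measurable_fun setT g.
  by apply/(measurable_restrictT _ mI); exact/measurable_EFinP.
have gphi t : t \in I0c -> g (phi t) = (f (1 - t / c))%:E.
  by rewrite -phi_I01 => /set_mem /= h; rewrite /g patchE mem_set.
have gi : mu.-integrable I0c (g \o phi).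
  by apply: eq_integrable fi => // t tI; rewrite /= gphi.
have -> : \int[mu]_(t in I0c) f (1 - t / c) =
    fine (\int[mu]_(t in I0c) (g \o phi) t)%E.
  by congr fine; apply: eq_integral => t tI; rewrite /= gphi.
rewrite /Rintegral.
have -> : (\int[mu]_(u in I01) (f u)%:E = \int[mu]_(u in I01) g u)%E.
  by apply: eq_integral => u uI; rewrite /g patchE uI.
have mgp := measurable_funepos mg; have mgn := measurable_funeneg mg.
have hp := ge0_integral_phi mgp (funepos_ge0 g).
have hn := ge0_integral_phi mgn (funeneg_ge0 g).
rewrite phi_I01 in hp hn.
rewrite integralE [X in _ = _ * fine X]integralE.
have ep : (\int[mu]_(t in I0c) (g \o phi)^\+ t)%E =
    (c%:E * \int[mu]_(u in I01) g^\+ u)%E by rewrite funepos_comp; exact: hp.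
have en : (\int[mu]_(t in I0c) (g \o phi)^\- t)%E =
    (c%:E * \int[mu]_(u in I01) g^\- u)%E by rewrite funeneg_comp; exact: hn.
have fp := integrable_pos_fin_num mI2 gi.
have fn := integrable_neg_fin_num mI2 gi.
rewrite ep en.
have fin_div (x : \bar K) : (c%:E * x)%E \is a fin_num -> x \is a fin_num.
  by case: x => [r _ //||]; [rewrite mulry|rewrite mulrNy]; rewrite gtr0_sg// mul1e.
have fp' : (\int[mu]_(u in I01) g^\+ u)%E \is a fin_num.
  by apply: fin_div; rewrite -ep.
have fn' : (\int[mu]_(u in I01) g^\- u)%E \is a fin_num.
  by apply: fin_div; rewrite -en.
by rewrite -(fineK fp') -(fineK fn') -!EFinM -!EFinB /= mulrBr.
Qed.

End Substitution.

(** * Entrywise integration of matrix functions *)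

Section MatrixIntegrals.
Variables (K : realType) (m : nat).
Local Notation M := 'M[K[i]]_m.+1.
Local Notation mu := (@lebesgue_measure K).
Local Notation I01 := (`]0%R, 1%R[%classic : set K).
Implicit Types (A X : M) (F G : K -> M) (D : set K).

Definition mxmeas D F := forall i j,
  measurable_fun D (fun x => Re (F x i j)) /\ measurable_fun D (fun x => Im (F x i j)).

Lemma mxder_mxmeas D F : open D -> (forall x, D x -> exists E, mxder F x E) ->
  mxmeas D F.
Proof.
move=> oD dF i j; split; apply: open_continuous_measurable_fun => //.
  by move=> x /set_mem /dF [E /(_ i j) [h _]]; exact: derive_cont h.
by move=> x /set_mem /dF [E /(_ i j) [_ h]]; exact: derive_cont h.
Qed.

Lemma mxintegrable_le D F (g : K -> K) : measurable D -> mxmeas D F ->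
  (forall x, D x -> nrm (F x) <= g x) -> mu.-integrable D (EFin \o g) ->
  mxintegrable D F.
Proof.
move=> mD mF Fg gi i j; have [mr mi] := mF i j.
split; apply: (@le_integrable _ (measurableTypeR K) K mu D mD _ (EFin \o g)) gi.
- exact/measurable_EFinP.
- move=> x Dx /=; rewrite lee_fin (le_trans (nrm_Re _ _ _))//.
  by rewrite (le_trans (Fg _ Dx))// ler_norm.
- exact/measurable_EFinP.
- move=> x Dx /=; rewrite lee_fin (le_trans (nrm_Im _ _ _))//.
  by rewrite (le_trans (Fg _ Dx))// ler_norm.
Qed.

Lemma Rintegral_DCT D (f_ : nat -> K -> K) (f g : K -> K) : measurable D ->
  (forall n, measurable_fun D (f_ n)) ->
  (forall x, D x -> f_ ^~ x @ \oo --> f x) ->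
  (forall n x, D x -> `|f_ n x| <= g x) -> mu.-integrable D (EFin \o g) ->
  mu.-integrable D (EFin \o f) /\
  (fun n => \int[mu]_(x in D) f_ n x) @ \oo --> \int[mu]_(x in D) f x.
Proof.
move=> mD mf_ f_f f_g gi.
have mf : measurable_fun D f by exact: measurable_fun_cvg f_f.
have [||||| fi _ h] := @dominated_convergence _ (measurableTypeR K) K mu D mD
  (fun n => EFin \o f_ n) (EFin \o f) (EFin \o g) => //.
- by move=> n; apply/measurable_EFinP; exact: mf_.
- by apply/measurable_EFinP; exact: mf.
- by apply: aeW => x Dx /=; apply: cvg_EFin; [exact: nearW|exact: f_f].
- by apply: aeW => x n Dx /=; rewrite lee_fin f_g.
split => //.
have fin : (\int[mu]_(x in D) (EFin \o f) x)%E \is a fin_num.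
  exact: integrable_fin_num.
by apply: fine_cvg; rewrite fineK.
Qed.

Lemma mxDCT D (F_ : nat -> K -> M) F (g : K -> K) : measurable D ->
  (forall n, mxmeas D (F_ n)) ->
  (forall x, D x -> mxcvg (F_ ^~ x) (F x)) ->
  (forall n x, D x -> nrm (F_ n x) <= g x) -> mu.-integrable D (EFin \o g) ->
  mxintegrable D F /\ mxcvg (fun n => mxintegral D (F_ n)) (mxintegral D F).
Proof.
move=> mD mF FF Fg gi.
have hr i j := @Rintegral_DCT D (fun n x => Re (F_ n x i j)) (fun x => Re (F x i j)) g
  mD (fun n => (mF n i j).1) (fun x Dx => @mxcvg_Re _ _ _ _ i j (FF x Dx))
  (fun n x Dx => le_trans (nrm_Re _ _ _) (Fg n x Dx)) gi.
have hi i j := @Rintegral_DCT D (fun n x => Im (F_ n x i j)) (fun x => Im (F x i j)) g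
  mD (fun n => (mF n i j).2) (fun x Dx => @mxcvg_Im _ _ _ _ i j (FF x Dx))
  (fun n x Dx => le_trans (nrm_Im _ _ _) (Fg n x Dx)) gi.
split; first by move=> i j; split; [have [] := hr i j|have [] := hi i j].
apply: mxcvg_entries => i j.
  rewrite /mxintegral mxE /=; under eq_fun do rewrite mxE /=.
  by have [_] := hr i j.
rewrite /mxintegral mxE /=; under eq_fun do rewrite mxE /=.
by have [_] := hi i j.
Qed.

Lemma eq_mxintegral D F G : (forall x, D x -> F x = G x) ->
  mxintegral D F = mxintegral D G.
Proof.
move=> FG; apply/matrixP => i j; rewrite !mxE.
by congr (_ +i* _); apply: eq_Rintegral => x /set_mem Dx; rewrite FG.
Qed.

Lemma eq_mxintegrable D F G : measurable D ->
  (forall x, D x -> F x = G x) -> mxintegrable D F -> mxintegrable D G.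
Proof.
move=> mD FG Fi i j; have [hr hi] := Fi i j; split.
  by apply: eq_integrable hr => // x /set_mem Dx; rewrite FG.
by apply: eq_integrable hi => // x /set_mem Dx; rewrite FG.
Qed.

Lemma Rintegral_sumr D (I : Type) (r : seq I) (f : I -> K -> K) : measurable D ->
  (forall i, mu.-integrable D (EFin \o f i)) ->
  mu.-integrable D (EFin \o (fun x => \sum_(i <- r) f i x)) /\
  \int[mu]_(x in D) (\sum_(i <- r) f i x) = \sum_(i <- r) \int[mu]_(x in D) f i x.
Proof.
move=> mD fi; elim: r => [|i r [IHi IH]].
  split; first by under eq_fun do rewrite big_nil; exact: integrable0.
  by under eq_Rintegral do rewrite big_nil; rewrite big_nil Rintegral_cst// mul0r.
split.
  under [X in EFin \o X]eq_fun do rewrite big_cons.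
  exact: (@integrableD _ (measurableTypeR K) K mu D mD (EFin \o f i)
    (EFin \o (fun x => \sum_(i <- r) f i x))).
under eq_Rintegral do rewrite big_cons.
by rewrite big_cons -IH RintegralD.
Qed.

Lemma mxintegralD D F G : measurable D -> mxintegrable D F -> mxintegrable D G ->
  mxintegrable D (fun x => F x + G x) /\
  mxintegral D (fun x => F x + G x) = mxintegral D F + mxintegral D G.
Proof.
move=> mD Fi Gi; split.
  move=> i j; have [fr fi] := Fi i j; have [gr gi] := Gi i j; split.
    under [X in _.-integrable _ X]eq_fun do rewrite mxE raddfD EFinD.
    exact: integrableD.
  under [X in _.-integrable _ X]eq_fun do rewrite mxE raddfD EFinD.
  exact: integrableD.
apply/matrixP => i j; have [fr fi] := Fi i j; have [gr gi] := Gi i j.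
rewrite !mxE; apply/eqP; rewrite eq_complex /=; apply/andP; split; apply/eqP.
  by rewrite -RintegralD//; apply: eq_Rintegral => x _; rewrite mxE raddfD.
by rewrite -RintegralD//; apply: eq_Rintegral => x _; rewrite mxE raddfD.
Qed.

Lemma mxintegralMl D A F : measurable D -> mxintegrable D F ->
  mxintegrable D (fun x => A * F x) /\
  mxintegral D (fun x => A * F x) = A * mxintegral D F.
Proof.
move=> mD Fi.
have hZ (a : K) (f : K -> K) : mu.-integrable D (EFin \o f) ->
    mu.-integrable D (EFin \o (fun x => a * f x)).
  move=> fi; exact: (@integrableZl _ (measurableTypeR K) K mu D mD a (EFin \o f) fi).
have hr i j k : mu.-integrable D (EFin \o (fun x =>
    Re (A i k) * Re (F x k j) - Im (A i k) * Im (F x k j))).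
  have [fr fi] := Fi k j.
  exact: (@integrableB _ (measurableTypeR K) K mu D mD _ _ (hZ _ _ fr) (hZ _ _ fi)).
have hi i j k : mu.-integrable D (EFin \o (fun x =>
    Re (A i k) * Im (F x k j) + Im (A i k) * Re (F x k j))).
  have [fr fi] := Fi k j.
  exact: (@integrableD _ (measurableTypeR K) K mu D mD _ _ (hZ _ _ fi) (hZ _ _ fr)).
have er i j x : Re ((A * F x) i j) =
    \sum_k (Re (A i k) * Re (F x k j) - Im (A i k) * Im (F x k j)).
  by rewrite mxE Re_sum; apply: eq_bigr => k _; rewrite ReM.
have ei i j x : Im ((A * F x) i j) =
    \sum_k (Re (A i k) * Im (F x k j) + Im (A i k) * Re (F x k j)).
  by rewrite mxE Im_sum; apply: eq_bigr => k _; rewrite ImM.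
split.
  move=> i j; split.
    under [X in _.-integrable _ X]eq_fun do rewrite er.
    by have [] := Rintegral_sumr (index_enum _) mD (hr i j).
  under [X in _.-integrable _ X]eq_fun do rewrite ei.
  by have [] := Rintegral_sumr (index_enum _) mD (hi i j).
apply/matrixP => i j; rewrite !mxE.
apply/eqP; rewrite eq_complex /=; apply/andP; split; apply/eqP.
  under eq_Rintegral do rewrite er.
  have [_ ->] := Rintegral_sumr (index_enum _) mD (hr i j).
  rewrite Re_sum; apply: eq_bigr => k _; rewrite mxE ReM /=.
  have [fr fi] := Fi k j.
  by rewrite RintegralB ?RintegralZl//; exact: hZ.
under eq_Rintegral do rewrite ei.
have [_ ->] := Rintegral_sumr (index_enum _) mD (hi i j).
rewrite Im_sum; apply: eq_bigr => k _; rewrite mxE ImM /=.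
have [fr fi] := Fi k j.
by rewrite RintegralD ?RintegralZl//; exact: hZ.
Qed.

Lemma mxintegral_tr D F : mxintegral D (fun x => (F x)^T) = (mxintegral D F)^T.
Proof.
apply/matrixP => i j; rewrite !mxE.
by congr (_ +i* _); apply: eq_Rintegral => x _; rewrite mxE.
Qed.

Lemma mxintegrable_tr D F : mxintegrable D F -> mxintegrable D (fun x => (F x)^T).
Proof.
move=> Fi i j; have [fr fi] := Fi j i.
split; first by under [X in _.-integrable _ X]eq_fun do rewrite mxE.
by under [X in _.-integrable _ X]eq_fun do rewrite mxE.
Qed.

(** Transposition reduces this to multiplication on the left. *)
Lemma mxintegralMr D A F : measurable D -> mxintegrable D F ->
  mxintegrable D (fun x => F x * A) /\
  mxintegral D (fun x => F x * A) = mxintegral D F * A.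
Proof.
move=> mD Fi.
have trM X Y : (X * Y)^T = Y^T * X^T :> M by exact: trmx_mul.
have [h1 h2] := mxintegralMl A^T mD (mxintegrable_tr Fi).
have e : (fun x => A^T * (F x)^T) = fun x => (F x * A)^T.
  by apply/funext => x; rewrite trM.
rewrite e in h1 h2; split.
  by have := mxintegrable_tr h1; under eq_fun do rewrite trmxK.
by apply: trmx_inj; rewrite -mxintegral_tr h2 mxintegral_tr trM.
Qed.

Lemma mxintegral_comm D X F : measurable D -> mxintegrable D F ->
  (forall x, D x -> GRing.comm X (F x)) -> GRing.comm X (mxintegral D F).
Proof.
move=> mD Fi XF; rewrite /GRing.comm.
have [_ <-] := mxintegralMl X mD Fi; have [_ <-] := mxintegralMr X mD Fi.
exact: eq_mxintegral.
Qed.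

Lemma nrm_cvg0_Re (T : Type) (Fl : set_system T) (FF : Filter Fl) (F : T -> M) L i j :
  nrm (F x - L) @[x --> Fl] --> (0 : K) -> Re (F x i j) @[x --> Fl] --> Re (L i j).
Proof.
move=> h; apply/cvgrPdist_lt => e e0.
move/cvgrPdist_lt : h => /(_ _ e0); apply: filterS => k.
rewrite sub0r normrN ger0_norm ?nrm_ge0// => /(le_lt_trans _); apply.
by rewrite distrC -raddfB (le_trans _ (nrm_Re _ i j))// !mxE.
Qed.

Lemma nrm_cvg0_Im (T : Type) (Fl : set_system T) (FF : Filter Fl) (F : T -> M) L i j :
  nrm (F x - L) @[x --> Fl] --> (0 : K) -> Im (F x i j) @[x --> Fl] --> Im (L i j).
Proof.
move=> h; apply/cvgrPdist_lt => e e0.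
move/cvgrPdist_lt : h => /(_ _ e0); apply: filterS => k.
rewrite sub0r normrN ger0_norm ?nrm_ge0// => /(le_lt_trans _); apply.
by rewrite distrC -raddfB (le_trans _ (nrm_Im _ i j))// !mxE.
Qed.

Lemma mxder_nrm_cvg F x E : mxder F x E -> nrm (F t - F x) @[t --> x] --> (0 : K).
Proof.
move=> dF.
pose e t := \sum_i \sum_j (`|Re (F t i j) - Re (F x i j)| + `|Im (F t i j) - Im (F x i j)|).
have z : \sum_(i < m.+1) \sum_(j < m.+1) (`|0 : K| + `|0 : K|) = 0 :> K.
  by rewrite big1// => i _; rewrite big1// => j _; rewrite normr0 addr0.
have h : e t @[t --> x] --> \sum_(i < m.+1) \sum_(j < m.+1) (`|0 : K| + `|0 : K|).
  apply: cvg_sumr => i; apply: cvg_sumr => j; have [dr di] := dF i j.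
  apply: cvgD; apply: cvg_norm; apply/subr_cvg0; first exact: derive_cont dr.
  exact: derive_cont di.
rewrite z in h.
apply: (@squeeze_cvgr _ _ _ _ (fun=> 0) e) => //; last exact: cvg_cst.
apply: nearW => t; rewrite nrm_ge0 (le_trans (nrm_le_sum _))// /e.
apply: ler_sum => i _; apply: ler_sum => j _; rewrite !mxE.
by case: (F t i j) (F x i j) => [a b] [c d].
Qed.

(** The boundary values enter as one-sided limits, since matrix powers of u are controlled only for
    u > 0. *)
Lemma mxFTC01 F (f : K -> M) L0 L1 :
  (forall x, I01 x -> mxder F x (f x)) ->
  (forall x, I01 x -> exists E, mxder f x E) -> mxintegrable I01 f ->
  nrm (F x - L0) @[x --> 0^'+] --> (0 : K) ->
  nrm (F x - L1) @[x --> 1^'-] --> (0 : K) ->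
  mxintegral I01 f = L1 - L0.
Proof.
move=> dF df fi F0 F1; apply/matrixP => i j; have [fr fim] := fi i j.
rewrite !mxE; apply/eqP; rewrite eq_complex; apply/andP; split; apply/eqP.
  rewrite raddfB /=; apply: (@integral_FTC01 _ _ (fun x => Re (F x i j))).
  - by move=> x /df [E /(_ i j) [h _]]; exact: derive_cont h.
  - exact: fr.
  - by move=> x /dF /(_ i j) [].
  - exact: nrm_cvg0_Re.
  - exact: nrm_cvg0_Re.
rewrite raddfB /=; apply: (@integral_FTC01 _ _ (fun x => Im (F x i j))).
- by move=> x /df [E /(_ i j) [_ h]]; exact: derive_cont h.
- exact: fim.
- by move=> x /dF /(_ i j) [].
- exact: nrm_cvg0_Im.
- exact: nrm_cvg0_Im.
Qed.

Lemma mxintegral_rescale F (c : K) : 0 < c -> mxmeas I01 F ->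
  mxintegrable `]0, c[ (fun t => F (1 - t / c)) ->
  mxintegral `]0, c[ (fun t => F (1 - t / c)) = c%:C *: mxintegral I01 F.
Proof.
move=> c0 mF Fi; apply/matrixP => i j; have [mr mi] := mF i j; have [fr fi] := Fi i j.
rewrite !mxE; apply/eqP; rewrite eq_complex ReM ImM /= !mul0r subr0 addr0.
by apply/andP; split; apply/eqP; exact: Rintegral_rescale.
Qed.

(** Moves integrals over growing intervals to one fixed domain, as dominated convergence
    requires. *)
Lemma mxintegral_patch D D' F : measurable D' -> D' `<=` D ->
  mxintegral D' F = mxintegral D (fun x => if x \in D' then F x else 0).
Proof.
move=> mD' DD'; apply/matrixP => i j; rewrite !mxE.
have e : D' = D `&` D' by apply/seteqP; split => [x h|x []//]; split => //; exact: DD'.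
congr (_ +i* _).
  rewrite [in LHS]e Rintegral_mkcondr; apply: eq_Rintegral => x _; rewrite patchE.
  by case: ifP => // _; rewrite mxE.
rewrite [in LHS]e Rintegral_mkcondr; apply: eq_Rintegral => x _; rewrite patchE.
by case: ifP => // _; rewrite mxE.
Qed.

End MatrixIntegrals.

(** * Positive stable matrices and Pochhammer symbols *)

Section StableMatrices.
Variables (K : realType) (m : nat).
Local Notation M := 'M[K[i]]_m.+1.
Implicit Types (A Q R S X : M).

Lemma positive_stable_unit A : positive_stable A -> A \is a GRing.unit.
Proof.
move=> As; rewrite -row_free_unit -kermx_eq0; apply: contraT => k0.
have : eigenvalue A 0 by rewrite /eigenvalue /eigenspace raddf0 subr0.
by move=> /As; rewrite ltxx.
Qed.

Lemma positive_stableD A (a : K) : 0 <= a -> positive_stable A ->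
  positive_stable (A + a%:C%:M).
Proof.
move=> a0 As c /eigenvalueP[v vA v0].
have : eigenvalue A (c - a%:C).
  apply/eigenvalueP; exists v => //.
  by rewrite scalerBl -vA mulmxDr mul_mx_scalar addrK.
by move=> /As; rewrite raddfB /= => h; lra.
Qed.

Lemma positive_stable_natD A n : positive_stable A -> positive_stable (A + n%:R%:M).
Proof.
move=> As; have -> : (n%:R : K[i]) = (n%:R : K)%:C.
  by rewrite (rmorph_nat (real_complex K)).
exact: positive_stableD.
Qed.

Lemma positive_stable1 : positive_stable (1 : M).
Proof.
move=> c /eigenvalueP[v]; rewrite mulmx1 => vc v0.
suff -> : c = 1 by rewrite ltr01.
apply/eqP; rewrite -subr_eq0; have : (c - 1) *: v == 0.
  by rewrite scalerBl scale1r -vc subrr.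
by rewrite scaler_eq0 (negbTE v0) orbF.
Qed.

Lemma mxpochS A n : mxpoch A n.+1 = mxpoch A n * (A + n%:R%:M).
Proof. by rewrite /mxpoch big_ord_recr. Qed.

Lemma mxpoch0 A : mxpoch A 0 = 1.
Proof. by rewrite /mxpoch big_ord0. Qed.

Lemma mxpoch_comm A X n : GRing.comm X A -> GRing.comm X (mxpoch A n).
Proof.
move=> XA; apply: commr_prod => i _; apply: commrD => //; exact: comm_scalar.
Qed.

Lemma mxpoch_unit A n : positive_stable A -> mxpoch A n \is a GRing.unit.
Proof.
move=> As; apply: rpred_prod => i _; apply: positive_stable_unit.
exact: positive_stable_natD.
Qed.

Lemma mxpochSl A n : mxpoch A n.+1 = A * mxpoch (A + 1) n.
Proof.
rewrite /mxpoch big_ord_recl /= raddf0 addr0; congr (_ * _).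
by apply: eq_bigr => i _; rewrite /bump /= natrD raddfD /= addrA.
Qed.

End StableMatrices.

(** * The matrix Beta integral *)

Section Beta.
Variables (K : realType) (m : nat).
Local Notation M := 'M[K[i]]_m.+1.
Local Notation mu := (@lebesgue_measure K).
Local Notation I01 := (`]0%R, 1%R[%classic : set K).
Implicit Types (A Q R S X : M) (u : K).

Definition beta_kernel Q S (u : K) : M :=
  cpowmx u%:C (Q - 1%:M) * cpowmx (1 - u)%:C (S - 1%:M).

Definition mxBeta Q S : M := mxintegral I01 (beta_kernel Q S).

Lemma cpowmx_sub1_bound A : positive_stable A ->
  exists a C, [/\ 0 < a <= 1, 0 <= C & forall u, 0 < u <= 1 ->
    nrm (cpowmx u%:C (A - 1%:M)) <= C * u `^ (a - 1)].
Proof.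
move=> /cpowmx_stable_bound[a [C [a01 C0 hC]]]; exists a, C; split => // u /andP[u0 u1].
have := hC u; rewrite u0 u1 => /(_ isT).
rewrite (cpowmx_sub1 A u0) nrmZ cmod_real gtr0_norm// => h.
rewrite -(ler_pM2l u0) (le_trans h)// mulrCA mulr_powRB1// ?ltW//.
by case/andP: a01.
Qed.

Lemma powR_sub1_le2 (a u : K) : 0 < a <= 1 -> 2^-1 <= u -> u <= 1 -> u `^ (a - 1) <= 2.
Proof.
move=> /andP[a0 a1] u2 u1; have u0 : 0 < u by apply: lt_le_trans u2.
rewrite -[a - 1]opprB powRN -[leRHS]invrK lef_pV2 ?posrE ?powR_gt0//.
rewrite (le_trans u2)// ger1_powR ?u0//; lra.
Qed.

(** Each factor is singular at one endpoint only: on the half of the interval away from it, it is at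
    most twice its constant. So the product is dominated by a sum. *)
Lemma beta_kernel_bound Q S : positive_stable Q -> positive_stable S ->
  exists a b C, [/\ 0 < a, 0 < b, 0 <= C & forall u, I01 u ->
    nrm (beta_kernel Q S u) <= C * (u `^ (a - 1) + (1 - u) `^ (b - 1))].
Proof.
move=> /cpowmx_sub1_bound[a [C [a01 C0 hC]]] /cpowmx_sub1_bound[b [D [b01 D0 hD]]].
have [a0 a1] := andP a01; have [b0 b1] := andP b01.
exists a, b, (C * D * 2); split => //; first by rewrite !mulr_ge0.
move=> u; rewrite /= in_itv/= => /andP[u0 u1].
apply: (le_trans (nrmM _ _)).
apply: (@le_trans _ _ ((C * u `^ (a - 1)) * (D * (1 - u) `^ (b - 1)))).
  apply: ler_pM; rewrite ?nrm_ge0//; first by apply: hC; rewrite u0 ltW.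
  by apply: hD; apply/andP; split; lra.
rewrite mulrACA -(mulrA (C * D)) ler_wpM2l ?mulr_ge0//.
have pa := powR_ge0 u (a - 1); have pb := powR_ge0 (1 - u) (b - 1).
have [u2|u2] := leP u 2^-1.
  have h : (1 - u) `^ (b - 1) <= 2 by apply: powR_sub1_le2 => //; lra.
  have := ler_wpM2l pa h; lra.
have h : u `^ (a - 1) <= 2 by apply: powR_sub1_le2 => //; lra.
have := ler_wpM2r pb h; lra.
Qed.

Lemma mxder_cpowmx_onem A u : u < 1 ->
  mxder (fun t => cpowmx (1 - t)%:C A) u (- (A * cpowmx (1 - u)%:C (A - 1%:M))).
Proof.
move=> u1; have u1' : 0 < 1 - u by rewrite subr_gt0.
have := @mxder_comp _ _ (fun t => cpowmx t%:C A) (fun t => 1 - t) u _ _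
  (mxder_cpowmx A u1') (is_derive_onem u).
by apply: mxder_eq; rewrite rmorphN rmorph1 raddfN /= mulNr mul1r.
Qed.

Lemma mxder_beta_kernel Q S u : I01 u -> exists E, mxder (beta_kernel Q S) u E.
Proof.
rewrite /= in_itv/= => /andP[u0 u1]; eexists; apply: mxderM.
  exact: mxder_cpowmx.
exact: mxder_cpowmx_onem.
Qed.

Lemma itv01_open : open I01. Proof. exact: itv_open. Qed.
Lemma itv01_measurable : measurable I01. Proof. exact: measurable_itv. Qed.

Lemma beta_kernel_meas Q S : mxmeas I01 (beta_kernel Q S).
Proof. by apply: (mxder_mxmeas itv01_open) => u; exact: mxder_beta_kernel. Qed.

Lemma integrable_beta_boundZ (a b C : K) : 0 < a -> 0 < b ->
  mu.-integrable I01 (EFin \o (fun u => C * (u `^ (a - 1) + (1 - u) `^ (b - 1)))).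
Proof.
move=> a0 b0; have h := integrable_beta_bound a0 b0.
exact: (@integrableZl _ (measurableTypeR K) K mu I01 itv01_measurable C _ h).
Qed.

Lemma beta_kernel_integrable Q S : positive_stable Q -> positive_stable S ->
  mxintegrable I01 (beta_kernel Q S).
Proof.
move=> Qs Ss; have [a [b [C [a0 b0 C0 hC]]]] := beta_kernel_bound Qs Ss.
apply: (mxintegrable_le itv01_measurable (beta_kernel_meas Q S) hC).
exact: integrable_beta_boundZ.
Qed.

Lemma beta_kernel_comm Q S X u : GRing.comm X Q -> GRing.comm X S ->
  GRing.comm X (beta_kernel Q S u).
Proof.
move=> XQ XS; apply: commrM; apply: cpowmx_comm; apply: commrB => //; exact: comm_scalar.
Qed.

Lemma mxBeta_comm Q S X : positive_stable Q -> positive_stable S ->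
  GRing.comm X Q -> GRing.comm X S -> GRing.comm X (mxBeta Q S).
Proof.
move=> Qs Ss XQ XS; apply: (mxintegral_comm itv01_measurable).
  exact: beta_kernel_integrable.
by move=> u _; exact: beta_kernel_comm.
Qed.

End Beta.

(** * The functional equation of Beta *)

Section BetaRecursion.
Variables (K : realType) (m : nat).
Local Notation M := 'M[K[i]]_m.+1.
Local Notation I01 := (`]0%R, 1%R[%classic : set K).
Implicit Types (A Q R S X : M) (u : K).

Lemma ring_subr0 (T : pzRingType) (x a y b : T) :
  x * a + - y * b = 0 - 0 -> x * a = y * b.
Proof. by rewrite subrr mulNr => /eqP; rewrite subr_eq0 => /eqP. Qed.

Lemma ring_oppr1 (T : pzRingType) (x a : T) : - x * a = 0 - 1 -> x * a = 1.
Proof. by rewrite sub0r mulNr => /eqP; rewrite eqr_opp => /eqP. Qed.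

Lemma ring_comm_cancel (T : pzRingType) (w p r b d : T) :
  w * r = r * w -> w * p = p * w -> p * b = r * d -> p * (w * b) = r * (w * d).
Proof. by move=> wr wp h; rewrite mulrA -wp -mulrA h !mulrA wr. Qed.

Lemma scale_mull (c : K[i]) A : c%:M * A = c *: A.
Proof. exact: mul_scalar_mx. Qed.

Lemma powR_onem_le1 (a u : K) : 0 < a -> 0 < u < 1 -> u `^ a <= 1.
Proof.
move=> a0 /andP[u0 u1]; rewrite -[leRHS](powRr0 u).
by apply: ger_powR; rewrite ?u0 ltW.
Qed.

Lemma right_cvg0 (F : K -> M) (a C : K) : 0 < a ->
  (forall u, 0 < u < 1 -> nrm (F u) <= C * u `^ a) ->
  nrm (F x - 0) @[x --> 0^'+] --> (0 : K).
Proof.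
move=> a0 hF; have h : C * u `^ a @[u --> 0^'+] --> C * 0.
  by apply: cvgM; [exact: cvg_cst|exact: powR_cvg0].
rewrite mulr0 in h.
apply: (@squeeze_cvgr _ _ _ _ (fun=> 0) (fun u => C * u `^ a)) => //; last exact: cvg_cst.
near=> u; rewrite subr0 nrm_ge0 hF//; apply/andP; split.
  by near: u; exact: nbhs_right_gt.
by near: u; exact: nbhs_right_lt.
Unshelve. all: by end_near. Qed.

Lemma left_cvg0 (F : K -> M) (a C : K) : 0 < a ->
  (forall u, 0 < u < 1 -> nrm (F u) <= C * (1 - u) `^ a) ->
  nrm (F x - 0) @[x --> 1^'-] --> (0 : K).
Proof.
move=> a0 hF.
have h0 : (1 - u) @[u --> (1 : K)^'-] --> (0 : K)^'+.
  move=> V [e /= e0 eV]; exists e => //= u; rewrite /= => ue u1.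
  apply: eV => /=; last by rewrite subr_gt0.
  by rewrite sub0r normrN.
have h : C * (1 - u) `^ a @[u --> 1^'-] --> C * 0.
  apply: cvgM; first exact: cvg_cst.
  exact: (cvg_comp _ _ h0 (powR_cvg0 a0)).
rewrite mulr0 in h.
apply: (@squeeze_cvgr _ _ _ _ (fun=> 0) (fun u => C * (1 - u) `^ a)) => //; last exact: cvg_cst.
near=> u; rewrite subr0 nrm_ge0 hF//; apply/andP; split.
  by near: u; exact: nbhs_left_gt.
by near: u; exact: nbhs_left_lt.
Unshelve. all: by end_near. Qed.

(** The derivative of u^Q (1 - u)^S, with a = u^(Q - I) and b = (1 - u)^(S - I); writing v as 1 - u
    produces the two Beta kernels. *)
Lemma beta_derivative (T : algType K[i]) (q s a b : T) (u v : K[i]) : v = 1 - u ->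
  q * a = a * q -> s * a = a * s ->
  q * a * (v *: b) + u *: a * - (s * b) = q * (a * b) - (q + s) * (u *: a * b).
Proof.
move=> -> qa sa.
rewrite -!scalerAr -!scalerAl -!scalerAr mulrN scalerN (mulrA a) -sa mulrDl scalerDr.
by rewrite -!mulrA scalerBl scale1r opprD addrA.
Qed.

(** The primitive u^Q (1 - u)^S vanishes at both endpoints by stability, so its derivative has
    integral 0. *)
Lemma mxBeta_recursion Q S : positive_stable Q -> positive_stable S ->
  GRing.comm Q S -> Q * mxBeta Q S = (Q + S) * mxBeta (Q + 1) S.
Proof.
move=> Qs Ss QS.
have Q1s : positive_stable (Q + 1) by exact: (@positive_stable_natD _ _ Q 1%N).
pose F u := cpowmx u%:C Q * cpowmx (1 - u)%:C S.
pose f u := Q * beta_kernel Q S u - (Q + S) * beta_kernel (Q + 1) S u.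
have dF u : I01 u -> mxder F u (f u).
  rewrite /= in_itv/= => /andP[u0 u1].
  have u1' : 0 < 1 - u by rewrite subr_gt0.
  have := mxderM (mxder_cpowmx Q u0) (mxder_cpowmx_onem S u1).
  apply: mxder_eq; rewrite /f /beta_kernel.
  rewrite (cpowmx_sub1 S u1') (cpowmx_sub1 Q u0) addrK (cpowmx_sub1 Q u0).
  apply: beta_derivative; first by rewrite rmorphB rmorph1.
    by apply: cpowmx_comm; apply: commrB => //; exact: comm_scalar.
  apply: cpowmx_comm; apply: commrB; last exact: comm_scalar.
  exact: commr_sym.
have [i1 e1] := mxintegralMl Q (@itv01_measurable K) (beta_kernel_integrable Qs Ss).
have [i2 e2] := mxintegralMl (- (Q + S)) (@itv01_measurable K) (beta_kernel_integrable Q1s Ss).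
have [i3 e3] := mxintegralD (@itv01_measurable K) i1 i2.
have ff : (fun u => Q * beta_kernel Q S u + - (Q + S) * beta_kernel (Q + 1) S u) = f.
  by apply/funext => u; rewrite /f mulNr.
rewrite ff in i3 e3.
have [a [C [/andP[a0 a1] C0 hC]]] := cpowmx_stable_bound Qs.
have [b [D [/andP[b0 b1] D0 hD]]] := cpowmx_stable_bound Ss.
have hF u : 0 < u < 1 -> nrm (F u) <= (C * u `^ a) * (D * (1 - u) `^ b).
  move=> /andP[u0 u1]; apply: (le_trans (nrmM _ _)).
  apply: ler_pM; rewrite ?nrm_ge0//; first by apply: hC; rewrite u0 ltW.
  by apply: hD; apply/andP; split; lra.
have : mxintegral I01 f = 0 - 0.
  apply: (mxFTC01 dF) => //.
  - move=> u uI; have [E1 h1] := mxder_beta_kernel Q S uI.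
    have [E2 h2] := mxder_beta_kernel (Q + 1) S uI.
    exists (Q * E1 + - (Q + S) * E2); rewrite -ff.
    by apply: mxderD; exact: mxderMl.
  - apply: (@right_cvg0 _ a (C * D)) => // u u01; apply: (le_trans (hF _ u01)).
    have [u0 u1] := andP u01.
    rewrite mulrACA mulrA ler_piMr ?mulr_ge0 ?powR_ge0//.
    by apply: powR_onem_le1 => //; apply/andP; split; lra.
  - apply: (@left_cvg0 _ b (C * D)) => // u u01; apply: (le_trans (hF _ u01)).
    have [u0 u1] := andP u01.
    rewrite mulrACA ler_wpM2l ?mulr_ge0// ler_piMl ?powR_ge0//.
    exact: powR_onem_le1.
have e4 : mxintegral I01 f = Q * mxBeta Q S + - (Q + S) * mxBeta (Q + 1) S.
  exact: etrans e3 (congr2 +%R e1 e2).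
by move=> h; exact: (ring_subr0 (etrans (esym e4) h)).
Qed.

(** The kernel is (1 - u)^(S - I), with -S times it the derivative of (1 - u)^S, which falls from I
    to 0. *)
Lemma mxBeta_1 S : positive_stable S -> S * mxBeta 1 S = 1.
Proof.
move=> Ss.
have s1 := @positive_stable1 K m.
pose F u := cpowmx (1 - u)%:C S.
pose f u := - S * beta_kernel 1 S u.
have dF u : u < 1 -> 0 < u -> mxder F u (f u).
  move=> u1 u0.
  have := mxder_cpowmx_onem S u1.
  apply: mxder_eq; rewrite /f /beta_kernel.
  have -> : (1 : M) - 1%:M = 0 by rewrite subrr.
  by rewrite /cpowmx scaler0 mxexp0 mul1r mulNr.
have [i1 e1] := mxintegralMl (- S) (@itv01_measurable K) (beta_kernel_integrable s1 Ss).
have [b [D [/andP[b0 b1] D0 hD]]] := cpowmx_stable_bound Ss.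
have : mxintegral I01 f = 0 - 1.
  apply: (@mxFTC01 _ _ F) => //.
  - by move=> u; rewrite /= in_itv/= => /andP[u0 u1]; exact: dF.
  - move=> u uI; have [E1 h1] := mxder_beta_kernel 1 S uI.
    by exists (- S * E1); exact: mxderMl.
  (* At u = 0 the base 1 - u equals 1, so differentiability already gives the one-sided limit. *)
  - have F0 : F 0 = 1 by rewrite /F subr0 cpowmx_base1.
    rewrite -F0; apply: cvg_at_right_filter.
    exact: mxder_nrm_cvg (mxder_cpowmx_onem S ltr01).
  - apply: (@left_cvg0 _ b D) => // u /andP[u0 u1].
    by apply: hD; apply/andP; split; lra.
rewrite e1; exact: ring_oppr1.
Qed.

Lemma mxBeta_poch Q S n : positive_stable Q -> positive_stable S ->
  GRing.comm Q S ->
  mxpoch Q n * mxBeta Q S = mxpoch (Q + S) n * mxBeta (Q + n%:R%:M) S.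
Proof.
move=> Qs Ss QS; elim: n => [|n IH].
  have -> : Q + 0%:R%:M = Q by rewrite raddf0 addr0.
  by rewrite (mxpoch0 Q) (mxpoch0 (Q + S)).
have cn X : GRing.comm Q X -> GRing.comm (Q + n%:R%:M) X.
  move=> h; apply: commr_sym; apply: commrD; first exact: commr_sym.
  exact: comm_scalar.
have cQS := cn _ QS.
have rec := mxBeta_recursion (@positive_stable_natD _ _ Q n Qs) Ss cQS.
rewrite !mxpochS -mulrA.
have -> : Q + S + n%:R%:M = Q + n%:R%:M + S by rewrite addrAC.
have -> : Q + n.+1%:R%:M = Q + n%:R%:M + 1 by rewrite -natr1 raddfD /= addrA.
rewrite -(mulrA (mxpoch (Q + S) n)) -rec.
have c1 : GRing.comm (Q + n%:R%:M) (mxpoch (Q + S) n).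
  apply: mxpoch_comm; apply: cn; apply: commrD; [exact: commr_refl|exact: QS].
have c2 : GRing.comm (Q + n%:R%:M) (mxpoch Q n).
  by apply: mxpoch_comm; apply: cn; exact: commr_refl.
exact: (ring_comm_cancel c1 c2 IH).
Qed.

End BetaRecursion.

Section ConvergenceTools.
Variables (K : realType) (m : nat).
Local Notation M := 'M[K[i]]_m.+1.

Lemma mxcvg_near (u v : nat -> M) L : (\forall k \near \oo, u k = v k) ->
  mxcvg u L -> mxcvg v L.
Proof.
move=> uv h; apply: (mxcvg_squeeze _ h).
by apply: filterS uv => k ->.
Qed.

Lemma mxcvg_real (x : nat -> K) (l : K) : x @ \oo --> l ->
  mxcvg (fun k => (x k)%:C%:M : M) (l%:C%:M).
Proof.
move=> xl; apply: (@mxcvg_squeeze _ _ (fun k => `|x k - l| * nrm (1 : M))).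
  apply: nearW => k; rewrite -raddfB /= -rmorphB /= -[_%:M]mulr1 scale_mull nrmZ.
  by rewrite cmod_real.
rewrite -[X in _ --> X](mul0r (nrm (1 : M))); apply: cvgM; last exact: cvg_cst.
by rewrite -(normr0 K); apply: cvg_norm; apply/subr_cvg0.
Qed.

End ConvergenceTools.

(** * Gauss' limit for Gamma *)

Section GaussLimit.
Variables (K : realType) (m : nat).
Local Notation M := 'M[K[i]]_m.+1.
Local Notation mu := (@lebesgue_measure K).
Local Notation I0y := (`]0%R, +oo[%classic : set K).
Implicit Types (A Q R S X : M) (t u : K).

Lemma cvg_inv_natS2 : (fun k => k.+2%:R^-1 : K) @ \oo --> (0 : K).
Proof. by have := @cvg_harmonic K; rewrite -cvg_shiftS. Qed.

Lemma expR_onem_le t : 1 - t <= expR (- t).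
Proof. exact: expR_ge1Dx. Qed.

Lemma expR_onem_ge t : t < 1 -> expR (- (t / (1 - t))) <= 1 - t.
Proof.
move=> t1; have t1' : 0 < 1 - t by rewrite subr_gt0.
rewrite expRN -[leRHS]invrK lef_pV2 ?posrE ?expR_gt0 ?invr_gt0//.
apply: le_trans (expR_ge1Dx _); rewrite le_eqVlt; apply/orP; left; apply/eqP.
by field; rewrite gt_eqF.
Qed.

(** Squeezed between the powers of e^(-x / (1 - x)) <= 1 - x <= e^(-x) at x = t / (k + 2); both
    exponents tend to -t. *)
Lemma cvg_onem_pow t : 0 < t ->
  (fun k => (1 - t / k.+2%:R) ^+ k.+1) @ \oo --> expR (- t).
Proof.
move=> t0.
have he := cvg_inv_natS2.
have h1 : t * (1 - (k.+2%:R)^-1) @[k --> \oo] --> t.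
  have : t * (1 - (k.+2%:R)^-1) @[k --> \oo] --> t * (1 - 0).
    by apply: cvgM; [exact: cvg_cst|apply: cvgB => //; exact: cvg_cst].
  by rewrite subr0 mulr1.
have h2 : t * (1 - (k.+2%:R)^-1) / (1 - t * (k.+2%:R)^-1) @[k --> \oo] --> t.
  have : t * (1 - (k.+2%:R)^-1) / (1 - t * (k.+2%:R)^-1) @[k --> \oo] --> t / (1 - t * 0).
    apply: cvgM => //; apply: cvgV; first by rewrite mulr0 subr0 oner_eq0.
    by apply: cvgB; [exact: cvg_cst|apply: cvgM => //; exact: cvg_cst].
  by rewrite mulr0 subr0 divr1.
have ce (u : nat -> K) : u @ \oo --> t -> expR (- u k) @[k --> \oo] --> expR (- t).
  by move=> ut; apply: continuous_cvg; [exact: continuous_expR|exact: cvgN].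
apply: (squeeze_cvgr _ (ce _ h2) (ce _ h1)).
have : \forall k \near \oo, (k.+2%:R)^-1 < t^-1 / 2.
  have p : 0 < t^-1 / 2 by rewrite divr_gt0// invr_gt0.
  move/cvgrPdist_lt : he => /(_ _ p); apply: filterS => k.
  by rewrite sub0r normrN gtr0_norm.
apply: filterS => k hk.
have N0 : 0 < k.+2%:R :> K by [].
have x1 : t / k.+2%:R < 1.
  have := ltr_pM2l t0 (k.+2%:R)^-1 (t^-1 / 2); rewrite hk mulrA divff ?gt_eqF//.
  by move=> h; apply: lt_trans h _; lra.
have x1' : 0 < 1 - t / k.+2%:R by rewrite subr_gt0.
have e1 : t * (1 - (k.+2%:R)^-1) = k.+1%:R * (t / k.+2%:R).
  have -> : k.+1%:R = k.+2%:R - 1 :> K by rewrite -[k.+2%:R]natr1 addrK.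
  by field; rewrite gt_eqF.
apply/andP; split.
  have -> : - (t * (1 - (k.+2%:R)^-1) / (1 - t / k.+2%:R)) =
      k.+1%:R * (- (t / k.+2%:R / (1 - t / k.+2%:R))).
    by rewrite e1 mulrN -mulrA.
  rewrite mulrC expRM_natr lerXn2r ?nnegrE ?expR_ge0 ?(ltW x1')//.
  exact: expR_onem_ge.
have -> : - (t * (1 - (k.+2%:R)^-1)) = - (t / k.+2%:R) * k.+1%:R by rewrite e1; ring.
rewrite expRM_natr lerXn2r ?nnegrE ?expR_ge0 ?(ltW x1')//.
exact: expR_onem_le.
Qed.

Lemma cpowmx_div A (s t : K) : 0 < s -> 0 < t ->
  cpowmx (t / s)%:C A = cpowmx t%:C A * cpowmx s%:C (- A).
Proof.
move=> s0 t0; rewrite !cpowmxE ?divr_gt0// ln_div ?posrE//.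
rewrite rmorphB scalerBl -scalerN mxexpD//.
by apply: commrZ; apply: commrN; apply: commr_sym; apply: commrZ; exact: commr_refl.
Qed.

Lemma mxmeas_patch (D D' : set K) (F : K -> M) : measurable D -> measurable D' ->
  D' `<=` D -> mxmeas D' F -> mxmeas D (fun x => if x \in D' then F x else 0).
Proof.
move=> mD mD' DD' mF i j; have [mr mi] := mF i j.
have e : D `&` D' = D' by apply/setIidPr.
split.
  have : measurable_fun D ((fun x => Re (F x i j)) \_ D').
    by apply/(measurable_restrict _ mD' mD); rewrite e.
  congr (measurable_fun _ _); apply/funext => x; rewrite patchE.
  by case: ifP => // _; rewrite mxE.
have : measurable_fun D ((fun x => Im (F x i j)) \_ D').
  by apply/(measurable_restrict _ mD' mD); rewrite e.
congr (measurable_fun _ _); apply/funext => x; rewrite patchE.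
by case: ifP => // _; rewrite mxE.
Qed.

Section GaussKernel.
Variables (Q S : M).
Hypotheses (Qs : positive_stable Q) (Ss : positive_stable S) (QS : GRing.comm Q S).

Implicit Types (c : K) (n : nat).

(* Used with c = k + 2 and n = k + 1, for which it tends to e^-t t^(S - I). *)
Definition gauss_kernel c n t : M :=
  cpowmx (1 - t / c)%:C (Q + n%:R%:M) * cpowmx t%:C (S - 1%:M).

Local Notation I0c c := (`]0%R, c[%classic : set K).

Lemma onem_div_itv c t : 0 < c -> I0c c t -> [/\ 0 < t, 0 < 1 - t / c & 1 - t / c < 1].
Proof.
move=> c0; rewrite /= in_itv/= => /andP[t0 tN].
have h1 : 0 < t / c by rewrite divr_gt0.
have h2 : t / c < 1 by rewrite ltr_pdivrMr// mul1r.
by split => //; lra.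
Qed.

Lemma is_derive_onem_div c t : is_derive t 1 (fun t : K => 1 - t / c) (- c^-1).
Proof.
have := is_deriveB (is_derive_cst (1 : K) t 1) (is_deriveZ (c^-1) (is_derive_id t (1 : K))).
have -> : cst 1 - c^-1 \*: id = fun t : K => 1 - t / c.
  by apply/funext => x; rewrite !fctE /GRing.scale /= mulrC.
by move/is_derive_eq; apply; rewrite sub0r /GRing.scale /= mulr1.
Qed.

Lemma mxder_gauss_kernel c n t : 0 < c -> I0c c t -> exists E, mxder (gauss_kernel c n) t E.
Proof.
move=> c0 /(onem_div_itv c0)[t0 h1 h2]; eexists; apply: mxderM.
  exact: (@mxder_comp _ _ (fun t => cpowmx t%:C (Q + n%:R%:M)) (fun t : K => 1 - t / c)
    t _ _ (mxder_cpowmx _ h1) (is_derive_onem_div c t)).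
exact: mxder_cpowmx.
Qed.

Lemma gauss_kernel_meas c n : 0 < c -> mxmeas (I0c c) (gauss_kernel c n).
Proof.
move=> c0; apply: mxder_mxmeas => [|t]; first exact: itv_open.
exact: mxder_gauss_kernel.
Qed.

(** The bound must be uniform in c and n, to serve both as integrability and as domination in the
    limit; c <= 2 n is what keeps the exponential decay uniform. *)
Lemma gauss_kernel_bound : exists a D, [/\ 0 < a <= 1, 0 <= D &
  forall c n t, 0 < c -> c <= 2 * n%:R -> I0c c t ->
  nrm (gauss_kernel c n t) <= 128 * D * ((t / (1 + t)) `^ (a - 1) * ((1 + t) ^+ 2)^-1)].
Proof.
have [aq [CQ [/andP[aq0 _] CQ0 hQ]]] := cpowmx_stable_bound Qs.
have [b [CS [b01 CS0 hS]]] := cpowmx_sub1_bound Ss.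
have [CL [CL0 hL]] := cpowmx_large_bound (S - 1%:M).
exists b, (CQ * (CS + CL)); split => //; first by rewrite mulr_ge0// addr_ge0.
move=> c n t c0 cn tI; have [t0 h1 h2] := onem_div_itv c0 tI.
(* Here (1 - t/c)^n <= e^(-t n/c) <= e^(-t/2), while stability bounds (1 - t/c)^Q by [CQ]. *)
have hq : nrm (cpowmx (1 - t / c)%:C (Q + n%:R%:M)) <= CQ * expR (- (t / 2)).
  rewrite (cpowmx_natD Q _ h1) nrmZ cmod_real ger0_norm ?exprn_ge0 ?(ltW h1)//.
  rewrite mulrC ler_pM ?nrm_ge0 ?exprn_ge0 ?(ltW h1)//.
    apply: le_trans (hQ _ _) _; first by rewrite h1 ltW.
    rewrite ler_piMr//; apply: powR_onem_le1 => //; by rewrite h1.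
  apply: (@le_trans _ _ (expR (- (t / c)) ^+ n)).
    by rewrite lerXn2r ?nnegrE ?expR_ge0 ?(ltW h1)//; exact: expR_onem_le.
  rewrite -expRM_natr ler_expR mulNr lerN2 -mulrA ler_wpM2l ?(ltW t0)//.
  by rewrite ler_pdivlMl// ler_pdivrMr// mulrC.
apply: gamma_bound_ge => //; first by rewrite mulr_ge0// addr_ge0.
  move=> t1; apply: (le_trans (nrmM _ _)); rewrite -mulrA ler_pM ?nrm_ge0//.
    apply: (le_trans hq); rewrite ler_piMr// -[leRHS]expR0 ler_expR.
    by rewrite oppr_le0 divr_ge0// ltW.
  apply: (le_trans (hS _ _)); first by rewrite t0.
  by rewrite ler_wpM2r ?powR_ge0// lerDl.
move=> t1; apply: (le_trans (nrmM _ _)).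
apply: (@le_trans _ _ ((CQ * expR (- (t / 2))) * (CL * expR (t / 4)))).
  by rewrite ler_pM ?nrm_ge0//; exact: hL.
rewrite mulrACA -expRD (_ : - (t / 2) + t / 4 = - (t / 4)); last by field.
by rewrite ler_wpM2r ?expR_ge0// ler_wpM2l// lerDr.
Qed.

Lemma integrable_gamma_boundZ a (C : K) : 0 < a <= 1 ->
  mu.-integrable I0y (EFin \o (fun t => C * ((t / (1 + t)) `^ (a - 1) * ((1 + t) ^+ 2)^-1))).
Proof.
move=> a01; have h := integrable_gamma_bound a01.
have mI : measurable I0y by exact: measurable_itv.
exact: (@integrableZl _ (measurableTypeR K) K mu I0y mI C _ h).
Qed.

Lemma sub_I0c c : I0c c `<=` I0y.
Proof. by move=> t; rewrite /= !in_itv/= andbT => /andP[]. Qed.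

Lemma gauss_kernel_integrable c n : 0 < c -> c <= 2 * n%:R ->
  mxintegrable (I0c c) (gauss_kernel c n).
Proof.
move=> c0 cn; have [a [D [a01 D0 hD]]] := gauss_kernel_bound.
have mI : measurable (I0c c) by exact: measurable_itv.
have mIy : measurable I0y by exact: measurable_itv.
apply: (mxintegrable_le mI (gauss_kernel_meas n c0) (fun t => hD c n t c0 cn)).
apply: (@integrableS _ (measurableTypeR K) K mu I0y) => //; first exact: sub_I0c.
exact: integrable_gamma_boundZ.
Qed.

Lemma ring_commute_front (T : algType K[i]) (a b d : T) (x : K[i]) :
  a * d = d * a -> b * d = d * b -> a * (b * (x *: d)) = (x *: d) * (a * b).
Proof.
by move=> ad bd; rewrite -!scalerAr -scalerAl bd !mulrA ad.
Qed.

(** The I subtracted in the Beta kernel lowers n + 1 to n, and (t/c)^(S - I) releases the constant c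
    c^(-S). *)
Lemma beta_kernel_rescale c n t : 0 < c -> I0c c t ->
  beta_kernel (Q + n.+1%:R%:M) S (1 - t / c) =
  (c%:C *: cpowmx c%:C (- S)) * gauss_kernel c n t.
Proof.
move=> c0 tI; have [t0 h1 h2] := onem_div_itv c0 tI.
rewrite /beta_kernel /gauss_kernel.
have -> : Q + n.+1%:R%:M - 1%:M = Q + n%:R%:M.
  by rewrite -[n.+1%:R]natr1 raddfD /= addrA addrK.
have -> : 1 - (1 - t / c) = t / c by rewrite opprB addrC subrK.
rewrite (cpowmx_div _ c0 t0).
have -> : cpowmx c%:C (- (S - 1%:M)) = c%:C *: cpowmx c%:C (- S).
  by rewrite opprB addrC (cpowmx_natD (- S) 1 c0) expr1.
have SQ : GRing.comm S (Q + n%:R%:M).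
  by apply: commrD; [exact: commr_sym|exact: comm_scalar].
apply: ring_commute_front.
  apply: cpowmx_comm; apply: commrN; apply: commr_sym; exact: cpowmx_comm.
apply: cpowmx_comm; apply: commrN; apply: commr_sym; apply: cpowmx_comm.
by apply: commrB; [exact: commr_refl|exact: comm_scalar].
Qed.

Lemma ring_scale_cancel (T : algType K[i]) (a b d e : T) (x : K[i]) : x != 0 ->
  b * a = 1 -> x *: a * d = x *: e -> b * e = d.
Proof.
move=> x0 ab; rewrite -scalerAl => /(scalerI x0) <-.
by rewrite mulrA ab mul1r.
Qed.

(** The change of variables contributes a factor c, which cancels the scalar c released by the
    kernel; c^S then cancels c^(-S). *)
Lemma gauss_integral c n : 0 < c -> c <= 2 * n%:R ->
  cpowmx c%:C S * mxBeta (Q + n.+1%:R%:M) S = mxintegral (I0c c) (gauss_kernel c n).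
Proof.
move=> c0 cn.
have mI : measurable (I0c c) by exact: measurable_itv.
set W := c%:C *: cpowmx c%:C (- S).
have [i1 e1] := mxintegralMl W mI (gauss_kernel_integrable c0 cn).
have e2 : mxintegral (I0c c) (fun t => beta_kernel (Q + n.+1%:R%:M) S (1 - t / c)) =
    W * mxintegral (I0c c) (gauss_kernel c n).
  by rewrite -e1; apply: eq_mxintegral => t; exact: beta_kernel_rescale.
have i2 : mxintegrable (I0c c) (fun t => beta_kernel (Q + n.+1%:R%:M) S (1 - t / c)).
  by apply: (eq_mxintegrable mI _ i1) => t tI; rewrite (beta_kernel_rescale n c0 tI).
have e3 := mxintegral_rescale c0 (beta_kernel_meas (Q + n.+1%:R%:M) S) i2.
have nz : c%:C != 0 by rewrite eq_complex /= gt_eqF.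
exact: (ring_scale_cancel nz (cpowmxNr _ _) (etrans (esym e2) e3)).
Qed.

Lemma cpowmx_near1 (A : M) (x : nat -> K) : x @ \oo --> (0 : K) ->
  mxcvg (fun k => cpowmx (1 - x k)%:C A) 1.
Proof.
move=> x0; have h := mxder_nrm_cvg (mxder_cpowmx_onem A (@ltr01 K)).
rewrite subr0 cpowmx_base1 in h.
exact: (cvg_comp x _ x0 h).
Qed.

(** The power splits into the scalar (1 - t/c)^n, tending to e^(-t), and (1 - t/c)^Q, tending to I
    by continuity at base 1. *)
Lemma gauss_kernel_cvg t : 0 < t ->
  mxcvg (fun k => gauss_kernel k.+2%:R k.+1 t) ((expR (- t))%:C *: cpowmx t%:C (S - 1%:M)).
Proof.
move=> t0.
have ct : (fun k => t / k.+2%:R) @ \oo --> (0 : K).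
  rewrite -(mulr0 t); apply: cvgM; [exact: cvg_cst|exact: cvg_inv_natS2].
have h1 := mxcvg_real m (cvg_onem_pow t0).
have h2 := mxcvgM (mxcvgM h1 (cpowmx_near1 Q ct)) (mxcvg_cst (cpowmx t%:C (S - 1%:M))).
rewrite mulr1 scale_mull in h2.
apply: (mxcvg_near _ h2).
move/cvgrPdist_lt : ct => /(_ _ ltr01); apply: filterS => k.
rewrite sub0r normrN gtr0_norm ?divr_gt0// => tk.
rewrite scale_mull /gauss_kernel (cpowmx_natD Q) // subr_gt0 //.
Qed.

Lemma gauss_limit :
  mxcvg (fun k => cpowmx (k.+2%:R : K)%:C S * mxBeta (Q + k.+2%:R%:M) S) (mxGamma S).
Proof.
have [a [D [a01 D0 hD]]] := gauss_kernel_bound.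
have mIy : measurable I0y by exact: measurable_itv.
have c0 k : 0 < k.+2%:R :> K by [].
have cn k : k.+2%:R <= 2 * k.+1%:R :> K.
  by rewrite -natrM ler_nat mul2n -addnn addSnnS leq_addl.
(* Extension by 0 gives a common domain; every t > 0 eventually lies in ]0, k + 2[, so pointwise
   limits are unaffected. *)
pose H k t := if t \in I0c k.+2%:R then gauss_kernel k.+2%:R k.+1 t else 0.
have e k : cpowmx (k.+2%:R : K)%:C S * mxBeta (Q + k.+2%:R%:M) S = mxintegral I0y (H k).
  rewrite (gauss_integral (c0 k) (cn k)).
  by apply: mxintegral_patch; [exact: measurable_itv|exact: sub_I0c].
have -> : (fun k => cpowmx (k.+2%:R : K)%:C S * mxBeta (Q + k.+2%:R%:M) S) =
    fun k => mxintegral I0y (H k) by apply/funext.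
have [|||//|_ h] := @mxDCT _ _ I0y H (fun t => (expR (- t))%:C *: cpowmx t%:C (S - 1%:M))
  (fun t => 128 * D * ((t / (1 + t)) `^ (a - 1) * ((1 + t) ^+ 2)^-1)) mIy.
- move=> k; apply: mxmeas_patch; [exact: mIy|exact: measurable_itv|exact: sub_I0c|].
  exact: gauss_kernel_meas.
- move=> t; rewrite /= in_itv/= andbT => t0.
  apply: (mxcvg_near _ (gauss_kernel_cvg t0)).
  have : \forall k \near \oo, t <= k%:R by exact: nbhs_infty_ger.
  apply: filterS => k tk; rewrite /H mem_set//= in_itv/= t0.
  by rewrite (le_lt_trans tk)// ltr_nat ltnS leqnSn.
- move=> k t _; rewrite /H; case: ifP => [/set_mem|_].
    exact: hD.
  by rewrite nrm0 !mulr_ge0 ?powR_ge0// invr_ge0 sqr_ge0.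
- exact: integrable_gamma_boundZ.
exact: h.
Qed.

End GaussKernel.
End GaussLimit.

(** * Boundedness of the Weierstrass products *)

Section WeierstrassBound.
Variables (K : realType) (m : nat).
Local Notation M := 'M[K[i]]_m.+1.
Implicit Types (A X : M) (t u : K).

Lemma ring_move_back (T : pzRingType) (w e p z : T) :
  e * (p * z) = p * z * e -> w * e * (p * z) = w * p * (z * e).
Proof. by move=> h; rewrite -mulrA h !mulrA. Qed.

Lemma ring_derivative_onem_exp (T : algType K[i]) (a e : T) (x : K[i]) :
  a * e + (1 + x *: a) * (- a * e) = - (x *: (a * a * e)).
Proof.
by rewrite mulrDl mul1r mulNr mulrN -scalerAl addrA addrN add0r mulrA.
Qed.

(** The first-order terms of the two factors cancel: the derivative is -x A^2 e^(-x A), of norm at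
    most d x, and integrating gives a multiple of x^2. *)
Lemma onem_exp_bound A : exists c, 0 <= c /\ forall x, 0 <= x <= 1 ->
  nrm ((1 + x%:C *: A) * mxexp (x%:C *: - A) - 1) <= c * x ^+ 2.
Proof.
pose B := nrm (1 : M) + expR (nrm A).
have B0 : 0 <= B by rewrite addr_ge0 ?nrm_ge0 ?expR_ge0.
pose d := nrm A * nrm A * B.
have d0 : 0 <= d by rewrite !mulr_ge0 ?nrm_ge0.
pose k : K := (2 * m.+1 ^ 2)%:R.
exists (k * (d / 2)); split; first by rewrite mulr_ge0 ?ler0n// divr_ge0.
move=> x /andP[x0 x1].
pose F t : M := (1 + t%:C *: A) * mxexp (t%:C *: - A).
have F0 : F 0 = 1 by rewrite /F !scale0r addr0 mxexp0 mulr1.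
have dlin t : mxder (fun t : K => 1 + t%:C *: A) t A.
  have h1 := mxderMr A (@mxder_real K m id t 1 (is_derive_id t (1 : K))).
  have h2 := mxderD (mxder_cst (1 : M) t) h1.
  apply: eq_mxder (mxder_eq _ h2) => [s|]; first by rewrite scale_mull.
  by rewrite add0r mul1r.
have := @mxder_bound K m F (fun t => - (t%:C *: (A * A * mxexp (t%:C *: - A))))
  (fun t => d / 2 * t ^+ 2) (fun t => d * t) 0 x x0.
rewrite F0 expr0n /= mulr0 subr0 -/k mulrA; apply.
- move=> t _; have := mxderM (dlin t) (mxder_mxexp (- A) t).
  by apply: mxder_eq; exact: ring_derivative_onem_exp.
- move=> t _; have := is_deriveZ (d / 2) (is_deriveX 2 (is_derive_id t (1 : K))).
  have -> : d / 2 \*: id ^+ 2 = fun t : K => d / 2 * t ^+ 2 by apply/funext.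
  move/is_derive_eq; apply; rewrite /GRing.scale /= expr1 mulr1.
  by field.
- move=> t /andP[t0 tx]; rewrite nrmN nrmZ cmod_real ger0_norm// mulrC ler_wpM2r//.
  apply: (le_trans (nrmM _ _)); rewrite /d ler_pM ?nrm_ge0 ?nrmM//.
  apply: (le_trans (nrm_mxexp _)); rewrite /B lerD2l ler_expR nrmZ nrmN cmod_real.
  by rewrite ger0_norm// ler_piMl ?nrm_ge0// (le_trans tx).
Qed.

Definition harmonic_sum n : K := \sum_(j < n) j.+1%:R^-1.

(** Both inequalities are sums of 1/(k + 2) <= ln (k + 2) - ln (k + 1) <= 1/(k + 1). *)
Lemma harmonic_sum_ln n : 0 <= harmonic_sum n.+1 - ln n.+1%:R <= 1.
Proof.
have n0 k : 0 < k.+1%:R :> K by [].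
have up k : ln (k.+2%:R : K) - ln k.+1%:R <= k.+1%:R^-1.
  rewrite -ln_div ?posrE// (_ : k.+2%:R / k.+1%:R = 1 + k.+1%:R^-1 :> K).
    by apply: le_ln1Dx; rewrite (lt_trans (ltrN10 K))// invr_gt0.
  by rewrite -[k.+2%:R]natr1 mulrDl divff ?gt_eqF// mul1r.
have lo k : k.+2%:R^-1 <= ln (k.+2%:R : K) - ln k.+1%:R.
  rewrite -lerN2 opprB -ln_div ?posrE//.
  rewrite (_ : k.+1%:R / k.+2%:R = 1 + - k.+2%:R^-1 :> K).
    apply: le_ln1Dx; rewrite ltrN2 invf_lt1//.
    by rewrite ltr1n.
  by rewrite -[X in X / _](addrK 1) natr1 mulrBl divff ?gt_eqF// mul1r.
apply/andP; split.
  (* The upper bounds on the increments telescope to the logarithm of the next integer, so the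
     induction runs on this stronger form. *)
  suff : ln n.+2%:R <= harmonic_sum n.+1.
    rewrite subr_ge0; apply: le_trans; rewrite ler_ln ?posrE// ler_nat//.
  elim: n => [|n IH].
    have := up 0%N; rewrite ln1 subr0 /harmonic_sum big_ord_recl big_ord0 addr0; exact.
  rewrite /harmonic_sum big_ord_recr /= -/(harmonic_sum n.+1).
  apply: le_trans (lerD IH (up n.+1)).
  by rewrite [leRHS]addrC subrK.
elim: n => [|n IH].
  by rewrite /harmonic_sum big_ord_recl big_ord0 addr0 ln1 subr0 invr1.
rewrite /harmonic_sum big_ord_recr /= -/(harmonic_sum n.+1).
by move: IH (lo n); set a := ln _; set b := ln _; set h := harmonic_sum _; set i := _^-1; lra.
Qed.

(** The partial product of (I + A/j) e^(-A/j), with its exponentials gathered in front. These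
    convergence factors keep it bounded, whereas the product of the I + A/j alone behaves like
    n^A. *)
Definition weierstrass A n : M :=
  mxexp ((harmonic_sum n)%:C *: - A) * \prod_(j < n) (1 + (j.+1%:R^-1 : K)%:C *: A).

(* The factors are I + O(1/j^2), and 1/(n+1)^2 is at most twice
   the increment of 1 - 1/(n+1). *)
Lemma weierstrass_bound A : exists c, forall n, nrm (weierstrass A n) <= c.
Proof.
have [c [c0 hc]] := onem_exp_bound A.
suff h n : nrm (weierstrass A n) <= nrm (1 : M) * expR (2 * c * (1 - n.+1%:R^-1)).
  exists (nrm (1 : M) * expR (2 * c)) => n; apply: (le_trans (h n)).
  rewrite ler_wpM2l ?nrm_ge0// ler_expR ler_piMr ?mulr_ge0// gerBl//.
elim: n => [|n IH].
  rewrite /weierstrass /harmonic_sum !big_ord0 scale0r mxexp0 mulr1.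
  by rewrite invr1 subrr mulr0 expR0 mulr1.
pose x : K := n.+1%:R^-1.
have x01 : 0 <= x <= 1 by rewrite invr_ge0 ler0n/= invf_le1 ?ltr0n// ler1n.
pose Y := (1 + x%:C *: A) * mxexp (x%:C *: - A).
have e : weierstrass A n.+1 = weierstrass A n * Y.
  rewrite /weierstrass /harmonic_sum !big_ord_recr /= -/(harmonic_sum n) -/x.
  rewrite rmorphD scalerDl mxexpD; last first.
    by apply: commrZ; apply: commr_sym; apply: commrZ; exact: commr_refl.
  set E := mxexp (x%:C *: - A); set P := \prod_(j < n) _; set Z := 1 + _.
  have AE : GRing.comm E A.
    by apply: commr_sym; apply: mxexp_comm; apply: commrZ; apply: commrN; exact: commr_refl.
  have EZ y : GRing.comm E (1 + y *: A) by apply: commrD; [exact: commr1|exact: commrZ].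
  have EP : GRing.comm E (P * Z) by apply: commrM; [apply: commr_prod => j _|]; exact: EZ.
  exact: (ring_move_back _ EP).
rewrite e (_ : weierstrass A n * Y = weierstrass A n + weierstrass A n * (Y - 1)); last first.
  by rewrite mulrBr mulr1 addrC subrK.
apply: (le_trans (nrmD _ _)).
apply: (@le_trans _ _ (nrm (weierstrass A n) * (1 + c * x ^+ 2))).
  by rewrite [leRHS]mulrDr mulr1 lerD2l (le_trans (nrmM _ _))// ler_wpM2l ?nrm_ge0// hc.
apply: (@le_trans _ _ (nrm (1 : M) * expR (2 * c * (1 - x)) * expR (c * x ^+ 2))).
  apply: ler_pM => //; rewrite ?nrm_ge0//.
    by rewrite addr_ge0// mulr_ge0// sqr_ge0.
  exact: expR_ge1Dx.
rewrite -mulrA -expRD ler_wpM2l ?nrm_ge0// ler_expR.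
have -> : n.+2%:R^-1 = x / (1 + x).
  rewrite /x -[n.+2%:R]natr1; have n0 : 0 < n.+1%:R :> K by [].
  by field; rewrite !gt_eqF// ?addr_gt0.
have [x0 x1] := andP x01.
have h : c * x ^+ 2 <= 2 * c * (x - x / (1 + x)).
  have -> : x - x / (1 + x) = x ^+ 2 * (1 + x)^-1 by field; rewrite gt_eqF// ltr_wpDr.
  rewrite [2 * c]mulrC -mulrA ler_wpM2l// mulrCA ler_peMr ?sqr_ge0//.
  rewrite ler_pdivlMr ?mul1r ?ltr_wpDr//; lra.
lra.
Qed.

End WeierstrassBound.

(** * The Gamma-Beta relation and invertibility of Gamma *)

Section GammaBeta.
Variables (K : realType) (m : nat).
Local Notation M := 'M[K[i]]_m.+1.
Implicit Types (A Q R S X : M) (t u : K).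

Lemma ring_cancel_mid (T : pzRingType) (a b c : T) :
  a * c = c * a -> a * b = 1 -> a * (c * b) = c.
Proof. by move=> ac ab; rewrite mulrA ac -mulrA ab mulr1. Qed.

(* Tends to mxGamma A by Gauss' limit for Q = I, B(I + n, A) being n! (A)_(n+1)^-1. *)
Definition gauss_seq A k : M :=
  cpowmx (k.+2%:R : K)%:C A * mxBeta (1 + k.+2%:R%:M) A.

Lemma gauss_seq_cvg A : positive_stable A -> mxcvg (gauss_seq A) (mxGamma A).
Proof.
move=> As; exact: (gauss_limit (@positive_stable1 K m) As (commr_sym (commr1 A))).
Qed.

Lemma mxpoch_1 n : mxpoch (1 : M) n = n`!%:R%:M.
Proof.
elim: n => [|n IH]; first by rewrite mxpoch0 fact0.
rewrite mxpochS IH factS mulnC natrM scalar_mxM; congr (_ * _).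
by rewrite -natr1 raddfD addrC.
Qed.

(** Since (A)_(n+1) = A (A + I)_n, the Beta recursion started at Q = I leaves n! A B(I, A) = n!
    I. *)
Lemma mxpoch_beta1 A n : positive_stable A ->
  mxpoch A n.+1 * mxBeta (1 + n%:R%:M) A = n`!%:R%:M.
Proof.
move=> As; have s1 := @positive_stable1 K m.
have h := mxBeta_poch n s1 As (commr_sym (commr1 A)).
rewrite mxpochSl -mulrA addrC -h mxpoch_1.
exact: ring_cancel_mid (comm_scalar _ A) (mxBeta_1 As).
Qed.

(** Both sides are multiplied by the invertible symbols [pq] and [pr]; f stands for the factorial,
    [nr], [nq], [ns] for n^R, n^Q, n^S. *)
Lemma ring_gauss_cancel (T : unitRingType) (pr pq gr gq b b' nr nq ns f : T) :
  pr \is a GRing.unit -> pq \is a GRing.unit ->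
  pr * gr = f * nr -> pq * gq = f * nq -> pq * b = pr * b' -> nr = nq * ns ->
  pq * pr = pr * pq -> pq * f = f * pq -> pr * f = f * pr ->
  pq * nr = nr * pq -> pr * nr = nr * pr -> gr * b = gq * (ns * b').
Proof.
move=> ur uq hr hq hb hn pp pqf prf pqn prn.
apply: (mulrI ur); apply: (mulrI uq).
transitivity (f * (nr * (pr * b'))).
  by rewrite (mulrA pr) hr (mulrA pq) (mulrA pq f) pqf -(mulrA f pq) pqn -!mulrA hb.
symmetry; rewrite (mulrA pq pr) pp -(mulrA pr pq) (mulrA pq gq) hq -(mulrA f) (mulrA nq) -hn.
by rewrite (mulrA pr f) prf -(mulrA f pr) (mulrA pr nr) prn -(mulrA nr).
Qed.

(** With n = k + 2 this is Euler's form n! n^A (A)_(n+1)^(-1) of the sequence converging to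
    Gamma. *)
Lemma mxpoch_gauss_seq A k : positive_stable A ->
  mxpoch A k.+3 * gauss_seq A k = k.+2`!%:R%:M * cpowmx (k.+2%:R : K)%:C A.
Proof.
move=> As; rewrite /gauss_seq.
have c : GRing.comm (mxpoch A k.+3) (cpowmx (k.+2%:R : K)%:C A).
  by apply: cpowmx_comm; apply: commr_sym; apply: mxpoch_comm; exact: commr_refl.
by rewrite mulrA c -mulrA mxpoch_beta1// comm_scalar.
Qed.

(** The relation already holds exactly at every finite stage, with a sequence tending to Gamma(S) in
    place of it; then limits are taken on both sides. *)
Lemma beta_gamma Q S : positive_stable Q -> positive_stable S ->
  positive_stable (Q + S) -> GRing.comm Q S ->
  mxGamma (Q + S) * mxBeta Q S = mxGamma Q * mxGamma S.
Proof.
move=> Qs Ss Rs QS; set R := Q + S.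
have QR : GRing.comm Q R by apply: commrD; [exact: commr_refl|exact: QS].
have Q1s : positive_stable (Q + 1) by exact: (@positive_stable_natD _ _ Q 1%N).
have Q1S : GRing.comm (Q + 1) S.
  by apply: commr_sym; apply: commrD; [exact: commr_sym|exact: commr1].
(* The symbols (Q)_(n+1), (R)_(n+1) with n = k + 2 raise Q by n + 1, so Gauss' limit is used at Q +
   I instead of Q. *)
have e k : gauss_seq R k * mxBeta Q S = gauss_seq Q k *
    (cpowmx (k.+2%:R : K)%:C S * mxBeta (Q + 1 + k.+2%:R%:M) S).
  have sf X n : GRing.comm X (n%:R%:M : M) by exact: comm_scalar.
  apply: (ring_gauss_cancel (mxpoch_unit k.+3 Rs) (mxpoch_unit k.+3 Qs)
    (mxpoch_gauss_seq k Rs) (mxpoch_gauss_seq k Qs) _ (cpowmxD _ QS) _ (sf _ _) (sf _ _)).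
  - have e : Q + k.+3%:R%:M = Q + 1 + k.+2%:R%:M.
      by rewrite -[k.+3%:R]natr1 raddfD /= [k.+2%:R%:M + _]addrC addrA.
    have := mxBeta_poch k.+3 Qs Ss QS; rewrite e; exact.
  - by apply: mxpoch_comm; apply: commr_sym; apply: mxpoch_comm; exact: commr_sym.
  - by apply: cpowmx_comm; apply: commr_sym; apply: mxpoch_comm; exact: commr_sym.
  - by apply: cpowmx_comm; apply: commr_sym; apply: mxpoch_comm; exact: commr_refl.
have h1 := mxcvgM (gauss_seq_cvg Rs) (mxcvg_cst (mxBeta Q S)).
have h2 := mxcvgM (gauss_seq_cvg Qs) (gauss_limit Q1s Ss Q1S).
apply: (mxcvg_uniq h1); apply: (mxcvg_near _ h2).
by apply: nearW => k; exact: esym (e k).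
Qed.

(** The scalar j + 1 is taken out of each factor A + (j + 1) I. *)
Lemma mxpoch_weierstrass A n :
  mxpoch (A + 1) n = n`!%:R%:M * \prod_(j < n) (1 + (j.+1%:R^-1 : K)%:C *: A).
Proof.
elim: n => [|n IH]; first by rewrite mxpoch0 big_ord0 fact0 mulr1.
rewrite mxpochS big_ord_recr /= IH factS mulnC natrM scalar_mxM.
set P := \prod_(j < n) _; set Z := 1 + _.
have -> : A + 1 + n%:R%:M = n.+1%:R%:M * Z.
  rewrite scale_mull /Z scalerDr scalerA fmorphV (rmorph_nat (real_complex K)).
  rewrite mulfV ?pnatr_eq0// scale1r -addrA addrC; congr (_ + _).
  by rewrite -[n.+1%:R]natr1 scalerDl scale1r scalemx1 addrC.
have c : GRing.comm P (n.+1%:R%:M) by exact: comm_scalar.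
by rewrite -mulrA (mulrA P) c -!mulrA.
Qed.

Lemma ring_gauss_inverse (T : algType K[i]) (a w g x y e d : T) (f : K[i]) : f != 0 ->
  a * (f *: w) * g = f *: x -> y * x = 1 -> e * d = y -> a * y = y * a ->
  a * (e * (d * w)) * g = 1.
Proof.
move=> f0; rewrite -scalerAr -scalerAl => /(scalerI f0) h yx ed ay.
by rewrite (mulrA e) ed (mulrA a) ay -!mulrA (mulrA a) h.
Qed.

Lemma ring_kernel (T : pzRingType) (y g i G : T) :
  y * G = 0 -> g * i = 1 -> y - 0 = y * (g - G) * i.
Proof. by move=> yG gi; rewrite mulrBr yG !subr0 -mulrA gi mulr1. Qed.

Lemma mxexp_shift A (x y : K) :
  mxexp ((x - y)%:C *: A) * mxexp (x%:C *: - A) = mxexp (y%:C *: - A).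
Proof.
rewrite -mxexpD.
  by rewrite rmorphB scalerBl !scalerN addrAC subrr add0r.
by apply: commrZ; apply: commrN; apply: commr_sym; apply: commrZ; exact: commr_refl.
Qed.

(* The inverses of gauss_seq A are bounded, being given by the Weierstrass
   product of 1/Gamma up to a bounded factor; hence the limit has no kernel. *)
Lemma mxGamma_unit A : positive_stable A -> mxGamma A \is a GRing.unit.
Proof.
move=> As.
have [c hc] := weierstrass_bound A.
pose E k := mxexp ((harmonic_sum K k.+2 - ln k.+2%:R)%:C *: A).
(* [E k] converts the e^(-H_n A) of the product into n^(-A), n = k + 2, and is bounded because 0 <=
   H_n - ln n <= 1. *)
pose inv k := A * (E k * weierstrass A k.+2).
have inv1 k : gauss_seq A k * inv k = 1.
  apply: mulmx1C.
  have f0 : k.+2`!%:R != 0 :> K[i] by rewrite pnatr_eq0 -lt0n fact_gt0.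
  have h := mxpoch_gauss_seq k As.
  rewrite mxpochSl mxpoch_weierstrass !scale_mull in h.
  apply: (ring_gauss_inverse f0 h (cpowmxN _ _)); last first.
    by apply: cpowmx_comm; apply: commrN; exact: commr_refl.
  rewrite cpowmxE ?ltr0Sn//; exact: mxexp_shift.
pose C := nrm A * ((nrm (1 : M) + expR (nrm A)) * c).
have inv_bound k : nrm (inv k) <= C.
  apply: (le_trans (nrmM _ _)); rewrite ler_wpM2l ?nrm_ge0//.
  apply: (le_trans (nrmM _ _)); rewrite ler_pM ?nrm_ge0//.
  apply: (le_trans (nrm_mxexp _)); rewrite lerD2l ler_expR nrmZ cmod_real.
  rewrite ler_piMl ?nrm_ge0//.
  by have /andP[h0 h1] := harmonic_sum_ln K k.+1; rewrite ger0_norm.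
rewrite -row_free_unit -kermx_eq0; apply/eqP.
set Y := kermx (mxGamma A).
have YG : Y * mxGamma A = 0 by exact: mulmx_ker.
(* Y kills the limit, so Y = Y (g_k - Gamma(A)) g_k^(-1), which tends to 0 as the inverses stay
   bounded. *)
apply: (mxcvg_uniq (mxcvg_cst Y)).
apply: (@mxcvg_squeeze _ _ (fun k => nrm Y * nrm (gauss_seq A k - mxGamma A) * C)).
  apply: nearW => k; rewrite (ring_kernel YG (inv1 k)).
  apply: (le_trans (nrmM _ _)); rewrite ler_pM ?nrm_ge0//.
  exact: nrmM.
rewrite -(mul0r C) -(mulr0 (nrm Y)).
by apply: cvgM; [apply: cvgM; [exact: cvg_cst|exact: gauss_seq_cvg]|exact: cvg_cst].
Qed.

Lemma mxGamma_comm A X : positive_stable A -> GRing.comm X A -> GRing.comm X (mxGamma A).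
Proof.
move=> As XA; apply: mxcvg_comm (gauss_seq_cvg As) => k.
apply: commrM; first exact: cpowmx_comm.
have s1 := @positive_stable_natD K m 1 k.+2 (@positive_stable1 K m).
apply: (mxBeta_comm s1 As _ XA).
by apply: commrD; [exact: commr1|exact: comm_scalar].
Qed.

End GammaBeta.

(** * The principal logarithm on the right half-plane *)

Section RightHalfPlaneLog.
Variable K : realType.
Implicit Types (x y : K).

(** The definition by cases on the sign of y hides smoothness across the real axis; the arctangent
    form displays it. *)
Lemma carg_atan x y : 0 < x -> carg (x +i* y) = atan (y / x).
Proof.
move=> x0; set a := atan (y / x).
have ha : - (pi / 2) < a < pi / 2 by rewrite atan_gtNpi2 atan_ltpi2.
have pi0 := pi_gt0 K.
have ca : x / cmod (x +i* y) = cos a.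
  rewrite /a cos_atan cmodE /= (_ : x ^+ 2 + y ^+ 2 = x ^+ 2 * (1 + (y / x) ^+ 2)).
    by rewrite sqrtrM ?sqr_ge0// sqrtr_sqr gtr0_norm// invfM mulVKf ?gt_eqF.
  by field; rewrite gt_eqF.
rewrite /carg /= ca; case: ifPn => [y0|]; last rewrite -ltNge => y0.
  apply: cosK; rewrite in_itv /=; apply/andP; split; last by lra.
  have : 0 <= y / x by rewrite divr_ge0// ltW.
  rewrite /a; case: (ltgtP 0 (y / x)) => // [/lt_atan|<-]; rewrite atan0 //.
  by move/ltW.
rewrite cosKN ?opprK//; apply/andP; split; first by lra.
have /lt_atan : y / x < 0 by rewrite pmulr_llt0 ?invr_gt0.
by rewrite atan0 => /ltW.
Qed.

Lemma clog_atan x y : 0 < x ->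
  clog (x +i* y) = ln (x ^+ 2 + y ^+ 2) / 2 +i* atan (y / x).
Proof.
move=> x0; rewrite /clog carg_atan// cmodE /= -powR12_sqrt ?addr_ge0 ?sqr_ge0//.
by rewrite ln_powR mulrC.
Qed.

End RightHalfPlaneLog.

(** * Differentiating complex powers along a real path *)

Section ComplexExponentDerivative.
Variables (K : realType) (m : nat).
Local Notation M := 'M[K[i]]_m.+1.
Implicit Types (A P : M) (t u x y : K).

Lemma ring_exp_derivative (T : algType K[i]) (p e f a b i : T) :
  GRing.comm e p -> GRing.comm e b -> GRing.comm e i ->
  a * (p * e) * f + e * (b * (i * p * f)) = (a + b * i) * p * (e * f).
Proof.
move=> ep eb ei; rewrite !mulrDl (mulrA e b) eb -!mulrA; congr (_ + b * _).
by rewrite (mulrA e i) ei -mulrA (mulrA e p) ep -!mulrA.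
Qed.

Lemma complexE_mul (x y : K) : x +i* y = x%:C + y%:C * 'i.
Proof. by apply/eqP; rewrite eq_complex; apply/andP; split; apply/eqP => /=; ring. Qed.

(** Separates a complex exponent into two real-parameter exponentials, of P and of i P, to which
    [mxder_mxexp] applies. *)
Lemma mxexp_complex P (x y : K) :
  mxexp ((x +i* y) *: P) = mxexp (x%:C *: P) * mxexp (y%:C *: ('i%:M * P)).
Proof.
rewrite scale_mull -mxexpD; last first.
  by do 2 apply: commrZ; apply: commr_sym; apply: commrZ; exact: commr_refl.
by rewrite scalerA -scalerDl -complexE_mul.
Qed.

Lemma mxder_mxexp_complex P (a b : K -> K) t a' b' :
  is_derive t 1 a a' -> is_derive t 1 b b' ->
  mxder (fun s => mxexp ((a s +i* b s) *: P)) t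
    ((a' +i* b')%:M * P * mxexp ((a t +i* b t) *: P)).
Proof.
move=> da db.
have e s := mxexp_complex P (a s) (b s).
have d1 := mxder_comp (mxder_mxexp P (a t)) da.
have d2 := mxder_comp (mxder_mxexp ('i%:M * P) (b t)) db.
apply: eq_mxder (mxder_eq _ (mxderM d1 d2)) => [s|]; first by rewrite e.
rewrite e (_ : (a' +i* b')%:M = a'%:C%:M + b'%:C%:M * 'i%:M :> M); last first.
  by rewrite -scalar_mxM -raddfD -complexE_mul.
apply: ring_exp_derivative; try exact: comm_scalar.
by apply: commr_sym; apply: mxexp_comm; apply: commrZ; exact: commr_refl.
Qed.

Lemma is_derive_ln_norm (X Y : K -> K) t X' Y' : 0 < X t ->
  is_derive t 1 X X' -> is_derive t 1 Y Y' ->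
  is_derive t 1 (fun s => ln (X s ^+ 2 + Y s ^+ 2) / 2)
    ((X t * X' + Y t * Y') / (X t ^+ 2 + Y t ^+ 2)).
Proof.
move=> X0 dX dY.
have p0 : 0 < X t ^+ 2 + Y t ^+ 2 by rewrite ltr_pwDl ?exprn_gt0// sqr_ge0.
have d1 := is_deriveD (is_deriveX 2 dX) (is_deriveX 2 dY).
have d2 := @is_derive1_comp _ (@ln K) (X ^+ 2 + Y ^+ 2) t _ _ (is_derive1_ln p0) d1.
have := is_deriveZ (2^-1) d2.
have -> : 2^-1 \*: (@ln K \o (X ^+ 2 + Y ^+ 2)) = fun s => ln (X s ^+ 2 + Y s ^+ 2) / 2.
  by apply/funext => s; rewrite /= /GRing.scale /= mulrC.
move/is_derive_eq; apply; rewrite /GRing.scale /= !expr1.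
by field; rewrite gt_eqF.
Qed.

Lemma is_derive_atan_div (X Y : K -> K) t X' Y' : 0 < X t ->
  is_derive t 1 X X' -> is_derive t 1 Y Y' ->
  is_derive t 1 (fun s => atan (Y s / X s))
    ((X t * Y' - Y t * X') / (X t ^+ 2 + Y t ^+ 2)).
Proof.
move=> X0 dX dY.
have p0 : 0 < X t ^+ 2 + Y t ^+ 2 by rewrite ltr_pwDl ?exprn_gt0// sqr_ge0.
have nX : X t != 0 by rewrite gt_eqF.
have d1 := is_deriveM dY (is_deriveV nX dX).
have d2 := @is_derive1_comp _ (@atan K) _ t _ _ (is_derive1_atan (Y t / X t)) d1.
move: d2; move/is_derive_eq; apply; rewrite /GRing.scale /=.
by field; rewrite nX/= gt_eqF.
Qed.

Lemma mxder_mxexp_clog P (X Y : K -> K) t X' Y' : 0 < X t ->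
  is_derive t 1 X X' -> is_derive t 1 Y Y' ->
  mxder (fun s => mxexp (clog (X s +i* Y s) *: P)) t
    (((X' +i* Y') / (X t +i* Y t))%:M * P * mxexp (clog (X t +i* Y t) *: P)).
Proof.
move=> X0 dX dY.
have := mxder_mxexp_complex P (is_derive_ln_norm X0 dX dY) (is_derive_atan_div X0 dX dY).
rewrite -(clog_atan (Y t) X0) => h.
(* The arctangent form of the logarithm must hold on a neighbourhood of t before its derivative can
   be transferred. *)
have : \forall s \near t, 0 < X s.
  by have := derive_cont dX; rewrite /continuous_at => /cvgr_gt; apply.
move=> Xn; apply: (mxder_near _ (mxder_eq _ h)).
  by apply: filterS Xn => s Xs; rewrite clog_atan.
congr (_%:M * _ * _).
have p0 : 0 < X t ^+ 2 + Y t ^+ 2 by rewrite ltr_pwDl ?exprn_gt0// sqr_ge0.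
have nz : X t +i* Y t != 0 by rewrite eq_complex /= negb_and gt_eqF.
apply: (mulIf nz); rewrite divfK//.
apply/eqP; rewrite eq_complex /=; apply/andP; split; apply/eqP; field; exact: lt0r_neq0.
Qed.

End ComplexExponentDerivative.

(** * The matrix binomial series *)

Section BinomialSeries.
Variables (K : realType) (m : nat).
Local Notation M := 'M[K[i]]_m.+1.
Implicit Types (P : M) (t : K) (w : K[i]).

Definition binc P w k : M := (w ^+ k / k`!%:R) *: mxpoch P k.

Lemma binc0 P w : binc P w 0 = 1.
Proof. by rewrite /binc mxpoch0 expr0 fact0 divr1 scale1r. Qed.

Lemma bincS P w k : binc P w k.+1 = (w / k.+1%:R) *: (binc P w k * (P + k%:R%:M)).
Proof.
rewrite /binc mxpochS -scalerAl scalerA exprS factS natrM invfM; congr (_ *: _).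
by rewrite mulrACA.
Qed.

Lemma ring_natD_scalar P X (k : nat) : X * (P + k%:R%:M) = X * P + k%:R *: X.
Proof. by rewrite mulrDr comm_scalar scale_mull. Qed.

(** Consecutive terms have ratio at most |w| (nrm P + k) / (k + 1), which is at most y once k (y -
    |w|) >= |w| nrm P. *)
Lemma geo_binc P w y : cmod w < y -> 0 < y -> geo y (binc P w).
Proof.
move=> wy y0.
apply: (@geo_ratio _ _ y _ (Num.trunc (cmod w * nrm P / (y - cmod w))).+1) => // k hk.
rewrite bincS nrmZ cmodM cmodV cmod_natr ring_natD_scalar.
have d0 : 0 < y - cmod w by rewrite subr_gt0.
have k0 : 0 < k.+1%:R :> K by [].
have h1 : cmod w * nrm P <= k%:R * (y - cmod w).
  rewrite -ler_pdivrMr//; apply: ltW.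
  apply: lt_le_trans (_ : (Num.trunc (cmod w * nrm P / (y - cmod w))).+1%:R <= _).
    exact: truncnS_gt.
  by rewrite ler_nat.
set B := binc P w k.
have h2 : nrm (B * P + k%:R *: B) <= nrm B * (nrm P + k%:R).
  apply: (le_trans (nrmD _ _)); rewrite nrmZ cmod_natr mulrDr lerD ?nrmM//.
  by rewrite mulrC.
rewrite mulrAC ler_pdivrMr//.
apply: le_trans (ler_wpM2l (cmod_ge0 w) h2) _.
rewrite mulrCA -mulrA [leRHS]mulrCA; apply: ler_wpM2l; first exact: nrm_ge0.
rewrite -natr1; move: h1 (cmod_ge0 w) y0.
by set a := cmod w; set b := nrm P; set n := k%:R => ? ? ?; nra.
Qed.

(** The equation F' = w P F + w s F' for partial sums: k c_k is d_(k-1), so the last sum is shifted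
    and has one term less. *)
Lemma binc_ode (T : algType K[i]) (c d : nat -> T) (p : T) (w s : K[i]) n :
  (forall k, d k = k.+1%:R *: c k.+1) ->
  (forall k, d k = w *: (p * c k + k%:R *: c k)) ->
  \sum_(k < n.+1) s ^+ k *: d k =
  (w *: p) * (\sum_(k < n.+1) s ^+ k *: c k) + (w * s) *: \sum_(k < n) s ^+ k *: d k.
Proof.
move=> d1 d2.
have -> : \sum_(k < n.+1) s ^+ k *: d k =
    \sum_(k < n.+1) (w *: p) * (s ^+ k *: c k) + \sum_(k < n.+1) (w * s ^+ k) *: (k%:R *: c k).
  rewrite -big_split; apply: eq_bigr => k _; rewrite d2 -scalerAl -scalerAr !scalerDr !scalerA.
  by rewrite (mulrC w).
rewrite -mulr_sumr; congr (_ + _).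
rewrite big_ord_recl scale0r scaler0 add0r scaler_sumr; apply: eq_bigr => k _.
by rewrite d1 !scalerA /= exprS !mulrA.
Qed.

Lemma psum0 (c : nat -> M) y : 0 < y -> geo y c -> psum c 0 = c 0.
Proof.
move=> y0 gc; have h : `|0 : K| * y < 1 by rewrite normr0 mul0r.
apply: (mxcvg_uniq (psum_cvg y0 h gc)).
apply: mxcvg_near (mxcvg_cst (c 0)).
exists 1%N => //= k; case: k => // k _.
rewrite seriesEord /= big_ord_recl expr0 scale1r big1 ?addr0// => i _.
by rewrite /= exprS mul0r scale0r.
Qed.

Lemma binc_psum_ode P w y t : cmod w < y -> 0 < y -> `|t| * y < 1 ->
  psum (psdiff (binc P w)) t = (w *: P) * psum (binc P w) t +
    (w * t%:C) *: psum (psdiff (binc P w)) t.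
Proof.
move=> wy y0 ty.
have [y2 [yy2 ty2]] := radius_gap ty.
have y20 : 0 < y2 by exact: lt_trans yy2.
have gc := geo_binc P wy y0.
have gd := geo_psdiff y0 yy2 gc.
have hc := psum_cvg y0 ty gc.
have hd := psum_cvg y20 ty2 gd.
have shift (u : nat -> M) L : mxcvg u L -> mxcvg (fun k => u k.+1) L.
  by move=> h; rewrite /mxcvg (cvg_shiftS (fun k => nrm (u k - L))).
apply: (mxcvg_uniq (shift _ _ hd)).
rewrite -[(w * _) *: _]scale_mull.
have h := mxcvgD (mxcvgM (mxcvg_cst (w *: P)) (shift _ _ hc))
  (mxcvgM (mxcvg_cst ((w * t%:C)%:M)) hd).
apply: (mxcvg_near _ h); apply: nearW => k.
rewrite !seriesEord /= scale_mull; symmetry.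
apply: binc_ode => // l.
rewrite /psdiff bincS scalerA mulrCA divff ?pnatr_eq0// mulr1 ring_natD_scalar.
congr (_ *: (_ + _)).
by apply: commr_sym; apply: commrZ; apply: mxpoch_comm; exact: commr_refl.
Qed.

(** Here v = 1 - t w, e is v^P with logarithmic derivative -w P / v, and f is the series; the
    hypothesis amounts to v f' = w P f. *)
Lemma ring_ode_cancel (T : algType K[i]) (p e f f' : T) (w v x : K[i]) :
  v != 0 -> x = - w / v -> p * e = e * p ->
  f' = (w *: p) * f + (1 - v) *: f' -> (x *: p * e) * f + e * f' = 0.
Proof.
move=> v0 -> pe h.
have {h} h : v *: f' = w *: (p * f).
  rewrite scalerAl; move: h; rewrite scalerBl scale1r addrCA => /(congr1 (fun z => z - f')).
  by rewrite subrr addrAC subrr add0r => /esym/eqP; rewrite subr_eq0 => /eqP.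
apply: (scalerI v0); rewrite scaler0 scalerDr [v *: (e * f')]scalerAr h -!scalerAl scalerA.
rewrite mulrC divfK//.
by rewrite -scalerAr mulrA pe -mulrA scaleNr addNr.
Qed.

Lemma ring_inverse_uniq (T : pzRingType) (a b c : T) : b * a = 1 -> a * c = 1 -> c = b.
Proof. by move=> ba ac; rewrite -[c]mul1r -ba -mulrA ac mulr1. Qed.

Lemma onem_complex t w : 1 - t%:C * w = (1 - t * Re w) +i* (- (t * Im w)).
Proof.
by case: w => a b; apply/eqP; rewrite eq_complex; apply/andP; split; apply/eqP => /=; ring.
Qed.

(* (1 - t w)^P times the series has derivative 0 in t. *)
Lemma binomial_series P w : cmod w < 1 ->
  mxcvg (series (binc P w)) (cpowmx (1 - w) (- P)).
Proof.
(* A ratio strictly between |w| and 1 puts the whole parameter segment [0, 1], including t = 1,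
   inside the disc of convergence. *)
move=> w1; pose y := (cmod w + 1) / 2.
have w0 := cmod_ge0 w.
have [wy y0 y1] : [/\ cmod w < y, 0 < y & y < 1] by rewrite /y; split; lra.
have gc := geo_binc P wy y0.
have ty t : 0 <= t <= 1 -> `|t| * y < 1.
  by move=> /andP[t0 t1]; rewrite ger0_norm//; apply: le_lt_trans y1; rewrite ler_piMl// ltW.
(* Keeps 1 - t w in the right half-plane, where the principal logarithm is smooth. *)
have Xp t : 0 <= t <= 1 -> 0 < 1 - t * Re w.
  move=> /andP[t0 t1]; rewrite subr_gt0; apply: le_lt_trans w1.
  apply: le_trans (_ : `|Re w| <= _); last exact: normRe_cmod.
  apply: le_trans (ler_norm _) _; rewrite normrM ger0_norm// ler_piMl//.
pose E t := mxexp (clog (1 - t%:C * w) *: P).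
pose F := psum (binc P w).
have H t : 0 <= t <= 1 -> mxder (fun t => E t * F t) t 0.
  move=> t01; have dF := psum_der y0 (ty t t01) gc.
  have dl (a : K) : is_derive t 1 (fun s : K => - (s * a)) (- a).
    have := is_deriveN (is_deriveZ a (is_derive_id t (1 : K))).
    have -> : - (a \*: id) = fun s : K => - (s * a).
      by apply/funext => s; rewrite /= /GRing.scale /= mulrC.
    by move/is_derive_eq; apply; rewrite /GRing.scale /= mulr1.
  have dX : is_derive t 1 (fun s : K => 1 - s * Re w) (- Re w).
    by have := is_deriveD (is_derive_cst (1 : K) t 1) (dl (Re w)); rewrite add0r.
  have dY : is_derive t 1 (fun s : K => - (s * Im w)) (- Im w) by exact: dl.
  have dE := @mxder_mxexp_clog K m P (fun s => 1 - s * Re w) (fun s => - (s * Im w)) t _ _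
    (Xp t t01) dX dY.
  have dE' : mxder E t (((- Re w +i* - Im w) / (1 - t%:C * w))%:M * P * E t).
    rewrite /E onem_complex; apply: eq_mxder dE => s; by rewrite onem_complex.
  apply: mxder_eq (mxderM dE' dF).
  have nz : 1 - t%:C * w != 0.
    by rewrite onem_complex eq_complex negb_and /= gt_eqF// Xp.
  rewrite scale_mull.
  apply: (ring_ode_cancel nz (w := w)).
  - by congr (_ / _); case: (w).
  - by apply: mxexp_comm; apply: commrZ; exact: commr_refl.
  - have := binc_psum_ode P wy y0 (ty t t01); rewrite opprB addrCA subrr addr0 mulrC; exact.
have e1 := mxder_constant ler01 H.
have e2 : mxexp (clog (1 - w) *: P) * F 1 = 1.
  move: e1; rewrite /E mul1r mul0r subr0 => ->.
  by rewrite (clog_real ltr01) ln1 scale0r mxexp0 mul1r /F (psum0 y0 gc) binc0.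
have <- : F 1 = cpowmx (1 - w) (- P).
  exact: (ring_inverse_uniq (cpowmxN (1 - w) P) e2).
have t1 : `|1| * y < 1 by apply: ty; rewrite ler01 lexx.
have := psum_cvg y0 t1 gc.
have -> // : (fun k => 1%:C ^+ k *: binc P w k) = binc P w.
by apply/funext => k; rewrite expr1n scale1r.
Qed.

End BinomialSeries.

(** * Products of commuting factors and splitting of Pochhammer symbols *)

Section CommutingProducts.
Variables (T : unitRingType) (I : Type).
Implicit Types (r : seq I) (f g : I -> T).

Lemma prodrM_comm r f g : (forall i j, GRing.comm (g i) (f j)) ->
  \prod_(i <- r) (f i * g i) = \prod_(i <- r) f i * \prod_(i <- r) g i.
Proof.
move=> fg; elim: r => [|i r IH]; first by rewrite !big_nil mulr1.
have c : GRing.comm (g i) (\prod_(j <- r) f j) by apply: commr_prod => j _; exact: fg.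
by rewrite !big_cons IH -!mulrA (mulrA (g i)) c -!mulrA.
Qed.

Lemma prodrV_comm r f : (forall i j, GRing.comm (f i) (f j)) ->
  (forall i, f i \is a GRing.unit) ->
  \prod_(i <- r) f i \is a GRing.unit /\ \prod_(i <- r) (f i)^-1 = (\prod_(i <- r) f i)^-1.
Proof.
move=> ff uf; elim: r => [|i r [u IH]]; first by rewrite !big_nil unitr1 invr1.
have c : GRing.comm (\prod_(j <- r) f j) (f i).
  by apply: commr_sym; apply: commr_prod => j _; exact: ff.
rewrite !big_cons IH; split; first by rewrite rpredM ?uf.
by rewrite invrM//; apply: commrV; apply: commr_sym; exact: commrV.
Qed.

End CommutingProducts.

Section SplitPochhammer.
Variables (K : realType) (m : nat).
Local Notation M := 'M[K[i]]_m.+1.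
Implicit Types (A X : M).

Lemma positive_stableZ (a : K) A : 0 < a -> positive_stable A -> positive_stable (a%:C *: A).
Proof.
move=> a0 As c /eigenvalueP[v vA v0].
have nz : a%:C != 0 by rewrite eq_complex /= gt_eqF.
have : eigenvalue A (a%:C^-1 * c).
  apply/eigenvalueP; exists v => //; apply: (scalerI nz).
  by rewrite scalemxAr vA scalerA mulVKf.
move/As; rewrite -fmorphV ReM /= mul0r subr0 pmulr_rgt0 ?invr_gt0//.
Qed.

Lemma ring_scale_step (T : algType K[i]) (p x r b : T) (c c' : K[i]) :
  p * x = c' *: r -> p * (x * (c *: b)) = (c * c') *: (r * b).
Proof. by move=> h; rewrite mulrA h -scalerAr -scalerAl scalerA. Qed.

Lemma mxpoch_cat A (c : K[i]) n l :
  mxpoch A n * \prod_(j < l) (c *: (A + (n + j)%:R%:M)) = c ^+ l *: mxpoch A (n + l).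
Proof.
elim: l => [|l IH]; first by rewrite big_ord0 mulr1 expr0 scale1r addn0.
rewrite big_ord_recr /= addnS mxpochS exprS; exact: ring_scale_step.
Qed.

Lemma mxsplit_factor A (q n j : nat) : (0 < q)%N ->
  q%:R^-1 *: (A + j%:R%:M) + n%:R%:M = (q%:R^-1 : K[i]) *: (A + (q * n + j)%:R%:M).
Proof.
move=> q0; rewrite natrD [((q * n)%:R + _)%:M]raddfD /= [(q * n)%:R%:M + _]addrC addrA.
rewrite [RHS]scalerDr.
congr (_ + _).
rewrite scale_scalar_mx natrM mulrA mulVf ?mul1r// pnatr_eq0 -lt0n //.
Qed.

(** Raising n by 1 multiplies the product by the q factors (A + (q n + j) I)/q, j < q, which extend
    (A)_(q n) to (A)_(q n + q). *)
Lemma mxsplit_poch A (q n : nat) : (0 < q)%N ->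
  \prod_(B <- mxsplit q A) mxpoch B n = (q%:R^-1) ^+ (q * n) *: mxpoch A (q * n).
Proof.
move=> q0; elim: n => [|n IH].
  by rewrite muln0 expr0 scale1r mxpoch0 big1// => i _; rewrite mxpoch0.
have cs i j : GRing.comm (q%:R^-1 *: (A + i%:R%:M) + n%:R%:M : M) (q%:R^-1 *: (A + j%:R%:M)).
  apply: commrZ; apply: commrD; last exact: comm_scalar.
  apply: commr_sym; apply: commrD; last exact: comm_scalar.
  apply: commrZ; apply: commrD; [exact: commr_refl|exact: comm_scalar].
rewrite big_map; under eq_bigr do rewrite mxpochS.
rewrite prodrM_comm; last by move=> i j; apply: mxpoch_comm; exact: cs.
move: IH; rewrite big_map => ->.
under eq_bigr do rewrite mxsplit_factor//.
rewrite -{4}[q]subn0 -/(index_iota 0 q) big_mkord.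
by rewrite -scalerAl mxpoch_cat scalerA -exprD mulnS addnC.
Qed.

Lemma mxsplit_stable A (q k : nat) : (0 < q)%N -> positive_stable A ->
  positive_stable (q%:R^-1 *: (A + k%:R%:M)).
Proof.
move=> q0 As; rewrite -(rmorph_nat (real_complex K)) -fmorphV.
by apply: positive_stableZ; [rewrite invr_gt0 ltr0n|exact: positive_stable_natD].
Qed.

Lemma mxsplit_pochV A (q n : nat) : (0 < q)%N -> positive_stable A ->
  \prod_(B <- mxsplit q A) invmx (mxpoch B n) =
  ((q%:R^-1) ^+ (q * n) *: mxpoch A (q * n))^-1.
Proof.
move=> q0 As; rewrite -mxsplit_poch// !big_map.
have [|i|_ <-//] := @prodrV_comm M nat (iota 0 q) (fun k => mxpoch (q%:R^-1 *: (A + k%:R%:M)) n).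
  move=> i j; apply: mxpoch_comm; apply: commr_sym; apply: mxpoch_comm.
  apply: commrZ; apply: commrD; last exact: comm_scalar.
  apply: commr_sym; apply: commrZ; apply: commrD; [exact: commr_refl|exact: comm_scalar].
by apply: mxpoch_unit; exact: mxsplit_stable.
Qed.

(** The power c of 1/q is the same in numerator and denominator and cancels. *)
Lemma ring_hyp_term (T : unitAlgType K[i]) (p a b : T) (x c : K[i]) :
  c != 0 -> b \is a GRing.unit -> x *: (p * (c *: a) * (c *: b)^-1) = (x *: p) * (a * b^-1).
Proof.
move=> c0 ub; have uc : c \is a GRing.unit by rewrite unitfE.
rewrite invrZ// -scalerAl; congr (_ *: _).
by rewrite -!scalerAr -!scalerAl scalerA mulVf// scale1r mulrA.
Qed.

Lemma hyp_term_split (P Q R : M) (q : nat) (z : K[i]) n : (0 < q)%N -> positive_stable R ->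
  hyp_term (P :: mxsplit q Q) (mxsplit q R) z n =
  binc P z n * (mxpoch Q (q * n) * (mxpoch R (q * n))^-1).
Proof.
move=> q0 Rs; rewrite /hyp_term big_cons mxsplit_poch// mxsplit_pochV//.
apply: ring_hyp_term; last exact: mxpoch_unit.
by rewrite expf_neq0// invr_eq0 pnatr_eq0 -lt0n.
Qed.

End SplitPochhammer.

(** * Termwise integration and the Euler integral *)

Section EulerIntegral.
Variables (K : realType) (m : nat).
Local Notation M := 'M[K[i]]_m.+1.
Local Notation I01 := (`]0%R, 1%R[%classic : set K).
Implicit Types (P Q R S X : M) (u : K) (z w : K[i]).

Lemma mxintegrable_mxmeas (D : set K) (F : K -> M) : mxintegrable D F -> mxmeas D F.
Proof.
move=> Fi i j; have [hr hi] := Fi i j.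
by split; apply/measurable_EFinP; [exact: measurable_int hr|exact: measurable_int hi].
Qed.

Lemma mxintegral_series (D : set K) (f : nat -> K -> M) n : measurable D ->
  (forall k, mxintegrable D (f k)) ->
  mxintegrable D (fun x => series (f ^~ x) n) /\
  mxintegral D (fun x => series (f ^~ x) n) = series (fun k => mxintegral D (f k)) n.
Proof.
move=> mD fi; elim: n => [|n [IH1 IH2]].
  have [h1 h2] := mxintegralMl 0 mD (fi 0%N).
  have e : (fun x => series (f ^~ x) 0) = fun x => 0 * f 0 x.
    by apply/funext => x; rewrite seriesEord /= big_ord0 mul0r.
  by rewrite e h2 mul0r; split => //; rewrite seriesEord /= big_ord0.
have e : (fun x => series (f ^~ x) n.+1) = fun x => series (f ^~ x) n + f n x.
  by apply/funext => x; rewrite !seriesEord /= big_ord_recr.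
have [h1 h2] := mxintegralD mD IH1 (fi n).
by rewrite e h2 IH2; split => //; rewrite !seriesEord /= big_ord_recr.
Qed.

Lemma geometric_sum_le (y : K) n : 0 <= y < 1 -> \sum_(k < n) y ^+ k <= (1 - y)^-1.
Proof.
move=> /andP[y0 y1]; have d0 : 0 < 1 - y by rewrite subr_gt0.
rewrite -[leRHS]mul1r ler_pdivlMr// mulrC.
have -> : (1 - y) * \sum_(k < n) y ^+ k = 1 - y ^+ n.
  by apply: oppr_inj; rewrite -mulNr !opprB subrX1.
by rewrite gerBl exprn_ge0.
Qed.

Lemma binc_scale P z (c : K[i]) k : binc P (z * c) k = c ^+ k *: binc P z k.
Proof. by rewrite /binc exprMn scalerA mulrAC mulrC. Qed.

(** Uniformity in c, later u^q, and in the number of terms is what dominated convergence needs; |c|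
    <= 1 only shrinks the terms. *)
Lemma binc_series_bound P z : cmod z < 1 -> exists C, 0 <= C /\
  forall c n, cmod c <= 1 -> nrm (series (binc P (z * c)) n) <= C.
Proof.
move=> z1; pose y := (cmod z + 1) / 2.
have z0 := cmod_ge0 z.
have [zy y0 y1] : [/\ cmod z < y, 0 < y & y < 1] by rewrite /y; split; lra.
have [C hC] := geo_binc P zy y0.
have C0 := geo_ge0 hC.
exists (C * (1 - y)^-1); split; first by rewrite mulr_ge0// invr_ge0 subr_ge0 ltW.
move=> c n c1; rewrite seriesEord /=; apply: (le_trans (nrm_sum _ _ _)).
apply: (@le_trans _ _ (\sum_(k < n) C * y ^+ k)).
  apply: ler_sum => k _; rewrite binc_scale nrmZ cmodX.
  apply: le_trans (hC k); rewrite ler_piMl ?nrm_ge0//.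
  by rewrite exprn_ile1// cmod_ge0.
rewrite -mulr_sumr ler_wpM2l// geometric_sum_le// (ltW y0)//.
Qed.

Lemma beta_kernel_natD Q S n u : 0 < u ->
  beta_kernel (Q + n%:R%:M) S u = (u ^+ n)%:C *: beta_kernel Q S u.
Proof.
move=> u0; rewrite /beta_kernel addrAC (cpowmx_natD (Q - 1%:M) n u0).
by rewrite -scalerAl.
Qed.

Section Coefficients.
Variables (P Q S : M) (q : nat) (z : K[i]).
Hypotheses (PQ : GRing.comm P Q) (PS : GRing.comm P S) (QS : GRing.comm Q S).
Hypotheses (Qs : positive_stable Q) (Ss : positive_stable S).
Hypothesis Rs : positive_stable (Q + S).

Local Notation term k := (binc P z k * (mxpoch Q (q * k) * (mxpoch (Q + S) (q * k))^-1)).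

Definition euler_term k u : M := beta_kernel Q S u * binc P (z * u%:C ^+ q) k.

Lemma euler_termE k u : 0 < u ->
  euler_term k u = beta_kernel (Q + (q * k)%:R%:M) S u * binc P z k.
Proof.
move=> u0; rewrite /euler_term beta_kernel_natD// binc_scale -exprM -rmorphXn.
by rewrite -scalerAl -scalerAr.
Qed.

Lemma euler_term_integral k : mxintegrable I01 (euler_term k) /\
  mxintegral I01 (euler_term k) = mxBeta (Q + (q * k)%:R%:M) S * binc P z k.
Proof.
have Qks := positive_stable_natD (n := (q * k)%N) Qs.
have [h1 h2] := mxintegralMr (binc P z k) (@itv01_measurable K) (beta_kernel_integrable Qks Ss).
have e u : I01 u -> euler_term k u = beta_kernel (Q + (q * k)%:R%:M) S u * binc P z k.
  by rewrite /= in_itv/= => /andP[u0 _]; exact: euler_termE.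
split; last by rewrite -h2; apply: eq_mxintegral.
by apply: (eq_mxintegrable (@itv01_measurable K) _ h1) => u /e.
Qed.

Lemma ring_beta_term (T : unitRingType) (B B' b pq pr : T) : pr \is a GRing.unit ->
  pq * B = pr * B' -> B * b = b * B -> pq * b = b * pq -> pr * b = b * pr ->
  B * pq = pq * B -> B * pr = pr * B -> B' * pr = pr * B' -> B' * b = b * B' ->
  B * (b * (pq * pr^-1)) = B' * b.
Proof.
move=> ur h Bb qb rb Bq Br B'r B'b.
by rewrite mulrA Bb -mulrA (mulrA B) Bq h -B'r mulrK// B'b.
Qed.

Lemma binc_comm X w k : GRing.comm X P -> GRing.comm X (binc P w k).
Proof. by move=> XP; apply: commrZ; exact: mxpoch_comm. Qed.

(** Identifies the k-th hypergeometric term with the k-th integrated term without dividing by B(Q,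
    S); only (R)_(q k) is inverted. *)
Lemma mxBeta_term k : mxBeta Q S * term k = mxBeta (Q + (q * k)%:R%:M) S * binc P z k.
Proof.
have Qks := positive_stable_natD (n := (q * k)%N) Qs.
have QR : GRing.comm Q (Q + S) by apply: commrD; [exact: commr_refl|exact: QS].
have SQ := commr_sym QS; have QP := commr_sym PQ; have SP := commr_sym PS.
have SR : GRing.comm S (Q + S) by apply: commrD; [exact: SQ|exact: commr_refl].
have cB X : GRing.comm X Q -> GRing.comm X S -> GRing.comm (mxBeta Q S) X.
  by move=> XQ XS; apply: commr_sym; exact: mxBeta_comm.
have cB' X : GRing.comm X Q -> GRing.comm X S ->
    GRing.comm (mxBeta (Q + (q * k)%:R%:M) S) X.
  move=> XQ XS; apply: commr_sym; apply: mxBeta_comm => //.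
  by apply: commrD => //; exact: comm_scalar.
have pq X : GRing.comm X Q -> GRing.comm (mxpoch Q (q * k)) X.
  by move=> h; apply: commr_sym; exact: mxpoch_comm.
have pr X : GRing.comm X (Q + S) -> GRing.comm (mxpoch (Q + S) (q * k)) X.
  by move=> h; apply: commr_sym; exact: mxpoch_comm.
have PR : GRing.comm P (Q + S) by exact: commrD.
apply: (ring_beta_term (mxpoch_unit _ Rs) (mxBeta_poch _ Qs Ss QS)).
- by apply: binc_comm; apply: cB.
- by apply: binc_comm; apply: pq.
- by apply: binc_comm; apply: pr.
- by apply: mxpoch_comm; apply: cB; [exact: commr_refl|exact: QS].
- by apply: mxpoch_comm; apply: cB; apply: commr_sym.
- by apply: mxpoch_comm; apply: cB'; apply: commr_sym.
- by apply: binc_comm; apply: cB'.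
Qed.

Definition euler_kernel u : M := beta_kernel Q S u * cpowmx (1 - z * u%:C ^+ q) (- P).

(** Dominated convergence on the partial sums: the Beta majorant times the uniform bound on binomial
    partial sums dominates them all. *)
Lemma euler_integral : (0 < q)%N -> cmod z < 1 -> mxintegrable I01 euler_kernel /\
  mxcvg (fun n => mxBeta Q S * series (fun k => term k) n) (mxintegral I01 euler_kernel).
Proof.
move=> q0 z1; have mD := @itv01_measurable K.
pose F n u := series (euler_term ^~ u) n.
have Fi n := mxintegral_series n mD (fun k => (euler_term_integral k).1).
have FE n u : F n u = beta_kernel Q S u * series (binc P (z * u%:C ^+ q)) n.
  by rewrite /F !seriesEord /= mulr_sumr.
have IF n : mxintegral I01 (F n) = mxBeta Q S * series (fun k => term k) n.
  rewrite (Fi n).2 !seriesEord /= mulr_sumr; apply: eq_bigr => k _.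
  exact: etrans (euler_term_integral k).2 (esym (mxBeta_term k)).
have [a [b [C [a0 b0 C0 hC]]]] := beta_kernel_bound Qs Ss.
have [C' [C'0 hC']] := binc_series_bound P z1.
have uq u : I01 u -> cmod (u%:C ^+ q) < 1.
  rewrite /= in_itv/= => /andP[u0 u1]; rewrite cmodX cmod_real ger0_norm ?ltW//.
  by rewrite exprn_ilt1// ?ltW// -lt0n.
have [|||//|h1 h2] := @mxDCT _ _ I01 F euler_kernel
  (fun u => (C * C') * (u `^ (a - 1) + (1 - u) `^ (b - 1))) mD.
- by move=> n; apply: mxintegrable_mxmeas; exact: (Fi n).1.
- move=> u uI; have zu : cmod (z * u%:C ^+ q) < 1.
    rewrite cmodM; apply: le_lt_trans z1; rewrite ler_piMr ?cmod_ge0// ltW//.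
    exact: uq.
  have := mxcvgM (mxcvg_cst (beta_kernel Q S u)) (binomial_series P zu).
  by apply: mxcvg_near; apply: nearW => n; rewrite FE.
- move=> n u uI; rewrite FE mulrAC; apply: (le_trans (nrmM _ _)); rewrite ler_pM ?nrm_ge0//.
    exact: hC.
  by apply: hC'; apply: ltW; exact: uq.
- exact: integrable_beta_boundZ.
split => //; apply: mxcvg_near h2; apply: nearW => n; exact: IF.
Qed.

Lemma ring_gamma_quotient (T : unitRingType) (gr gq gs B : T) :
  gq \is a GRing.unit -> gs \is a GRing.unit -> gr * B = gq * gs ->
  gr * gq = gq * gr -> gr * gs = gs * gr -> gq * gs = gs * gq ->
  gr * gq^-1 * gs^-1 * B = 1.
Proof.
move=> uq us h rq rs qs.
rewrite (commrV rq) -(mulrA gq^-1 gr) (commrV rs) -!mulrA h qs (mulrA gs^-1) mulVr// mul1r.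
by rewrite mulVr.
Qed.

(** Exhibits the prefactor as a left inverse of B(Q, S), in the order of factors of the final
    statement. *)
Lemma gamma_quotient :
  mxGamma (Q + S) * (mxGamma Q)^-1 * (mxGamma S)^-1 * mxBeta Q S = 1.
Proof.
have QR : GRing.comm (Q + S) Q.
  by apply: commr_sym; apply: commrD; [exact: commr_refl|exact: QS].
have SR : GRing.comm (Q + S) S.
  by apply: commr_sym; apply: commrD; [exact: commr_sym|exact: commr_refl].
apply: (ring_gamma_quotient (mxGamma_unit Qs) (mxGamma_unit Ss) (beta_gamma Qs Ss Rs QS)).
- by apply: mxGamma_comm => //; apply: commr_sym; apply: mxGamma_comm => //; exact: commr_sym.
- by apply: mxGamma_comm => //; apply: commr_sym; apply: mxGamma_comm => //; exact: commr_sym.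
- by apply: mxGamma_comm => //; apply: commr_sym; apply: mxGamma_comm => //; exact: commr_sym.
Qed.

Lemma euler_series : (0 < q)%N -> cmod z < 1 ->
  mxcvg (series (fun k => term k))
    (mxGamma (Q + S) * (mxGamma Q)^-1 * (mxGamma S)^-1 * mxintegral I01 euler_kernel).
Proof.
move=> q0 z1; have [_ h] := euler_integral q0 z1.
apply: (mxcvg_near _ (mxcvgM (mxcvg_cst _) h)); apply: nearW => n.
exact: (etrans (mulrA _ _ _) (etrans (congr1 (fun X => X * _) gamma_quotient) (mul1r _))).
Qed.

End Coefficients.
End EulerIntegral.

Theorem theorem2p5 (K : realType) (N q : nat) (P Q R : 'M[K[i]]_N) (z : K[i])
    (q_ge1 : (1 <= q)%N)
    (PQ : comm_mx P Q) (PR : comm_mx P R) (QR : comm_mx Q R)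
    (Qstable : positive_stable Q) (Rstable : positive_stable R)
    (RQstable : positive_stable (R - Q))
    (z_lt1 : `|z| < 1) :
  let Ps := P :: mxsplit q Q in
  let Qs := mxsplit q R in
  let integrand := fun u : K =>
    cpowmx u%:C (Q - 1%:M) *m cpowmx (1 - u%:C) (R - Q - 1%:M) *m
      cpowmx (1 - z * u%:C ^+ q) (- P) in
  [/\ cvgn (series (hyp_term Ps Qs z)),
      mxintegrable `]0, 1[ integrand &
      hyp Ps Qs z =
        mxGamma R *m invmx (mxGamma Q) *m invmx (mxGamma (R - Q)) *m
          mxintegral `]0, 1[ integrand].
Proof.
(* In size 0 all matrices coincide and there are no entries to integrate. *)
case: N P Q R PQ PR QR Qstable Rstable RQstable => [|m] P Q R PQ PR QR Qs Rs Ss.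
  move=> Ps Qqs integrand; split.
  - have -> : series (hyp_term Ps Qqs z) = fun=> 0 by apply/funext => n; exact: flatmx0.
    exact: is_cvg_cst.
  - by case.
  - by rewrite [LHS]flatmx0 [RHS]flatmx0.
move=> Ps Qqs integrand.
have z1' : cmod z < 1 by rewrite -ltcR cmodC.
have PS : GRing.comm P (R - Q) by exact: commrB.
have QS : GRing.comm Q (R - Q) by apply: commrB => //; exact: commr_refl.
have RE : R = Q + (R - Q) by rewrite addrC subrK.
rewrite /Ps /Qqs /integrand => {Ps Qqs integrand}.
(* R - Q becomes an independent matrix S and R becomes Q + S, the form in which the Beta results are
   stated. *)
move: Rs Ss PS QS RE {PR QR}; move: (R - Q) => S Rs Ss PS QS RE; subst R.
have [h1 _] := euler_integral PQ PS QS Qs Ss Rs q_ge1 z1'.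
have h2 := euler_series PQ PS QS Qs Ss Rs q_ge1 z1'.
set integrand := fun u : K => _.
have ei : integrand = euler_kernel P Q S q z.
  by apply/funext => u; rewrite /integrand /euler_kernel /beta_kernel rmorphB.
have et : hyp_term (P :: mxsplit q Q) (mxsplit q (Q + S)) z = fun k => binc P z k *
    (mxpoch Q (q * k) * (mxpoch (Q + S) (q * k))^-1).
  apply/funext => k; exact: hyp_term_split.
rewrite -et in h2.
rewrite ei; split; last first.
- exact: mxcvg_limn h2.
- exact: h1.
- by apply/cvg_ex; eexists; exact: mxcvg_cvg h2.
Qed.
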